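(* Let $V$ be a finite-dimensional real Hilbert space with inner product $(\cdot|\cdot)$, let $V_{\mathbb C}=V\otimes\mathbb C$ carry the $\mathbb C$-bilinear extension of $(\cdot|\cdot)$, and let $\mu$ be the Gaussian probability measure on $V$. Let $Z_{x_*}$ be the graphical calculus (with formal variables $x_*$ on the ordinary vertices) of a Feynman algebra on $V_{\mathbb C}$ whose pairing is $(\cdot|\cdot)$. Let $S(x_*;v)$ be its potential. Then for any Feynman diagram $\Gamma$ the following equations hold: $$\langle\!\langle\Gamma\rangle\!\rangle=\int_V\frac{P_\Gamma(v)}{|\mathrm{Aut}\,\Gamma|}\,d\mu(v),$$ $$\langle\!\langle\Gamma\rangle\!\rangle_{x_*}=\int_V\frac{P_\Gamma(v)}{|\mathrm{Aut}\,\Gamma|}\,e^{S(x_*;v)}\,d\mu(v).$$ Explicitly, $$\sum_{[\Phi]\in\overline\Gamma}\frac{Z_{x_*}(\Phi)}{|\mathrm{Aut}\,\Phi|}=\int_V\frac{P_\Gamma(v)}{|\mathrm{Aut}\,\Gamma|}\,d\mu(v)$$ and $$\sum_{[\Phi]\in\mathcal F_\Gamma(0)}\frac{Z_{x_*}(\Phi)}{|\mathrm{Aut}\,\Phi|}=\int_V\frac{P_\Gamma(v)}{|\mathrm{Aut}\,\Gamma|}\,e^{S(x_*;v)}\,d\mu(v).$$ The second is an identity of formal power series in the variables $x_*$, and its right-hand side is integrated coefficientwise.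
   Context: **Colours.** Fix sets of colours $\mathsf{Co}$ (coupon), $\mathsf{Cy}$ (cyclic), $\mathsf{Sy}$ (symmetric), possibly depending on the valence. Each is split into disjoint subsets of *ordinary* and *special* colours. An injective map $\alpha\mapsto\boldsymbol\alpha$ from ordinary to special colours is given. For each valence $d$ there are only finitely many ordinary colours for $d$-valent vertices. Ordinary vertices have positive valence. **Feynman diagrams.** A Feynman diagram $\Gamma$ with $n$ legs is a finite $1$-dimensional CW-complex (loops and multiple edges allowed) with $n$ distinguished $1$-valent vertices called *endpoints*. The germs of edges at the endpoints are the legs of the diagram. Every other ( *internal* ) vertex $v$ is decorated with a colour, and the set $\mathrm{Leg}(v)$ of germs of edges at $v$ carries extra structure according to the type of the colour: - coupon vertex of type $(m,n)$: a splitting of $\mathrm{Leg}(v)$ into two totally ordered sets $\mathrm{In}(v)$, $\mathrm{Out}(v)$ of cardinalities $m$, $n$; - cyclic vertex: a cyclic order on $\mathrm{Leg}(v)$; - symmetric vertex: no extra structure. A vertex is ordinary or special according to its colour. Isomorphisms are homotopy classes of cellular isomorphisms preserving all the structure; the endpoints are not numbered and may be permuted. $\mathrm{Aut}\,\Gamma$ is the (finite) automorphism group. Gluing endpoints in pairs merges the corresponding edges into one edge (the glued points cease to be vertices). A circle without vertices may arise this way from edges of $\Gamma$ both of whose ends are endpoints. **Diagrams containing $\Gamma$.** $\mathcal F_\Gamma(0)$ is the groupoid whose objects are Feynman diagrams $\Psi$ without legs, containing $\Gamma$ as a distinguished sub-diagram and such that all vertices of $\Psi$ outside $\Gamma$ are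 ordinary. Here $\Psi$ is obtained by gluing all endpoints of $\Gamma$, via some bijection, to the endpoints of a diagram with the same number of legs and only ordinary internal vertices. Morphisms are isomorphisms of Feynman diagrams mapping the distinguished $\Gamma$ to itself (homotopies also being required to preserve $\Gamma$). $\overline\Gamma\subset\mathcal F_\Gamma(0)$ is the subgroupoid of *closures* of $\Gamma$: diagrams obtained by joining the legs of $\Gamma$ pairwise by edges in all possible ways (it is empty if $\Gamma$ has an odd number of legs). Sums over $[\Phi]$ run over isomorphism classes in these groupoids, and $\mathrm{Aut}\,\Phi$ is the automorphism group in the same groupoid. Objects of $\mathcal F_\Gamma(0)$ are graded by the sum of the valencies of their ordinary vertices; there are finitely many isomorphism classes in each degree. **Feynman algebra and graphical calculus.** A Feynman algebra on $V_{\mathbb C}$ compatible with $(\cdot|\cdot)$ is given by: - for each coupon colour $\alpha$ and type $(m,n)$, a tensor $T^\alpha_{m,n}:V_{\mathbb C}^{\otimes m}\to V_{\mathbb C}^{\otimes n}$; - for each cyclic colour $\beta$ and valence $n$, a $\mathbb Z/n\mathbb Z$-invariant linear map $C^\beta_n:V_{\mathbb C}^{\otimes n}\to\mathbb C$; - for each symmetric colour $\gamma$ and valence $n$, an $\mathfrak S_n$-invariant linear map $S^\gamma_n:V_{\mathbb C}^{\otimes n}\to\mathbb C$. An ordinary colour and its corresponding special colour have the same tensor. In $Z_{x_*}$, the tensor of each ordinary vertex is multiplied by an independent formal variable $x^\alpha_{m,n}$, $x^\beta_n$, $x^\gamma_n$ of degree equal to the valence of the vertex; tensors of special vertices are unchanged.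 Each vertex $v$ gives a multilinear form on copies of $V_{\mathbb C}$ indexed by $\mathrm{Leg}(v)$: for cyclic and symmetric vertices this is (the variable if ordinary, times) $C$ or $S$; for a coupon vertex it is (the variable if ordinary, times) $(u,w)\mapsto (T(u_1\otimes\cdots\otimes u_m)\,|\,w_1\otimes\cdots\otimes w_n)$, with $(\cdot|\cdot)$ extended factorwise to tensor powers. For a diagram $\Phi$ without legs, the amplitude $Z_{x_*}(\Phi)$ is obtained by taking the product of the forms of all vertices and contracting, for every edge, the two slots at its ends with the co-pairing $\sum_{i,j}g^{ij}e_i\otimes e_j$. Here $(e_i)$ is a basis of $V$ and $(g^{ij})$ is the inverse of the matrix $((e_i|e_j))$; a circle without vertices contributes $\dim V$. For a diagram $\Gamma$ with $n$ legs, $P_\Gamma(v)$ is obtained in the same way, except that the vector $v$ is inserted in the slot at the internal-vertex end of each edge with exactly one endpoint of $\Gamma$, and each edge joining two endpoints of $\Gamma$ contributes $(v|v)$. So $P_\Gamma$ is a homogeneous polynomial of degree $n$ in $v$ with coefficients in $\mathbb C[x_*]$. **Expectation values.** $\langle\!\langle\Gamma\rangle\!\rangle:=\sum_{[\Phi]\in\overline\Gamma}Z_{x_*}(\Phi)/|\mathrm{Aut}\,\Phi|\in\mathbb C[x_*]$ and $\langle\!\langle\Gamma\rangle\!\rangle_{x_*}:=\sum_{[\Phi]\in\mathcal F_\Gamma(0)}Z_{x_*}(\Phi)/|\mathrm{Aut}\,\Phi|\in\mathbb C[[x_*]]$. **Potential.** $S(x_*;v)$ is the sum of $P_{\mathsf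 v}(v)/|\mathrm{Aut}\,\mathsf v|$ over isomorphism classes of diagrams $\mathsf v$ consisting of a single ordinary vertex with its (unnumbered) legs, i.e. $$S(x_*;v)=\sum_{m,n,\alpha}x^\alpha_{m,n}\,(T^\alpha_{m,n}(v^{\otimes m})\,|\,v^{\otimes n})+\sum_{n,\beta}x^\beta_n\frac{C^\beta_n(v^{\otimes n})}{n}+\sum_{n,\gamma}x^\gamma_n\frac{S^\gamma_n(v^{\otimes n})}{n!},$$ with sums over ordinary colours. **Gaussian measure.** $d\mu(v)=e^{-\frac12(v|v)}dv\big/\int_Ve^{-\frac12(v|v)}dv$, for any nontrivial translation-invariant measure $dv$ on $V$. *)

(* Defs.v *)
From HB Require Import structures.
From mathcomp Require Import all_boot all_order all_fingroup all_algebra.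
From mathcomp Require Import all_classical all_reals all_analysis.
From mathcomp Require Import measurable_realfun.
From mathcomp Require Import complex sesquilinear ring lra.
From mathcomp Require monalg.

(* Without its notations: they clash with those of MathComp-Analysis. *)
Export -(notations) monalg.

Set Implicit Arguments.
Unset Strict Implicit.
Unset Printing Implicit Defensive.

Import Order.TTheory GRing.Theory Num.Theory.

Local Open Scope classical_set_scope.
Local Open Scope ring_scope.

(* The colours of each kind depend on the valence [d].  They are given as a
   finite type of ordinary colours ([o...]) and a disjoint type of special ones
   ([s...]); [b...] sends an ordinary colour to its special companion.  There
   is no ordinary colour in valence 0. *)
Record palette := Palette {
  oCo : nat -> finType; sCo : nat -> Type; bCo : forall d, oCo d -> sCo d;
  oCy : nat -> finType; sCy : nat -> Type; bCy : forall d, oCy d -> sCy d;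
  oSy : nat -> finType; sSy : nat -> Type; bSy : forall d, oSy d -> sSy d;
  bCo_inj : forall d, injective (@bCo d);
  bCy_inj : forall d, injective (@bCy d);
  bSy_inj : forall d, injective (@bSy d);
  oCo0 : #|oCo 0| = 0%N;
  oCy0 : #|oCy 0| = 0%N;
  oSy0 : #|oSy 0| = 0%N
}.

Definition Co (P : palette) d : Type := (oCo P d + sCo P d)%type.
Definition Cy (P : palette) d : Type := (oCy P d + sCy P d)%type.
Definition Sy (P : palette) d : Type := (oSy P d + sSy P d)%type.

(* The colour of a vertex, together with its type (m, k), resp. valence. *)
Inductive vcolour (P : palette) : Type :=
| Coupon m k of Co P (m + k)
| Cyclic k of Cy P k
| Symmetric k of Sy P k.
Arguments Coupon {P} m k _.
Arguments Cyclic {P} k _.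
Arguments Symmetric {P} k _.

(* The formal variables x^alpha_{m,k}, x^beta_k and x^gamma_k. *)
Definition var (P : palette) : choiceType :=
  ({mk : nat * nat & oCo P (mk.1 + mk.2)} + {k : nat & oCy P k}
   + {k : nat & oSy P k})%type.

(* [None] for the special colours. *)
Definition var_of (P : palette) (c : vcolour P) : option (var P) :=
  match c with
  | Coupon m k (inl a) =>
      Some (inl (inl
        (existT (fun mk : nat * nat => oCo P (mk.1 + mk.2) : Type) (m, k) a)))
  | Cyclic k (inl b) =>
      Some (inl (inr (existT (fun k => oCy P k : Type) k b)))
  | Symmetric k (inl g) => Some (inr (existT (fun k => oSy P k : Type) k g))
  | _ => None
  end.

Definition ordinary (P : palette) (c : vcolour P) : bool := isSome (var_of c).

Definition nin (P : palette) (c : vcolour P) : nat :=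
  match c with Coupon m _ _ => m | Cyclic k _ => k | Symmetric k _ => k end.

Definition nout (P : palette) (c : vcolour P) : nat :=
  if c is Coupon _ k _ then k else 0%N.

(* A finite 1-dimensional CW-complex is given by its internal vertices [vert],
   its endpoints [endp] and its germs of edges [flag].  Every edge has two ends,
   exchanged by [opp]; the germ [f] sits at the vertex [base f]; [leg p] is the
   unique germ at the endpoint [p].

   Leg(v) is listed by [ins v ++ outs v].  At a coupon, [ins v] and [outs v] are
   In(v) and Out(v) in increasing order.  At a cyclic vertex, [ins v] lists
   Leg(v) following the cyclic order, from an arbitrary starting point.  At a
   symmetric vertex, [ins v] is an arbitrary enumeration of Leg(v).  The
   arbitrary choices are not preserved by isomorphisms: see [same_order]. *)
Record diagram (P : palette) (vert endp flag : finType) := Diagram {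
  opp : flag -> flag;
  base : flag -> vert + endp;
  leg : endp -> flag;
  colour : vert -> vcolour P;
  ins : vert -> seq flag;
  outs : vert -> seq flag;
  oppK : involutive opp;
  opp_neq : forall f, opp f != f;
  legP : forall p f, (base f == inr p) = (f == leg p);
  star_uniq : forall v, uniq (ins v ++ outs v);
  starP : forall v f, (f \in ins v ++ outs v) = (base f == inl v);
  size_ins : forall v, size (ins v) = nin (colour v);
  size_outs : forall v, size (outs v) = nout (colour v)
}.

(* The germs of edges at the internal vertices. *)
Definition internal (P : palette) (vert endp flag : finType)
    (D : diagram P vert endp flag) (f : flag) : bool :=
  if base D f is inl _ then true else false.

Definition same_order (P : palette) (flag : eqType) (c : vcolour P)
    (s s' : seq flag) : Prop :=
  match c with
  | Coupon _ _ _ => s' = s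
  | Cyclic _ _ => exists i, s' = rot i s
  | Symmetric _ _ => perm_eq s' s
  end.

(* The homotopy class of a cellular isomorphism is determined by its action on
   vertices and germs of edges; a loop, or an edge joining two endpoints, may be
   reversed by a non-trivial automorphism. *)
Record is_iso (P : palette) (V E F V' E' F' : finType) (D : diagram P V E F)
    (D' : diagram P V' E' F') (fv : V -> V') (fe : E -> E') (ff : F -> F') :
    Prop := IsIso {
  iso_vert : bijective fv;
  iso_endp : bijective fe;
  iso_flag : bijective ff;
  iso_opp : forall f, ff (opp D f) = opp D' (ff f);
  iso_base : forall f, base D' (ff f) =
    match base D f with inl v => inl (fv v) | inr p => inr (fe p) end;
  iso_colour : forall v, colour D' (fv v) = colour D v;
  iso_ins : forall v, same_order (colour D v) (map ff (ins D v)) (ins D' (fv v));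
  iso_outs : forall v, outs D' (fv v) = map ff (outs D v)
}.

Definition aut_order (P : palette) (V E F : finType) (D : diagram P V E F) :
    nat :=
  #|[pred s : {perm V} * {perm E} * {perm F} |
      `[< is_iso D D s.1.1 s.1.2 s.2 >] ]|.

Section Glue.
Context (P : palette) (V1 V2 E F1 F2 : finType).
Variables (D1 : diagram P V1 E F1) (D2 : diagram P V2 E F2).

(* Every endpoint of [D1] is glued to the endpoint of [D2] with the same name.
   The germs of both diagrams together carry two involutions: [pre_opp] crosses
   an edge of [D1] or [D2], [jump] crosses a glued point. *)
Let F : finType := (F1 + F2)%type.

Definition pre_opp (f : F) : F :=
  match f with inl f1 => inl (opp D1 f1) | inr f2 => inr (opp D2 f2) end.

Definition jump (f : F) : F :=
  match f with
  | inl f1 => if base D1 f1 is inr p then inr (leg D2 p) else inl f1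
  | inr f2 => if base D2 f2 is inr p then inl (leg D1 p) else inr f2
  end.

Definition pre_base (f : F) : option (V1 + V2) :=
  match f with
  | inl f1 => if base D1 f1 is inl v then Some (inl v) else None
  | inr f2 => if base D2 f2 is inl v then Some (inr v) else None
  end.

Definition at_vertex (f : F) : bool := isSome (pre_base f).

(* Starting from a germ at a vertex, follow the edges and cross the glued points
   until a vertex is met again: this is the other end of the merged edge. *)
Definition cross (f : F) : F := pre_opp (jump f).

Definition other_end (f : F) : F :=
  let s := traject cross (cross f) #|F| in nth f s (find at_vertex s).

(* The circles without vertices are the components of the graph with edges
   [seam] none of whose germs sits at a vertex. *)
Definition seam : rel F := [rel f g | (g == pre_opp f) || (g == jump f)].

Definition circles : nat :=
  n_comp seam [pred f | [forall g, connect seam f g ==> ~~ at_vertex g]].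

Lemma at_vertex_jump f : at_vertex f = (jump f == f).
Proof.
by rewrite /at_vertex /jump; case: f => f /=; case: (base _ f) => p;
  rewrite ?eqxx.
Qed.

Lemma pre_oppK : involutive pre_opp.
Proof. by case=> f /=; rewrite oppK. Qed.

Lemma pre_opp_neq f : pre_opp f != f.
Proof. by case: f => f; apply/eqP => -[] /eqP; apply/negP/opp_neq. Qed.

Lemma jumpK : involutive jump.
Proof.
case=> f /=; case fp: (base _ f) => [v|p] /=; rewrite ?fp //.
- have /eqP -> : base D2 (leg D2 p) == inr p by rewrite legP.
  by move/eqP: fp; rewrite legP => /eqP ->.
- have /eqP -> : base D1 (leg D1 p) == inr p by rewrite legP.
  by move/eqP: fp; rewrite legP => /eqP ->.
Qed.

Lemma cross_inj : injective cross.
Proof. by move=> f g /(inv_inj pre_oppK) /(inv_inj jumpK). Qed.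

Lemma other_endP f : at_vertex f -> exists k,
  [/\ other_end f = iter k.+1 cross f, at_vertex (iter k.+1 cross f)
    & forall j, (j < k)%N -> ~~ at_vertex (iter j.+1 cross f)].
Proof.
move=> fv; rewrite /other_end; set s := traject _ _ _.
have sE j : (j < #|F|)%N -> nth f s j = iter j.+1 cross f.
  by move=> jF; rewrite /s (set_nth_default (cross f)) ?size_traject //
    nth_traject // -iterSr.
have sz : size s = #|F| by rewrite size_traject.
have hs : has at_vertex s.
  apply/hasP; exists f => //; apply/trajectP; exists (fingraph.order cross f).-1.
    by rewrite prednK ?order_gt0 // max_card.
  by rewrite -iterSr prednK ?order_gt0 // iter_order //; exact: cross_inj.
have ks : (find at_vertex s < #|F|)%N by rewrite -sz -has_find.
exists (find at_vertex s); split; first exact: sE.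
  by rewrite -sE // nth_find.
by move=> j jk; rewrite -sE ?(ltn_trans jk) // before_find.
Qed.

Lemma jump_iter_cross k f : at_vertex f -> at_vertex (iter k cross f) ->
  forall j, (j <= k)%N ->
    iter j cross (iter k cross f) = jump (iter (k - j) cross f).
Proof.
move=> fv kv; elim=> [_|j IHj jk].
  by rewrite subn0; move: kv; rewrite at_vertex_jump => /eqP.
rewrite iterS IHj ?(ltnW jk) // /cross jumpK -/cross.
by rewrite -(subnSK jk) iterS /cross pre_oppK.
Qed.

Lemma at_vertexJ f : at_vertex (jump f) = at_vertex f.
Proof. by rewrite !at_vertex_jump jumpK eq_sym. Qed.

Lemma other_endK f : at_vertex f -> other_end (other_end f) = f.
Proof.
move=> fv; have [k [-> kv klt]] := other_endP fv.
have [l [-> lv llt]] := other_endP kv.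
have rev := jump_iter_cross fv kv.
have ff : iter k.+1 cross (iter k.+1 cross f) = f.
  by rewrite rev // subnn; move: fv; rewrite at_vertex_jump => /eqP.
case: (ltngtP k l) => [kl|lk|<- //].
  by have := llt _ kl; rewrite ff fv.
have := klt (k - l.+1)%N; rewrite subnSK // => /(_ _)/negP; case.
  exact: leq_subr.
by rewrite -subSS -at_vertexJ -rev // ltnW.
Qed.

Lemma other_end_neq f : at_vertex f -> other_end f != f.
Proof.
move=> fv; have [k [-> kv klt]] := other_endP fv.
apply/eqP => kf; have rev := jump_iter_cross fv kv.
have [ke|ko] := boolP (odd k.+1).
  pose j := k./2; have kE : k.+1 = (j + j).+1.
    by rewrite addnn -[in LHS](odd_double_half k); move: ke => /= /negbTE ->.
  have := rev j; rewrite kf kE => /(_ (leqW (leq_addr _ _))).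
  rewrite -addnS addKn iterS => h.
  have := pre_opp_neq (jump (iter j cross f)).
  by rewrite -/(cross _) -[cross _]jumpK -h eqxx.
pose j := k.+1./2; have kE : k.+1 = (j + j)%N.
  by rewrite addnn -[in LHS](odd_double_half k.+1) (negbTE ko).
have j0 : (0 < j)%N by case: (j) kE.
have := rev j; rewrite kf kE leq_addl addnK => /(_ isT) h.
have := klt j.-1; rewrite prednK // at_vertex_jump -h eqxx => /(_ _)/negP; case=> //.
by rewrite -ltnS kE -[X in (X < _)%N]addn0 ltn_add2l.
Qed.

Definition glued_flag : finType := {f : F | at_vertex f}.

Definition glued_opp (f : glued_flag) : glued_flag := insubd f (other_end (val f)).

Definition oget T (o : option T) : isSome o -> T :=
  match o with Some x => fun=> x | None => fun h => False_rect T (notF h) end.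

Lemma ogetK T (o : option T) (h : isSome o) : Some (oget h) = o.
Proof. by case: o h. Qed.

Definition glued_base (f : glued_flag) : (V1 + V2) + void :=
  inl (oget (valP f)).

Definition restrict_flags (s : seq F) : seq glued_flag := pmap insub s.

Definition glued_colour (v : V1 + V2) : vcolour P :=
  match v with inl v => colour D1 v | inr v => colour D2 v end.

Definition pre_ins (v : V1 + V2) : seq F :=
  match v with inl v => map inl (ins D1 v) | inr v => map inr (ins D2 v) end.

Definition pre_outs (v : V1 + V2) : seq F :=
  match v with inl v => map inl (outs D1 v) | inr v => map inr (outs D2 v) end.

Definition glued_ins (v : V1 + V2) : seq glued_flag :=
  restrict_flags (pre_ins v).

Definition glued_outs (v : V1 + V2) : seq glued_flag :=
  restrict_flags (pre_outs v).

Lemma val_glued_opp f : val (glued_opp f) = other_end (val f).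
Proof.
rewrite /glued_opp val_insubd; have [k [-> -> _]] // := other_endP (valP f).
Qed.

Lemma glued_oppK : involutive glued_opp.
Proof.
by move=> f; apply: val_inj; rewrite !val_glued_opp other_endK ?(valP f).
Qed.

Lemma glued_opp_neq f : glued_opp f != f.
Proof. by rewrite -val_eqE val_glued_opp other_end_neq ?(valP f). Qed.

Lemma glued_legP (p : void) f : (glued_base f == inr p) = (f == of_void _ p).
Proof. by case: p. Qed.

Lemma glued_baseE f v : (glued_base f == inl v) = (pre_base (val f) == Some v).
Proof.
rewrite /glued_base; case: f => f fv /=; move: (valP _) => /= h.
by rewrite -{2}[pre_base f](ogetK h).
Qed.

Lemma mem_restrict_flags s f : (f \in restrict_flags s) = (val f \in s).
Proof.
rewrite /restrict_flags mem_pmap; apply/mapP/idP => [[x xs]|fs].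
  by case: insubP => // u _ ux [->]; rewrite ux.
by exists (val f); rewrite ?valK.
Qed.

Lemma val_restrict_flags s :
  all at_vertex s -> map val (restrict_flags s) = s.
Proof.
move=> /all_filterP sv; rewrite /restrict_flags pmap_filter; last exact: insubK.
rewrite -[RHS]sv; apply: eq_filter => f.
by case: insubP => // /negbTE ->.
Qed.

Lemma pre_starP v f :
  (f \in pre_ins v ++ pre_outs v) = (pre_base f == Some v).
Proof.
have inlr (T S : eqType) (s : seq T) (y : S) : (inr y \in map inl s) = false.
  by apply/mapP => -[].
have inrl (T S : eqType) (s : seq S) (x : T) : (inl x \in map inr s) = false.
  by apply/mapP => -[].
case: v => v; case: f => f; rewrite /= -map_cat ?inlr ?inrl.
- rewrite mem_map => [|x y [] //]; rewrite starP.
  by case: (base _ f).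
- by case: (base _ f).
- by case: (base _ f).
- rewrite mem_map => [|x y [] //]; rewrite starP.
  by case: (base _ f).
Qed.

Lemma pre_star_at_vertex v :
  all at_vertex (pre_ins v) /\ all at_vertex (pre_outs v).
Proof.
apply/andP; rewrite -all_cat; apply/allP => f.
by rewrite pre_starP /at_vertex => /eqP ->.
Qed.

Lemma glued_star_uniq v : uniq (glued_ins v ++ glued_outs v).
Proof.
have [iv ov] := pre_star_at_vertex v.
rewrite -(map_inj_uniq val_inj) map_cat !val_restrict_flags //.
by case: v {iv ov} => v /=; rewrite -map_cat map_inj_uniq ?star_uniq // => x y [].
Qed.

Lemma glued_starP v f :
  (f \in glued_ins v ++ glued_outs v) = (glued_base f == inl v).
Proof.
by rewrite mem_cat !mem_restrict_flags -mem_cat pre_starP glued_baseE.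
Qed.

Lemma glued_size_ins v : size (glued_ins v) = nin (glued_colour v).
Proof.
rewrite -(size_map val) val_restrict_flags ?(pre_star_at_vertex v).1 //.
by case: v => v; rewrite /= size_map size_ins.
Qed.

Lemma glued_size_outs v : size (glued_outs v) = nout (glued_colour v).
Proof.
rewrite -(size_map val) val_restrict_flags ?(pre_star_at_vertex v).2 //.
by case: v => v; rewrite /= size_map size_outs.
Qed.

Definition glue : diagram P (V1 + V2)%type void glued_flag :=
  Diagram glued_oppK glued_opp_neq glued_legP glued_star_uniq glued_starP
    glued_size_ins glued_size_outs.

End Glue.

(* A diagram without legs containing a diagram G with endpoints [E], and all of
   whose other vertices are ordinary, is given by the complement [rest] of G,
   whose endpoints are identified with those of G by means of the bijection along
   which they are glued; the underlying diagram is [glue G rest].  The internal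
   vertices and the germs of [rest] are taken in ordinals, so that these objects
   form a small type; up to isomorphism this is no restriction. *)
Record extension (P : palette) (E : finType) := Extension {
  nvert : nat;
  nflag : nat;
  rest : diagram P 'I_nvert E 'I_nflag;
  rest_ordinary : forall v, ordinary (colour rest v)
}.

HB.instance Definition _ P E := gen_eqMixin (extension P E).
HB.instance Definition _ P E := gen_choiceMixin (extension P E).

Section Extensions.
Context (P : palette) (V E F : finType) (G : diagram P V E F).
Local Notation extension := (extension P E).

(* An isomorphism mapping [G] to itself, up to homotopies preserving [G], is a
   pair of isomorphisms, of [G] and of the complements, that agree on the
   endpoints. *)
Definition is_ext_iso (A B : extension) (gv : V -> V) (gf : F -> F)
    (fe : E -> E) (hv : 'I_(nvert A) -> 'I_(nvert B))
    (hf : 'I_(nflag A) -> 'I_(nflag B)) : Prop :=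
  is_iso G G gv fe gf /\ is_iso (rest A) (rest B) hv fe hf.

Definition ext_iso (A B : extension) : Prop :=
  exists gv gf fe hv hf, @is_ext_iso A B gv gf fe hv hf.

Definition ext_aut_order (A : extension) : nat :=
  #|[pred s : {perm V} * {perm F} * {perm E}
            * {perm 'I_(nvert A)} * {perm 'I_(nflag A)} |
      `[< is_ext_iso s.1.1.1.1 s.1.1.1.2 s.1.1.2 s.1.2 s.2 >] ]|.

(* The complement consists of edges only, which join the legs pairwise. *)
Definition closures : set extension := [set A | nvert A = 0%N].

End Extensions.

(* One representative of each isomorphism class met by [A]. *)
Definition iso_classes (T : choiceType) (iso : T -> T -> Prop) (A : set T) :
  set T := [set xget x [set y | iso x y] | x in A].

Section Tensors.
Context (R : realType) (V : vectType R) (ip : {dot V for idfun}).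
Context (n : nat) (e : n.-tuple V).

(* Coordinates, with respect to the basis [e] of V, of the elements of V_C and
   of its m-th tensor power. *)
Definition vecC : Type := {ffun 'I_n -> R[i]}.
Definition tensC (m : nat) : Type := {ffun m.-tuple 'I_n -> R[i]^o}.

HB.instance Definition _ := GRing.Zmodule.on vecC.
HB.instance Definition _ m := GRing.Lmodule.on (tensC m).

Definition to_vecC (v : V) : vecC := [ffun i => (coord e i v)%:C%C].

(* u_0 (x) ... (x) u_(m-1) *)
Definition pure (m : nat) (us : seq vecC) : tensC m :=
  [ffun I : m.-tuple 'I_n => \prod_(k < m) (us`_k : vecC) (tnth I k)].

Definition gram : 'M[R]_n := \matrix_(i, j) ip e`_i e`_j.

(* The bilinear extension of the inner product to tensor powers. *)
Definition tens_pairing (m : nat) (s t : tensC m) : R[i] :=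
  \sum_(I : m.-tuple 'I_n) \sum_(J : m.-tuple 'I_n)
    s I * t J * \prod_(k < m) (gram (tnth I k) (tnth J k))%:C%C.

(* A tensor that is invariant under these permutations of pure tensors is
   invariant, since pure tensors span. *)
Record feynman_algebra (P : palette) := FeynmanAlgebra {
  coT : forall m k, Co P (m + k) -> {linear tensC m -> tensC k};
  cyT : forall k, Cy P k -> {scalar tensC k};
  syT : forall k, Sy P k -> {scalar tensC k};
  cyT_rot : forall k b (us : k.-tuple vecC),
    @cyT k b (pure k (rot 1 us)) = @cyT k b (pure k us);
  syT_perm : forall k g (us : k.-tuple vecC) (s : {perm 'I_k}),
    @syT k g (pure k [tuple tnth us (s i) | i < k]) = @syT k g (pure k us);
  coT_special : forall m k (a : oCo P (m + k)),
    @coT m k (inl a) =1 @coT m k (inr (bCo a));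
  cyT_special : forall k (b : oCy P k), @cyT k (inl b) =1 @cyT k (inr (bCy b));
  syT_special : forall k (g : oSy P k), @syT k (inl g) =1 @syT k (inr (bSy g))
}.

Context (P : palette) (A : feynman_algebra P).

(* C[x_*] *)
Definition xpoly : Type := malg (cmonom (var P)) R[i].

HB.instance Definition _ := GRing.ComNzRing.on xpoly.
HB.instance Definition _ := GRing.Lmodule.on xpoly.

Definition vertex_weight (c : vcolour P) : xpoly :=
  if var_of c is Some w then mkmalgU (ucm w) 1 else 1.

(* The multilinear form of a vertex, at the vectors sitting in its slots. *)
Definition vertex_form (c : vcolour P) (us ws : seq vecC) : R[i] :=
  match c with
  | Coupon m k a => tens_pairing (coT A a (pure m us)) (pure k ws)
  | Cyclic k b => cyT A b (pure k us)
  | Symmetric k g => syT A g (pure k us)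
  end.

Section Amplitude.
Context (vert endp flag : finType) (D : diagram P vert endp flag).

(* The germs of the edges joining two internal vertices. *)
Definition inner (f : flag) : bool := internal D f && internal D (opp D f).

(* Contraction is a sum over the labellings [l] of the slots at the ends of the
   inner edges by basis vectors.  The remaining slots receive [v]. *)
Definition slot (v : V) (l : {ffun flag -> option 'I_n}) (f : flag) : vecC :=
  to_vecC (if l f is Some i then e`_i else v).

Definition edge_weight (v : V) (l : {ffun flag -> option 'I_n}) (f : flag) :
    R[i] :=
  match l f, l (opp D f) with
  | Some i, Some j => (invmx gram i j)%:C%C
  | _, _ =>
      if internal D f || internal D (opp D f) then 1 else (ip v v)%:C%C
  end.

(* P_D(v); the vector [v] is irrelevant when D has no legs.  The first product
   has one factor for every edge. *)
Definition amplitude (v : V) : xpoly :=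
  \sum_(l : {ffun flag -> option 'I_n} | [forall f, isSome (l f) == inner f])
    (\prod_(f | (enum_rank f < enum_rank (opp D f))%N) edge_weight v l f) *:
    \prod_(x : vert)
      (vertex_form (colour D x) (map (slot v l) (ins D x))
        (map (slot v l) (outs D x)) *: vertex_weight (colour D x)).

End Amplitude.

Section Expectation.
Context (vert endp flag : finType) (G : diagram P vert endp flag).

Definition Z (B : extension P endp) : xpoly :=
  ((\dim {:V})%:R ^+ circles G (rest B) : R[i]) *: amplitude (glue G (rest B)) 0.

(* <<G>> *)
Definition expect_closures : xpoly :=
  \sum_(B \in iso_classes (ext_iso G) (@closures P endp))
    ((ext_aut_order G B)%:R^-1 *: Z B).

(* <<G>>_{x_*}, coefficientwise *)
Definition expect (M : cmonom (var P)) : R[i] :=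
  \sum_(B \in iso_classes (ext_iso G) [set: extension P endp])
    ((ext_aut_order G B)%:R^-1 * mcoeff M (Z B)).

End Expectation.

(* C[[x_*]]: a series is the family of its coefficients. *)
Definition xseries : Type := cmonom (var P) -> R[i].

Definition ser_of_poly (p : xpoly) : xseries := fun M => mcoeff M p.

Definition ser_one : xseries := fun M => (M == onecm _)%:R.

Definition ser_mul (f g : xseries) : xseries := fun M =>
  \sum_(p \in [set p : cmonom (var P) * cmonom (var P) | mulcm p.1 p.2 = M])
    (f p.1 * g p.2).

(* The sum over [k] is finite when [f] has no constant term, as is the case of
   the potential. *)
Definition ser_exp (f : xseries) : xseries := fun M =>
  \sum_(k \in [set: nat]) (iter k (ser_mul f) ser_one M / k`!%:R).

(* The coefficient in S(x_*; v) of the variable [w]. *)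
Definition potential_coef (v : V) (w : var P) : R[i] :=
  let u := to_vecC v in
  match w with
  | inl (inl (existT mk a)) =>
      tens_pairing (@coT _ A mk.1 mk.2 (inl a) (pure mk.1 (nseq mk.1 u)))
        (pure mk.2 (nseq mk.2 u))
  | inl (inr (existT k b)) => @cyT _ A k (inl b) (pure k (nseq k u)) / k%:R
  | inr (existT k g) => @syT _ A k (inl g) (pure k (nseq k u)) / k`!%:R
  end.

Definition potential (v : V) : xseries := fun M =>
  \sum_(w \in [set: var P]) mcoeff M (mkmalgU (ucm w) (potential_coef v w)).

End Tensors.

(* V, to be endowed with the Borel sigma-algebra of the norm of [ip]. *)
Definition hilbert (R : realType) (V : vectType R) (ip : {dot V for idfun}) :
  Type := V.

HB.instance Definition _ R V ip := Choice.on (@hilbert R V ip).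
HB.instance Definition _ R V ip := isPointed.Build (@hilbert R V ip) (0 : V).

Section Gaussian.
Context (R : realType) (V : vectType R) (ip : {dot V for idfun}).

Local Notation hilbert := (hilbert ip).

Definition ip_open : set (set hilbert) := [set A | forall v : V, A v ->
  exists2 r : R, 0 < r & forall w : V, ip (w - v) (w - v) < r -> A w].

HB.instance Definition _ := @isMeasurable.Build (sigma_display ip_open)
  hilbert <<s ip_open >> (@sigma_algebra0 _ setT ip_open)
  (@sigma_algebraC _ ip_open) (@sigma_algebra_bigcup _ setT ip_open).

Definition translation_invariant (dv : set hilbert -> \bar R) : Prop :=
  forall (a : V) (A : set hilbert), measurable A ->
    dv [set v : V | A (v - a)] = dv A.

(* Neither zero nor infinite on bounded sets. *)
Definition nontrivial_measure (dv : set hilbert -> \bar R) : Prop :=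
  dv setT != 0%E /\ forall r : R, (dv [set v : V | (ip v v < r)%R] < +oo)%E.

Definition gauss_density (v : hilbert) : R := expR (- (ip v v / 2)).

Context (dv : {measure set hilbert -> \bar R}).

Definition gaussian (A : set hilbert) : \bar R :=
  ((\int[dv]_(v in A) (gauss_density v)%:E)
   * ((fine (\int[dv]_v (gauss_density v)%:E))^-1)%:E)%E.

Lemma ip_sqr_ge0 (v : V) : 0 <= ip v v.
Proof.
have [->|v0] := eqVneq v 0; first by rewrite linear0l.
by rewrite ltW // neq0_dnorm_gt0.
Qed.

Lemma ip_sqr_approx (t : R) (v w : V) : 0 < t ->
  t * ip (w - v) (w - v) <= (1 + t) * (t * ip w w + ip v v).
Proof.
move: v => d t0.
have C x y : ip x y = ip y x by rewrite (hermC ip) expr0 mul1r.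
have Zl x y : ip (t *: x) y = t * ip x y by rewrite linearZl_LR.
have Zr x y : ip x (t *: y) = t * ip x y by rewrite C Zl C.
have Dl x y z : ip (x + y) z = ip x z + ip y z by rewrite linearDl.
have Dr x y z : ip z (x + y) = ip z x + ip z y by rewrite linearDr.
have Nl x z : ip (- x) z = - ip x z by rewrite linearNl.
have Nr x z : ip z (- x) = - ip z x by rewrite linearNr.
have : 0 <= t * (t * ip w w) + t * ip w d + (t * ip w d + ip d d).
  rewrite [X in 0 <= X](_ : _ = ip (t *: w + d) (t *: w + d)) ?ip_sqr_ge0 //.
  by rewrite Dl !Dr !Zl !Zr (C d w).
have -> : ip (w - d) (w - d) = ip w w - ip w d - (ip w d - ip d d).
  by rewrite Dl !Dr !Nl !Nr (C d w) opprD opprK.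
by move: (ip w w) (ip w d) (ip d d) => a b c ?; nra.
Qed.

Lemma measurable_ip_sqr : measurable_fun setT (fun v : hilbert => ip v v).
Proof.
apply: (measurability _ (RGenOInfty.measurableE R)).
move=> _ [_ [a ->] <-]; rewrite setTI; apply: sub_sigma_algebra => v /=.
rewrite in_itv/= andbT => av.
have [a0|a0] := ltP a 0.
  by exists 1 => // w _ /=; rewrite in_itv/= andbT (lt_le_trans a0) ?ip_sqr_ge0.
set n := ip v v in av; pose t := (n - a) / (2 * (a + 1)).
have a1 : 0 < a + 1 by rewrite ltr_wpDl.
have t0 : 0 < t by rewrite divr_gt0 ?subr_gt0 // mulr_gt0.
have t1 : 0 < 1 + t by rewrite addr_gt0.
have tE : 2 * t * (a + 1) = n - a by rewrite /t; field; rewrite gt_eqF.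
pose r := t * (n - a) / (2 * (1 + t)).
have rE : 2 * ((1 + t) * r) = t * (n - a) by rewrite /r; field; rewrite gt_eqF.
exists r => [|w wr].
  by apply: divr_gt0; apply: mulr_gt0 => //; rewrite subr_gt0.
rewrite /= in_itv/= andbT ltNge; apply/negP => wa.
have := ip_sqr_approx (w - v) w t0; rewrite subKr -/n.
move: (ip w w) (ip (w - v) (w - v)) wa wr => W D wa wr.
have h1 : (1 + t) * (t * W + D) < (1 + t) * (t * a + r).
  rewrite ltr_pM2l //; apply: ler_ltD => //. by rewrite ler_pM2l.
move=> /le_lt_trans /(_ h1); apply/negP; rewrite -leNgt.
nra.
Qed.

Lemma measurable_gauss_density : measurable_fun setT gauss_density.
Proof.
apply: measurableT_comp => //; apply: measurableT_comp => //.
by apply: measurable_funM => //; exact: measurable_ip_sqr.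
Qed.

Let gaussian0 : gaussian set0 = 0%E.
Proof. by rewrite /gaussian integral_set0 mul0e. Qed.

Let gaussian_ge0 A : (0 <= gaussian A)%E.
Proof.
rewrite /gaussian mule_ge0 ?integral_ge0 // => [v _|].
  by rewrite lee_fin expR_ge0.
rewrite lee_fin invr_ge0 fine_ge0 // integral_ge0 // => v _.
by rewrite lee_fin expR_ge0.
Qed.

Let gaussian_sigma_additive : semi_sigma_additive gaussian.
Proof.
move=> A mA tA mUA; rewrite /gaussian ge0_integral_bigcup //=.
- rewrite muleC -nneseriesZl // => [|k _]; last first.
    by apply: integral_ge0 => v _; rewrite lee_fin expR_ge0.
  under eq_eseriesr do rewrite muleC.
  by apply: is_cvg_ereal_nneg_natsum_cond => k _ _; exact: gaussian_ge0.
- by apply: measurable_funTS; apply/measurable_EFinP;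
    exact: measurable_gauss_density.
- by move=> v _; rewrite lee_fin expR_ge0.
Qed.

HB.instance Definition _ := measure_function.isMeasure.Build _ _ _
  gaussian gaussian0 gaussian_ge0 gaussian_sigma_additive.

End Gaussian.

Section ComplexIntegral.
Context (R : realType) (d : measure_display) (T : measurableType d).
Context (mu : {measure set T -> \bar R}).

Definition cintegrable (f : T -> R[i]) : Prop :=
  mu.-integrable setT (EFin \o (fun x => complex.Re (f x)))
  /\ mu.-integrable setT (EFin \o (fun x => complex.Im (f x))).

Definition cintegral (f : T -> R[i]) : R[i] :=
  Complex (\int[mu]_x complex.Re (f x)) (\int[mu]_x complex.Im (f x)).

End ComplexIntegral.

(* Main.v *)
From HB Require Import structures.
Require Import Defs.
From mathcomp Require Import all_boot all_order all_fingroup all_algebra.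
From mathcomp Require Import -(notations) finmap.
From mathcomp Require Import all_classical all_reals all_analysis.
From mathcomp Require Import measurable_realfun.
From mathcomp Require Import complex sesquilinear ring lra.
(* The names of diagrams take precedence over those of the libraries. *)
Import Defs.

(** Choose an orthonormal basis [u] of V.  In this basis every edge of a diagram
    is contracted by requiring the labels of its two ends to be equal
    ([amplitude_orthonormal]), so that a diagram with endpoints [E] defines a
    tensor indexed by the maps from [E] to the basis, and gluing two diagrams
    multiplies and sums their tensors, each circle giving a factor dim V
    ([glue_contraction]).  The edges of a complement of G pair its germs.  For
    fixed labels of the germs, the number of pairings that join equal labels is
    the Gaussian expectation of the product of the coordinates of v at the
    labels: this is Wick's formula ([wick]), proved by Gaussian integration by
    parts.  Summed over the labels, the complements with given vertices and
    incidences therefore contribute the expectation of P_G(v) times the product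
    of the forms of their vertices at v ([sum_code_tensor]); multilinearity
    turns the sum over labels into insertions of v ([star_expansion]).

    It remains to count.  The sum over isomorphism classes, weighted by the
    inverse orders of the automorphism groups, is computed on the finite set of
    codes: the monomial under consideration determines the number k of vertices
    and the number nf of germs of a complement, and a code is a complement whose
    vertices and germs are the elements of two fixed sets of these sizes.  A
    code is the source of k! nf! |Aut G| isomorphisms, times the number of ways
    to list the germs at the cyclic and symmetric vertices of the target
    ([ext_class_count]), and each colouring of the vertices has nf! incidences
    ([card_skeletons]).  What is left over is 1 / |Aut G|, the factor 1 / k!,
    and for every vertex the factor 1, 1 / d or 1 / d! with which its form
    enters the potential.  The sum over the colourings of k vertices is hence a
    coefficient of S^k / k!, and of no other term of the exponential series
    ([ser_exp_potential]).  Closures are the case of the trivial monomial.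

    On the analytic side, translation invariance is used twice: it bounds the
    growth of the measure on cubes, which makes functions of exponential growth
    integrable, and it gives integration by parts, by comparing the Gaussian
    measure with its small translates. *)

Set Implicit Arguments.
Unset Strict Implicit.
Unset Printing Implicit Defensive.

Import Order.TTheory GRing.Theory Num.Theory.

Local Open Scope classical_set_scope.
Local Open Scope ring_scope.

(** * Orthonormal bases *)

Section InnerProduct.
Context (R : realType) (V : vectType R) (ip : {dot V for idfun}).

Lemma ipC x y : ip x y = ip y x.
Proof. by rewrite (hermC ip) expr0 mul1r. Qed.
Lemma ipZl a x y : ip (a *: x) y = a * ip x y.
Proof. by rewrite linearZl_LR. Qed.
Lemma ipZr a x y : ip x (a *: y) = a * ip x y.
Proof. by rewrite ipC ipZl ipC. Qed.
Lemma ipDl x y z : ip (x + y) z = ip x z + ip y z.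
Proof. by rewrite linearDl. Qed.
Lemma ipDr x y z : ip z (x + y) = ip z x + ip z y.
Proof. by rewrite linearDr. Qed.
Lemma ipBl x y z : ip (x - y) z = ip x z - ip y z.
Proof. by rewrite linearBl. Qed.
Lemma ip0l x : ip 0 x = 0.
Proof. by rewrite linear0l. Qed.
Lemma ip_suml (I : Type) (s : seq I) (Q : pred I) (F : I -> V) x :
  ip (\sum_(i <- s | Q i) F i) x = \sum_(i <- s | Q i) ip (F i) x.
Proof. by rewrite linear_sumlz. Qed.

Definition orthonormal_family n (u : 'I_n -> V) :=
  forall i j, ip (u i) (u j) = (i == j)%:R.

Lemma nth_map_enum_ord n (u : 'I_n -> V) (i : 'I_n) :
  [seq u j | j <- enum 'I_n]`_i = u i.
Proof. by rewrite (nth_map i) ?size_enum_ord // nth_ord_enum. Qed.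

Lemma orthonormal_free n (u : 'I_n -> V) :
  orthonormal_family u -> free [seq u i | i <- enum 'I_n].
Proof.
move=> ou; have -> : [seq u i | i <- enum 'I_n] = [tuple u i | i < n] by [].
apply/freeP => k k0 j.
have : ip (\sum_(i < n) k i *: [tuple u i | i < n]`_i) (u j) = 0.
  by rewrite k0 ip0l.
rewrite ip_suml (bigD1 j) //= big1 ?addr0 => [|i ij].
  by rewrite nth_map_enum_ord ipZl ou eqxx mulr1.
by rewrite nth_map_enum_ord ipZl ou (negbTE ij) mulr0.
Qed.

(** One more step of the Gram-Schmidt process. *)
Lemma orthonormal_extend n (u : 'I_n -> V) :
  orthonormal_family u -> (n < \dim {:V})%N ->
  exists u' : 'I_n.+1 -> V, orthonormal_family u'.
Proof.
move=> ou nV.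
have [w wV] : exists w, w \notin <<[seq u i | i <- enum 'I_n]>>%VS.
  have : ~~ (fullv <= <<[seq u i | i <- enum 'I_n]>>)%VS.
    apply/negP => /dimvS; apply/negP; rewrite -ltnNge (leq_ltn_trans _ nV) //.
    by rewrite (leq_trans (dim_span _)) // size_map size_enum_ord.
  by move=> /subvPn[w _ ww]; exists w.
pose w' := w - \sum_i ip w (u i) *: u i.
have w'0 : w' != 0.
  apply: contraNneq wV => /eqP; rewrite subr_eq0 => /eqP ->.
  by apply: rpred_sum => i _; apply: rpredZ; apply/memv_span/map_f; rewrite mem_enum.
have w'u i : ip w' (u i) = 0.
  rewrite ipBl ip_suml (bigD1 i) //= big1 ?addr0 => [|j ij].
    by rewrite ipZl ou eqxx mulr1 subrr.
  by rewrite ipZl ou (negbTE ij) mulr0.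
have w'gt0 : 0 < ip w' w' by rewrite neq0_dnorm_gt0.
pose u' (i : 'I_n.+1) : V :=
  if unlift ord_max i is Some j then u j else (Num.sqrt (ip w' w'))^-1 *: w'.
exists u' => i j; rewrite /u'.
case: unliftP => [i' ->|->]; case: unliftP => [j' ->|->].
- by rewrite ou (inj_eq lift_inj).
- by rewrite ipZr ipC w'u mulr0 eq_sym (negbTE (neq_lift _ _)).
- by rewrite ipZl w'u mulr0 (negbTE (neq_lift _ _)).
- rewrite ipZl ipZr eqxx mulrA -invfM -expr2 sqr_sqrtr ?ltW // mulVf //.
  by rewrite gt_eqF.
Qed.

Lemma orthonormal_basis_exists :
  exists u : 'I_(\dim {:V}) -> V, orthonormal_family u.
Proof.
suff H k : (k <= \dim {:V})%N -> exists u : 'I_k -> V, orthonormal_family u.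
  exact: H.
elim: k => [_|k IHk kV]; first by exists (fun=> 0) => -[].
by have [u ou] := IHk (ltnW kV); exact: (orthonormal_extend ou).
Qed.

Context (n : nat) (nV : n = \dim {:V}) (u : 'I_n -> V).
Hypothesis ou : orthonormal_family u.

Lemma orthonormal_expansion v : v = \sum_i ip v (u i) *: u i.
Proof.
have bu : basis_of {:V} [tuple u i | i < n].
  rewrite basisEfree orthonormal_free //= subvf /= size_map size_enum_ord.
  by rewrite nV.
have vE := coord_basis bu (memvf v).
rewrite {1}vE; apply: eq_bigr => i _; rewrite nth_map_enum_ord.
congr (_ *: _); rewrite {2}vE ip_suml (bigD1 i) //= big1 ?addr0 => [|j ij].
  by rewrite nth_map_enum_ord ipZl ou eqxx mulr1.
by rewrite nth_map_enum_ord ipZl ou (negbTE ij) mulr0.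
Qed.

Lemma parseval v w : ip v w = \sum_i ip v (u i) * ip w (u i).
Proof.
rewrite {1}(orthonormal_expansion v) ip_suml; apply: eq_bigr => i _.
by rewrite ipZl (ipC (u i)).
Qed.

Lemma coord_sqr_le i v : ip v (u i) ^+ 2 <= ip v v.
Proof.
rewrite [leRHS]parseval (bigD1 i) //= -expr2 lerDl.
by apply: sumr_ge0 => j _; rewrite -expr2 sqr_ge0.
Qed.

End InnerProduct.

(** * The Gaussian measure *)

Section GaussianMeasure.
Context (R : realType) (V : vectType R) (ip : {dot V for idfun}).
Context (n : nat) (nV : n = \dim {:V}) (u : 'I_n -> V).
Hypothesis ou : orthonormal_family ip u.
Context (dv : {measure set (hilbert ip) -> \bar R}).
Hypothesis dv_inv : translation_invariant dv.
Hypothesis dv_nontrivial : nontrivial_measure dv.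

Local Notation H := (hilbert ip).
Local Notation y i v := (ip (v : V) (u i)).

Lemma ip_open_measurable (A : set H) : ip_open A -> measurable A.
Proof. exact: sub_sigma_algebra. Qed.

Lemma measurable_coord i : measurable_fun setT (fun v : H => y i v).
Proof.
apply: (measurability _ (RGenOInfty.measurableE R)).
move=> _ [_ [a ->] <-]; rewrite setTI; apply: ip_open_measurable => v /=.
rewrite in_itv/= andbT => av.
exists ((y i v - a) ^+ 2) => [|w wr]; first by rewrite exprn_gt0 // subr_gt0.
rewrite /= in_itv/= andbT.
have := le_lt_trans (coord_sqr_le nV ou i (w - v)) wr.
rewrite ipBl ltNge => h; rewrite ltNge; apply: contra h => wa.
by move: (y i v) (y i w) av wa => p q; nra.
Qed.

Lemma measurable_shift (a : V) :
  measurable_fun setT (fun v : H => (v : V) + a : H).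
Proof.
apply: (@measurability _ _ _ _ _ _ (ip_open (ip := ip))) => //.
move=> _ [A oA <-]; rewrite setTI; apply: ip_open_measurable => v /= Av.
have [r r0 rA] := oA _ Av; exists r => // w wr; apply: rA.
by rewrite opprD addrACA subrr addr0.
Qed.

Lemma ge0_integral_shift (a : V) (f : H -> \bar R) :
  measurable_fun setT f -> (forall v, 0 <= f v)%E ->
  (\int[dv]_v f ((v : V) + a)%R = \int[dv]_v f v)%E.
Proof.
move=> mf f0.
have f0' : {in [set: H], forall v, 0 <= f v}%E by move=> v _; exact: f0.
have := ge0_integral_pushforward (measurable_shift a) dv measurableT mf f0'.
rewrite preimage_setT /comp => <-.
apply: (@eq_measure_integral _ _ _ setT dv); first exact: measurable_shift.
move=> ? A mA _.
rewrite /pushforward /= -(dv_inv (- a) mA); congr (dv _).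
by apply/seteqP; split => v /=; rewrite opprK.
Qed.

(** * Volume growth of an invariant measure *)

Definition cube (r : R) : set H := [set v | forall i, `|y i v| <= r].

Lemma measurable_cube r : measurable (cube r).
Proof.
have -> : cube r = \bigcap_(i in [set: 'I_n]) [set v : H | `|y i v| <= r].
  by apply/seteqP; split => v h i; [move=> _; exact: h|exact: (h i I)].
apply: fin_bigcap_measurable => // i _.
have : measurable_fun setT (fun v : H => `|y i v|).
  by apply: measurableT_comp => //; exact: measurable_coord.
move=> /(_ measurableT _ (measurable_itv `]-oo, r])); rewrite setTI.
congr measurable; apply/seteqP; split=> v /=; by rewrite in_itv.
Qed.

(** Halving every edge cuts a cube into [2 ^ n] translates of one cube. *)
Lemma cube_doubling (r : R) : 0 <= r ->
  (dv (cube (2 * r)) <= (2 ^ n)%:R%:E * dv (cube r))%E.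
Proof.
move=> r0.
pose c (b : {ffun 'I_n -> bool}) : V := \sum_i (if b i then r else - r) *: u i.
have yc b i : y i (c b) = if b i then r else - r.
  rewrite /c ip_suml (bigD1 i) //= big1 ?addr0 => [|j ji].
    by rewrite ipZl ou eqxx mulr1.
  by rewrite ipZl ou (negbTE ji) mulr0.
pose C b : set H := [set v : V | cube r (v - c b)].
have mC b : measurable (C b).
  have := @measurable_shift (- c b) measurableT (cube r) (measurable_cube r).
  by rewrite setTI.
have sub : cube (2 * r) `<=`
    \bigcup_(b in [set: {ffun 'I_n -> bool}]) C b.
  move=> v vr; exists [ffun i => 0 <= y i v] => //= i; rewrite /cube /C /=; rewrite ipBl yc ffunE.
  have := vr i; case: ifPn; rewrite -?ltNge !ler_norml => h; lra.
have h : (dv (cube (2 * r)) <= \sum_(b \in [set: {ffun 'I_n -> bool}]) dv (C b))%E.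
  apply: (@content_sub_fsum _ _ _ dv) => //; last exact: measurable_cube.
  exact: finite_finset.
apply: (le_trans h).
rewrite (eq_fsbigr (fun=> dv (cube r))); last first.
  by move=> b _; rewrite dv_inv //; exact: measurable_cube.
rewrite (fsbig_fwiden (enum {ffun 'I_n -> bool})) ?enum_uniq //; last first.
- by move=> b [+ /(_ I)].
- by move=> b _ /=; rewrite mem_enum.
rewrite [X in (X <= _)%E](_ : _ = (size (enum {ffun 'I_n -> bool}))%:R%:E * dv (cube r))%E.
  by rewrite -cardE card_ffun card_bool card_ord.
elim: (enum _) => [|b s IHs]; first by rewrite big_nil mul0e.
by rewrite big_cons IHs /= -natr1 EFinD addeC ge0_muleDl ?mul1e // lee_fin.
Qed.

Lemma dv_cube_pow2 j :
  (dv (cube (2 ^+ j)) <= ((2 ^ n)%:R ^+ j)%:E * dv (cube 1))%E.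
Proof.
elim: j => [|j IHj]; first by rewrite !expr0 mul1e.
rewrite !exprS; apply: le_trans (cube_doubling _) _; first exact: exprn_ge0.
by rewrite EFinM -muleA lee_pmul2l // lte_fin ltr0n expn_gt0.
Qed.

Lemma dv_cube1 : (dv (cube 1) < +oo)%E.
Proof.
apply: le_lt_trans (dv_nontrivial.2 (n%:R + 1)).
have mb r : measurable [set v : H | ip (v : V) v < r].
  have := @measurable_ip_sqr _ _ ip measurableT _ (measurable_itv `]-oo, r[).
  by rewrite setTI.
apply: le_measure.
- by apply/mem_set; exact: measurable_cube.
- by apply/mem_set; exact: mb.
move=> v v1 /=; rewrite (parseval nV ou).
apply: (@le_lt_trans _ _ (\sum_(i < n) 1)); last first.
  by rewrite sumr_const card_ord ltrDl.
apply: ler_sum => i _; have := v1 i.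
by rewrite -expr2 -real_normK ?num_real // => ?; rewrite exprn_ile1.
Qed.

(** [a k.+1] bounds [expR (- (ip v v / 4))] where some coordinate of [v] is at
    least [2 ^+ k]. *)
Let a j : R := if j is k.+1 then expR (- (4 ^+ k / 4)) else 1.

Let a_ge0 j : 0 <= a j.
Proof. by case: j => [|k] //=; rewrite expR_ge0. Qed.

Let a_le : exists K : R, forall j, (2 ^ n)%:R ^+ j * a j <= K / 2 ^+ j.
Proof.
(* The bound [x ^+ n.+1 / n.+1`! <= expR x] at [x = 4 ^+ k / 4] beats the volume
   [2 ^+ (n * k.+1)] by a power of 2. *)
pose K : R := (n.+1)`!%:R * 4 ^+ n.+1 * 2 ^+ n * 2.
have K1 : 1 <= K.
  rewrite /K; do !rewrite mulr_ege1 ?exprn_ege1 ?ler1n ?fact_gt0 //.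
exists K => -[|k]; first by rewrite !expr0 mul1r divr1.
pose x : R := 4 ^+ k / 4.
have x0 : 0 < x by rewrite divr_gt0 ?exprn_gt0.
have ax : a k.+1 <= (n.+1)`!%:R / x ^+ n.+1.
  rewrite /= expRN -[leRHS]invrK lef_pV2 ?posrE ?expR_gt0 //; last first.
    by rewrite invr_gt0 divr_gt0 ?exprn_gt0 // ltr0n fact_gt0.
  by rewrite invf_div; apply: le_trans (expR_ge1Dxn n (ltW x0)); rewrite lerDr.
apply: le_trans (ler_wpM2l _ ax) _; first by rewrite exprn_ge0.
have p2 : 0 < 2 ^+ k :> R by rewrite exprn_gt0.
have p2n : 1 <= (2 ^+ k) ^+ n :> R by rewrite !exprn_ege1 ?ler1n.
have x4 : x = 2 ^+ k * 2 ^+ k / 4 by rewrite /x -exprMn; congr (_ ^+ _ / _); lra.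
have -> : (2 ^ n)%:R ^+ k.+1 = 2 ^+ n * (2 ^+ k) ^+ n :> R.
  by rewrite natrX exprS -!exprM mulnC.
have xn : x ^+ n.+1 = (2 ^+ k * (2 ^+ k) ^+ n) * (2 ^+ k * (2 ^+ k) ^+ n) / 4 ^+ n.+1.
  by rewrite x4 expr_div_n exprMn -exprS.
have p1 : 1 <= 2 ^+ k :> R by rewrite exprn_ege1 ?ler1n.
have f0 : 0 < 4 ^+ n.+1 :> R by rewrite exprn_gt0.
have e0 : 0 < 2 ^+ n :> R by rewrite exprn_gt0.
have c0 : 0 < (n.+1)`!%:R :> R by rewrite ltr0n fact_gt0.
rewrite xn (exprS 2 k) /K.
move: (2 ^+ k) ((2 ^+ k) ^+ n) (2 ^+ n) (4 ^+ n.+1) (n.+1)`!%:R p2 p2n p1 f0 e0 c0.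
move=> p q e f c p0 q1 p1 f0 e0 c0.
have q0 : 0 < q by apply: lt_le_trans q1.
rewrite (_ : e * q * _ = c * f * e * 2 / (2 * p) / (p * q)); last first.
  by field; rewrite !gt_eqF.
rewrite ler_pdivrMr ?mulr_gt0 // ler_peMr ?mulr_ege1 //.
by rewrite ltW // !(mulr_gt0, invr_gt0).
Qed.

(** The cubes [cube (2 ^+ j)] exhaust the space and the density decays
    faster than any power of their size.  The Gaussian density is the square of
    this one; the other factor is kept to absorb exponentials. *)
Lemma quarter_density_lty : (\int[dv]_v (expR (- (ip (v : V) v / 4)))%:E < +oo)%E.
Proof.
have [K aK] := a_le.
pose F j (v : H) : \bar R := (a j * \1_(cube (2 ^+ j)) v)%:E.
have F0 j v : (0 <= F j v)%E by rewrite lee_fin mulr_ge0.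
have mF j : measurable_fun setT (F j).
  apply/measurable_EFinP; apply: measurable_funM => //.
  apply/measurable_indic; exact: measurable_cube.
apply: (@le_lt_trans _ _ (\int[dv]_v (\sum_(j <oo) F j v))%E).
  apply: ge0_le_integral => //.
  - apply/measurable_EFinP; apply: measurableT_comp => //.
    apply: measurableT_comp => //; apply: measurable_funM => //.
    exact: measurable_ip_sqr.
  - exact: ge0_emeasurable_sum.
  move=> v _.
  (* At [v], the term of the smallest cube containing it dominates the density. *)
  have exv : exists j, `[< cube (2 ^+ j) v >].
    have [N vN] : exists N : nat, ip (v : V) v <= 2 ^+ N.
      exists (Num.bound (ip (v : V) v)).
      apply/ltW/(lt_trans (archi_boundP (ip_sqr_ge0 _ _))).
      by rewrite -natrX ltr_nat ltn_expl.
    exists N; apply/asboolP => i; have := coord_sqr_le nV ou i v.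
    have : 1 <= 2 ^+ N :> R by rewrite exprn_ege1 ?ler1n.
    rewrite -[y i v ^+ 2]real_normK ?num_real //.
    by move: `|_| vN (normr_ge0 (y i v)) => z; nra.
  have [j jv jmin] := ex_minnP exv.
  apply: (@le_trans _ _ (F j v)).
    rewrite /F indicE mem_set; last exact/asboolP.
    rewrite mulr1 lee_fin; case: j jv jmin => [|k] jv jmin /=.
      by rewrite -expR0 ler_expR oppr_le0 divr_ge0 ?ip_sqr_ge0.
    rewrite ler_expR lerN2 ler_pM2r //.
    have : ~ cube (2 ^+ k) v by move=> /asboolP /jmin; rewrite ltnn.
    move=> /existsNP[i /negP]; rewrite -ltNge => iv.
    apply: le_trans (coord_sqr_le nV ou i v).
    rewrite -[y i v ^+ 2]real_normK ?num_real // expr2 (_ : 4 = 2 * 2 :> R).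
      by rewrite exprMn ler_pM ?exprn_ge0 // ltW.
    by rewrite -natrM.
  apply: le_trans (nneseries_lim_ge j.+1 _) => //.
  by rewrite big_nat_recr //= leeDr // sume_ge0.
rewrite integral_nneseries //.
have I j : (\int[dv]_v F j v <= (K / 2 ^+ j)%:E * dv (cube 1))%E.
  rewrite /F; under eq_integral do rewrite EFinM.
  rewrite ge0_integralZl //; last 2 first.
  - apply/measurable_EFinP/measurable_indic; exact: measurable_cube.
  - by rewrite lee_fin.
  rewrite integral_indic ?setIT //; last exact: measurable_cube.
  apply: le_trans (lee_wpmul2l _ (dv_cube_pow2 j)) _; first by rewrite lee_fin.
  by rewrite muleA -EFinM lee_wpmul2r // lee_fin mulrC.
have K0 : 0 <= K.
  have := aK 0%N; rewrite !expr0 mul1r divr1; exact: le_trans.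
apply: (@le_lt_trans _ _ ((2 * K)%:E * dv (cube 1))%E); last first.
  by rewrite lte_mul_pinfty ?lee_fin ?mulr_ge0 ?dv_cube1.
apply: lime_le; first by apply: is_cvg_nneseries => *; apply: integral_ge0.
apply: nearW => N.
apply: (@le_trans _ _ (\sum_(0 <= j < N) ((K / 2 ^+ j)%:E * dv (cube 1)))%E).
  by apply: lee_sum => j _.
rewrite -ge0_sume_distrl => [|j _]; last by rewrite lee_fin divr_ge0 ?exprn_ge0.
rewrite lee_wpmul2r // sumEFin lee_fin.
suff : \sum_(0 <= j < N) K / 2 ^+ j <= 2 * K - 2 * K / 2 ^+ N.
  move=> /le_trans; apply; rewrite gerBl divr_ge0 ?mulr_ge0 ?exprn_ge0 //.
elim: N => [|N IHN]; first by rewrite big_nil expr0 divr1 subrr.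
rewrite big_nat_recr //= (le_trans (lerD IHN (lexx _))) // exprS.
by have : 2 ^+ N != 0 :> R by [rewrite expf_neq0]; move: (2 ^+ N) => q q0; rewrite le_eqVlt; apply/orP; left; apply/eqP; field.
Qed.

End GaussianMeasure.

(** * Measures with a density *)

Section Density.
Context d (T : measurableType d) (R : realType).
Context (mu nu : {measure set T -> \bar R}) (g : T -> R).
Hypothesis mg : measurable_fun setT g.
Hypothesis g0 : forall x, 0 <= g x.
Hypothesis nuE : forall B, measurable B ->
  nu B = (\int[mu]_(x in B) (g x)%:E)%E.

Import HBNNSimple.

Local Open Scope ereal_scope.

Lemma integral_density_nnsfun (h : {nnsfun T >-> R}) :
  \int[nu]_x (h x)%:E = \int[mu]_x ((h x)%:E * (g x)%:E).
Proof.
have mh r : measurable (h @^-1` [set r]) by [].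
transitivity (\int[nu]_x
    (\sum_(r \in range h) (r * \1_(h @^-1` [set r]) x)%:E)).
  by apply: eq_integral => x _; rewrite fsumEFin // -fimfunE.
rewrite ge0_integral_fsum //; last first.
- by move=> r x _; exact: nnfun_muleindic_ge0.
- by move=> r; apply/measurable_EFinP; exact: measurable_funM.
transitivity (\int[mu]_x
    (\sum_(r \in range h) ((r * \1_(h @^-1` [set r]) x)%:E * (g x)%:E))); last first.
  apply: eq_integral => x _; rewrite -ge0_mule_fsuml => [|r]; last first.
    exact: nnfun_muleindic_ge0.
  by rewrite fsumEFin // -fimfunE.
rewrite ge0_integral_fsum //; last first.
- by move=> r x _; rewrite mule_ge0 ?lee_fin // -lee_fin; exact: nnfun_muleindic_ge0.
- move=> r; apply: emeasurable_funM; apply/measurable_EFinP => //.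
  exact: measurable_funM.
apply: eq_fsbigr => r /[!inE] -[x _ <-].
under eq_integral do rewrite EFinM.
under [RHS]eq_integral do rewrite EFinM -muleA -[X in _ * X]EFinM.
have hx0 : 0 <= (h x)%:E by rewrite lee_fin fun_ge0.
have mi : measurable_fun setT (\1_(h @^-1` [set h x]) : T -> R).
  exact: measurable_indic.
rewrite !ge0_integralZl //; try exact/measurable_EFinP.
all: try by apply/measurable_EFinP; exact: measurable_funM.
all: try by move=> z _; rewrite lee_fin mulr_ge0.
congr (_ * _); rewrite integral_indic // setIT nuE // [LHS]integral_mkcond.
apply: eq_integral => z _; rewrite patchE indicE.
by case: ifP => _; rewrite ?mul1r ?mul0r.
Qed.

(** By definition the measure [nu] has density [g] on sets only; simple functions
    and monotone convergence extend this to integrals. *)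
Lemma ge0_integral_density (f : T -> \bar R) :
  measurable_fun setT f -> (forall x, 0 <= f x) ->
  \int[nu]_x f x = \int[mu]_x (f x * (g x)%:E).
Proof.
move=> mf f0; pose h := nnsfun_approx measurableT mf.
have hf x : (h k x)%:E @[k --> \oo] --> f x by exact: cvg_nnsfun_approx.
have mh k : measurable_fun setT (EFin \o h k) by exact/measurable_EFinP.
have ndh x : {homo (fun k => h k x) : a b / (a <= b)%N >-> (a <= b)%R}.
  by move=> a b ab; exact/lefP/nd_nnsfun_approx.
transitivity (limn (fun k => \int[nu]_x (h k x)%:E)).
  rewrite -monotone_convergence //.
  - by apply: eq_integral => x _; apply/esym/cvg_lim.
  - by move=> k x _; rewrite lee_fin.
  - by move=> x _ a b ab; rewrite lee_fin; exact: ndh.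
under eq_fun do rewrite integral_density_nnsfun.
rewrite -monotone_convergence //.
- apply: eq_integral => x _; apply/cvg_lim => //.
  by apply: cvgeZr => //; exact: hf.
- by move=> k; apply: emeasurable_funM => //; exact/measurable_EFinP.
- by move=> k x _; rewrite mule_ge0 ?lee_fin.
- by move=> x _ a b ab; rewrite lee_wpmul2r ?lee_fin //; exact: ndh.
Qed.

End Density.

(** * The Gaussian integral *)

Section GaussianIntegral.
Context (R : realType) (V : vectType R) (ip : {dot V for idfun}).
Context (n : nat) (nV : n = \dim {:V}) (u : 'I_n -> V).
Hypothesis ou : orthonormal_family ip u.
Context (dv : {measure set (hilbert ip) -> \bar R}).
Hypothesis dv_inv : translation_invariant dv.
Hypothesis dv_nontrivial : nontrivial_measure dv.

Local Notation H := (hilbert ip).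
Local Notation y i v := (ip (v : V) (u i)).
Local Notation gamma := (gaussian dv).
Local Notation dens := (@gauss_density R V ip).

Let mass : R := fine (\int[dv]_v (dens v)%:E).

Let dens_ge0 v : 0 <= dens v. Proof. exact: expR_ge0. Qed.

Let mdens : measurable_fun setT dens.
Proof. exact: measurable_gauss_density. Qed.

Lemma measurable_quarter_density :
  measurable_fun setT (fun v : H => expR (- (ip (v : V) v / 4))).
Proof.
apply: measurableT_comp => //; apply: measurableT_comp => //.
by apply: measurable_funM => //; exact: measurable_ip_sqr.
Qed.

Lemma dens_lty : (\int[dv]_v (dens v)%:E < +oo)%E.
Proof.
apply: le_lt_trans (quarter_density_lty nV ou dv_inv dv_nontrivial).
apply: ge0_le_integral => //.
- by move=> v _; rewrite lee_fin.
- exact/measurable_EFinP.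
- apply/measurable_EFinP; exact: measurable_quarter_density.
move=> v _; rewrite lee_fin ler_expR lerN2 ler_wpM2l ?ip_sqr_ge0 //.
by rewrite lef_pV2 ?posrE //; lra.
Qed.

(** A positive function of integral zero would make the measure vanish. *)
Lemma dens_neq0 : (\int[dv]_v (dens v)%:E != 0)%E.
Proof.
apply/eqP => int0; have /negP := dv_nontrivial.1; apply.
have mdensE : measurable_fun setT (EFin \o dens) by exact/measurable_EFinP.
have int0' : (\int[dv]_(v in setT) `|(EFin \o dens) v| = 0)%E.
  by rewrite -[RHS]int0; apply: eq_integral => v _; rewrite gee0_abs // lee_fin.
have := (ae_eq_integral_abs dv measurableT mdensE).1 int0'.
move=> [N [mN N0 sub]].
have -> : [set: H] = N.
  apply/seteqP; split => // v _; apply: sub => /= /(_ I) /eqP.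
  by rewrite eqe gt_eqF // expR_gt0.
by rewrite N0.
Qed.

Let mass_gt0 : 0 < mass.
Proof.
rewrite fine_gt0 // dens_lty andbT lt_neqAle eq_sym dens_neq0 /=.
by apply: integral_ge0 => v _; rewrite lee_fin.
Qed.

Lemma ge0_integral_gaussian (f : H -> \bar R) :
  measurable_fun setT f -> (forall v, 0 <= f v)%E ->
  (\int[gamma]_v f v = mass^-1%:E * \int[dv]_v (f v * (dens v)%:E))%E.
Proof.
move=> mf f0.
rewrite (@ge0_integral_density _ _ _ dv gamma (fun v => mass^-1 * dens v)) //; last first.
- move=> B mB.
  transitivity (mass^-1%:E * \int[dv]_(v in B) (dens v)%:E)%E; first exact: muleC.
  under [RHS]eq_integral do rewrite EFinM.
  rewrite ge0_integralZl //.
  + by apply/measurable_EFinP; exact: measurable_funTS.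
  + by move=> v _; rewrite lee_fin.
  + by rewrite lee_fin invr_ge0 (ltW mass_gt0).
- by move=> v; rewrite mulr_ge0 ?invr_ge0 ?(ltW mass_gt0).
- exact: measurable_funM.
under eq_integral do rewrite EFinM muleCA.
rewrite ge0_integralZl //.
- by apply: emeasurable_funM => //; exact/measurable_EFinP.
- by move=> v _; rewrite mule_ge0 ?lee_fin.
- by rewrite lee_fin invr_ge0 (ltW mass_gt0).
Qed.

(** The measure [dv] being invariant, only the density feels the translation. *)
Lemma ge0_integral_gaussian_shift (a : V) (f : H -> R) :
  measurable_fun setT f -> (forall v, 0 <= f v) ->
  (\int[gamma]_v (f v)%:E =
   \int[gamma]_v (f ((v : V) + a)%R * expR (- ip (v : V) a - ip a a / 2)%R)%:E)%E.
Proof.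
move=> mf f0.
have mfa : measurable_fun setT (fun v : H => f ((v : V) + a)).
  exact: (measurableT_comp mf (@measurable_shift _ _ ip a)).
have mipa : measurable_fun setT (fun v : H => ip (v : V) a).
  rewrite (_ : (fun v : H => _) = fun v : H => \sum_i y i v * ip a (u i)).
    apply: measurable_sum => i; apply: measurable_funM => //.
    exact: (measurable_coord nV ou).
  by apply/funext => v; exact: (parseval nV ou).
have mexp : measurable_fun setT
    (fun v : H => expR (- ip (v : V) a - ip a a / 2)).
  by apply: measurableT_comp => //; apply: measurable_funB => //; exact: measurableT_comp.
rewrite ge0_integral_gaussian => [|//|v]; last 2 first.
- exact/measurable_EFinP.
- by rewrite lee_fin.
rewrite ge0_integral_gaussian => [||v]; last 2 first.
- by apply/measurable_EFinP; exact: measurable_funM.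
- by rewrite lee_fin mulr_ge0 ?expR_ge0.
congr (_ * _)%E.
rewrite -(ge0_integral_shift dv_inv a); last 2 first.
- by apply: emeasurable_funM; exact/measurable_EFinP.
- by move=> v; rewrite mule_ge0 ?lee_fin.
apply: eq_integral => v _; rewrite -!EFinM -mulrA; congr (_ * _)%:E.
rewrite /gauss_density -expRD; congr expR.
by rewrite ipDl !ipDr (ipC _ a v); field.
Qed.

(** * Functions of exponential growth *)

(** A class of integrable functions that is closed under products and
    translations and contains the exponentials of linear forms. *)
Definition exp_growth (f : H -> R) := measurable_fun setT f /\
  exists2 c : R, 0 <= c &
    forall v, `|f v| <= expR (c * (1 + \sum_i `|y i v|)).

Let size1 v : 1 <= 1 + \sum_i `|y i v|.
Proof. by rewrite lerDl sumr_ge0. Qed.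

Lemma exp_growth_cst (k : R) : exp_growth (cst k).
Proof.
split=> //; exists `|k| => // v.
apply: le_trans (expR_ge1Dx _).
have := ler_peMr (normr_ge0 k) (size1 v); rewrite /=; lra.
Qed.

Lemma exp_growth_coord i : exp_growth (fun v => y i v).
Proof.
split; first exact: (measurable_coord nV ou).
exists 1 => // v; rewrite mul1r; apply: le_trans (expR_ge1Dx _).
rewrite (bigD1 i) //=; have : 0 <= \sum_(j < n | j != i) `|y j v| by apply: sumr_ge0.
by move: (\sum_(_ < n | _) _) `|_| => s z; lra.
Qed.

Lemma exp_growth_norm f : exp_growth f -> exp_growth (fun v => `|f v|).
Proof.
move=> [mf [c c0 fc]]; split; first exact: measurableT_comp.
by exists c => // v; rewrite normr_id.
Qed.

Lemma exp_growthM f g : exp_growth f -> exp_growth g ->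
  exp_growth (fun v => f v * g v).
Proof.
move=> [mf [c c0 fc]] [mg [d d0 gd]]; split; first exact: measurable_funM.
exists (c + d) => [|v]; first exact: addr_ge0.
by rewrite normrM mulrDl expRD ler_pM.
Qed.

Lemma exp_growthD f g : exp_growth f -> exp_growth g ->
  exp_growth (fun v => f v + g v).
Proof.
move=> [mf [c c0 fc]] [mg [d d0 gd]]; split; first exact: measurable_funD.
exists (1 + c + d) => [|v]; first by rewrite !addr_ge0.
apply: le_trans (ler_normD _ _) _.
apply: le_trans (lerD (fc v) (gd v)) _.
move: (1 + _) (size1 v) => s s1.
have s0 : 0 <= s by lra.
(* The sum of two numbers that are at least 1 is at most twice their product. *)
have e1 : 2 <= expR s by apply: le_trans (expR_ge1Dx _); lra.
have ec : 1 <= expR (c * s) by rewrite -expR0 ler_expR mulr_ge0.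
have ed : 1 <= expR (d * s) by rewrite -expR0 ler_expR mulr_ge0.
rewrite !mulrDl mul1r !expRD.
move: (expR s) (expR (c * s)) (expR (d * s)) e1 ec ed => p q r p2 q1 r1.
have qr : q + r <= 2 * (q * r) by nra.
by apply: (le_trans qr); rewrite -mulrA ler_wpM2r // mulr_ge0 //; lra.
Qed.

Lemma exp_growthZ (k : R) f : exp_growth f -> exp_growth (fun v => k * f v).
Proof. by move=> ?; apply: exp_growthM => //; exact: exp_growth_cst. Qed.

Lemma exp_growthB f g : exp_growth f -> exp_growth g ->
  exp_growth (fun v => f v - g v).
Proof.
move=> ef eg; rewrite (_ : (fun v => _) = fun v => f v + (- 1) * g v).
  by apply: exp_growthD => //; exact: exp_growthZ.
by apply/funext => v; rewrite mulN1r.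
Qed.

Lemma exp_growth_sum (I : Type) (s : seq I) (F : I -> H -> R) :
  (forall i, exp_growth (F i)) -> exp_growth (fun v => \sum_(i <- s) F i v).
Proof.
move=> eF; elim: s => [|i s IHs].
  by rewrite (_ : (fun v => _) = cst 0) ?funeqE => [|v]; [exact: exp_growth_cst|rewrite big_nil].
rewrite (_ : (fun v => _) = fun v => F i v + \sum_(j <- s) F j v).
  exact: exp_growthD.
by apply/funext => v; rewrite big_cons.
Qed.

Lemma exp_growth_prod (I : Type) (s : seq I) (F : I -> H -> R) :
  (forall i, exp_growth (F i)) -> exp_growth (fun v => \prod_(i <- s) F i v).
Proof.
move=> eF; elim: s => [|i s IHs].
  by rewrite (_ : (fun v => _) = cst 1) ?funeqE => [|v]; [exact: exp_growth_cst|rewrite big_nil].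
rewrite (_ : (fun v => _) = fun v => F i v * \prod_(j <- s) F j v).
  exact: exp_growthM.
by apply/funext => v; rewrite big_cons.
Qed.

Lemma exp_growth_exp i (c : R) : 0 <= c ->
  exp_growth (fun v => expR (c * `|y i v|)).
Proof.
move=> c0; split.
  apply: measurableT_comp => //; apply: measurable_funM => //.
  by apply: measurableT_comp => //; exact: (measurable_coord nV ou).
exists c => // v; rewrite /= [X in X <= _]ger0_norm ?expR_ge0 // ler_expR ler_wpM2l //.
by rewrite (bigD1 i) //= addrCA lerDl addr_ge0 ?sumr_ge0.
Qed.

Lemma exp_growth_integrable f :
  exp_growth f -> gamma.-integrable setT (EFin \o f).
Proof.
move=> [mf [c c0 fc]]; apply/integrableP; split; first exact/measurable_EFinP.
rewrite ge0_integral_gaussian //; last first.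
  by apply: measurableT_comp => //; exact/measurable_EFinP.
rewrite lte_mul_pinfty ?lee_fin ?invr_ge0 ?(ltW mass_gt0) //.
(* Complete the square in each coordinate: [c * z - z ^+ 2 / 4 <= c ^+ 2]. *)
pose K := expR (c + n%:R * c ^+ 2).
apply: (@le_lt_trans _ _
    (\int[dv]_v (K%:E * (expR (- (ip (v : V) v / 4)))%:E))%E); last first.
  rewrite ge0_integralZl //.
  - rewrite lte_mul_pinfty ?lee_fin ?expR_ge0 //.
    exact: (quarter_density_lty nV ou dv_inv dv_nontrivial).
  - apply/measurable_EFinP; exact: measurable_quarter_density.
  - by rewrite lee_fin expR_ge0.
apply: ge0_le_integral => //.
- by move=> v _; rewrite mule_ge0 // lee_fin.
- apply: emeasurable_funM; last exact/measurable_EFinP.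
  by apply: measurableT_comp => //; exact/measurable_EFinP.
- by apply: emeasurable_funM => //; apply/measurable_EFinP; exact: measurable_quarter_density.
move=> v _; rewrite -EFinM lee_fin.
apply: le_trans (ler_wpM2r (dens_ge0 v) (fc v)) _.
rewrite /gauss_density -!expRD ler_expR (parseval nV ou v v).
rewrite mulrDr mulr1 -addrA -addrA lerD2l.
rewrite mulr_sumr [X in - (X / 2)](_ : _ = \sum_i `|y i v| ^+ 2); last first.
  by apply: eq_bigr => i _; rewrite real_normK ?num_real // expr2.
rewrite [X in - (X / 4)](_ : _ = \sum_i `|y i v| ^+ 2); last first.
  by apply: eq_bigr => i _; rewrite real_normK ?num_real // expr2.
have -> : n%:R * c ^+ 2 = \sum_(i < n) c ^+ 2 by rewrite sumr_const card_ord mulr_natl.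
rewrite !mulr_suml -!sumrN -!big_split /=; apply: ler_sum => i _.
by move: `|_| (normr_ge0 (y i v)) => z z0; have := sqr_ge0 (z / 2 - c); lra.
Qed.

Lemma gaussianT : gamma setT = 1%E.
Proof.
rewrite /gaussian -[X in (X * _)%E]fineK; last first.
  by rewrite ge0_fin_numE ?dens_lty // integral_ge0 // => v _; rewrite lee_fin.
by rewrite -EFinM divff // gt_eqF.
Qed.

End GaussianIntegral.

(** * Gaussian integration by parts *)

Section FirstOrder.
Context (R : realType) (F : Type) (z d : F -> R).
Hypothesis d01 : forall f, 0 <= d f <= 1.

(** The derivative at 0 of the product of the [z f + t * d f]. *)
Fixpoint prod_deriv (s : seq F) : R :=
  if s is f :: s' then d f * \prod_(g <- s') z g + z f * prod_deriv s' else 0.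

Lemma prod_shift_le t s : `|t| <= 1 ->
  `|\prod_(f <- s) (z f + t * d f)| <= \prod_(f <- s) (1 + `|z f|).
Proof.
move=> t1; elim: s => [|f s IHs]; first by rewrite !big_nil normr1.
rewrite !big_cons normrM ler_pM //.
rewrite (le_trans (ler_normD _ _)) // addrC lerD2r normrM.
by have /andP[d0 d1] := d01 f; rewrite (ger0_norm d0) mulr_ile1.
Qed.

Lemma prod_shift_sub_le t s : `|t| <= 1 ->
  `|\prod_(f <- s) (z f + t * d f) - \prod_(f <- s) z f| <=
  `|t| * \prod_(f <- s) (1 + `|z f|).
Proof.
move=> t1; elim: s => [|f s IHs].
  by rewrite !big_nil subrr normr0 mulr1.
rewrite !big_cons; move: IHs (prod_shift_le s t1) (d01 f).
move: (\prod_(_ <- s) (_ + _)) (\prod_(_ <- s) z _) (\prod_(_ <- s) (1 + _)).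
move=> p q b pq pb /andP[d0 d1].
rewrite (_ : _ - _ = z f * (p - q) + t * (d f * p)); last by ring.
rewrite (le_trans (ler_normD _ _)) // !normrM (ger0_norm d0).
have h1 := ler_wpM2l (normr_ge0 (z f)) pq.
have h2 : d f * `|p| <= b.
  by apply: le_trans pb; rewrite ler_piMl.
have h3 := ler_wpM2l (normr_ge0 t) h2.
by apply: le_trans (lerD h1 h3) _; rewrite le_eqVlt; apply/orP; left; apply/eqP; ring.
Qed.

Lemma prod_shift_taylor t s : `|t| <= 1 ->
  `|\prod_(f <- s) (z f + t * d f) - \prod_(f <- s) z f - t * prod_deriv s| <=
  t ^+ 2 * \prod_(f <- s) (1 + `|z f|).
Proof.
move=> t1; elim: s => [|f s IHs].
  by rewrite !big_nil mulr0 subrr subr0 normr0 mulr1 sqr_ge0.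
rewrite !big_cons /=; move: IHs (prod_shift_sub_le s t1) (d01 f).
move: (prod_deriv s) (\prod_(_ <- s) (_ + _)) (\prod_(_ <- s) z _) (\prod_(_ <- s) (1 + _)).
move=> e p q b pq pb /andP[d0 d1].
rewrite (_ : _ - _ = z f * (p - q - t * e) + t * d f * (p - q)); last by ring.
rewrite (le_trans (ler_normD _ _)) // !normrM (ger0_norm d0).
have h1 := ler_wpM2l (normr_ge0 (z f)) pq.
have h2 : d f * `|p - q| <= `|t| * b.
  by apply: le_trans pb; rewrite ler_piMl.
have h3 := ler_wpM2l (normr_ge0 t) h2.
rewrite -mulrA; apply: le_trans (lerD h1 h3) _.
by rewrite -[t ^+ 2]real_normK ?num_real // le_eqVlt; apply/orP; left; apply/eqP; ring.
Qed.

Lemma expR_taylor (x : R) : `|expR x - 1 - x| <= x ^+ 2 * expR `|x|.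
Proof.
have ge (x' : R) : expR x' * (1 - x') <= 1.
  rewrite -[leRHS](expRxMexpNx_1 x') ler_wpM2l ?expR_ge0 //.
  by have := expR_ge1Dx (- x').
have x1 := expR_ge1Dx x; have e0 := expR_ge0 x.
rewrite ger0_norm; last by rewrite -addrA -opprD subr_ge0.
have [x0|x0] := leP 0 x.
  by rewrite (ger0_norm x0); have := ge x; move: (expR x) e0 x1 => q; nra.
have eN : 1 <= expR `|x| by rewrite -expR0 ler_expR.
have h : expR x - 1 - x <= x ^+ 2.
  by have := ge x; move: (expR x) e0 x1 => q; nra.
by rewrite (le_trans h) // ler_peMr ?sqr_ge0.
Qed.

(** The exponential by which a translation of size [t] multiplies the density,
    to first order in [t]. *)
Lemma gauss_factor_taylor (w t : R) : `|t| <= 1 ->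
  `|expR (- (t * w) - t ^+ 2 / 2) - 1 + t * w| <=
  t ^+ 2 * (2 * expR (3 * (`|w| + 1))).
Proof.
move=> t1; set x := _ - _.
have xE : x = - t * (w + t / 2) by rewrite /x; field.
have wt : `|w + t / 2| <= `|w| + 1.
  by rewrite (le_trans (ler_normD _ _)) // lerD2l normrM (ger0_norm (_ : 0 <= 2^-1)) //; lra.
have x1 : `|x| <= `|w| + 1.
  rewrite xE normrM normrN (le_trans _ wt) // ler_piMl //.
have x2 : x ^+ 2 <= t ^+ 2 * (`|w| + 1) ^+ 2.
  rewrite xE exprMn sqrrN ler_wpM2l ?sqr_ge0 // -[_ ^+ 2]real_normK ?num_real //.
  by rewrite lerXn2r ?nnegrE ?addr_ge0.
have w0 := normr_ge0 w.
have E1 : 1 <= expR (`|w| + 1) by rewrite -expR0 ler_expR addr_ge0.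
have E2 : (`|w| + 1) <= expR (`|w| + 1).
  by apply: le_trans (expR_ge1Dx _); lra.
have E3 : (`|w| + 1) ^+ 2 * expR (`|w| + 1) <= expR (3 * (`|w| + 1)).
  have -> : expR (3 * (`|w| + 1)) = expR (`|w| + 1) ^+ 2 * expR (`|w| + 1).
    by rewrite expr2 -!expRD; congr expR; lra.
  by rewrite ler_wpM2r ?expR_ge0 // lerXn2r ?nnegrE ?expR_ge0 ?addr_ge0.
have T := expR_taylor x.
have T' : `|expR x - 1 - x| <= t ^+ 2 * expR (3 * (`|w| + 1)).
  apply: (le_trans T); apply: le_trans (ler_wpM2l (sqr_ge0 t) E3).
  rewrite mulrA ler_pM ?sqr_ge0 ?expR_ge0 // ler_expR //.
have E4 : 1 <= expR (3 * (`|w| + 1)) by rewrite -expR0 ler_expR mulr_ge0 ?addr_ge0.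
rewrite (_ : _ + _ = (expR x - 1 - x) - t ^+ 2 / 2); last first.
  by rewrite {3}/x; ring.
rewrite (le_trans (ler_normB _ _)) //.
have t2 := sqr_ge0 t.
rewrite [X in _ + X]ger0_norm ?divr_ge0 //.
have := ler_wpM2l t2 E4; lra.
Qed.

End FirstOrder.

Section Stein.
Context (R : realType) (V : vectType R) (ip : {dot V for idfun}).
Context (n : nat) (nV : n = \dim {:V}) (u : 'I_n -> V).
Hypothesis ou : orthonormal_family ip u.
Context (dv : {measure set (hilbert ip) -> \bar R}).
Hypothesis dv_inv : translation_invariant dv.
Hypothesis dv_nontrivial : nontrivial_measure dv.

Local Notation H := (hilbert ip).
Local Notation y i v := (ip (v : V) (u i)).
Local Notation gamma := (gaussian dv).
Local Notation exp_growth := (@exp_growth R V ip n u).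

Definition expectation (f : H -> R) : R := \int[gamma]_v f v.

Let int f : exp_growth f -> gamma.-integrable setT (EFin \o f).
Proof. exact: (exp_growth_integrable nV ou dv_inv dv_nontrivial). Qed.

Lemma expectationD f g : exp_growth f -> exp_growth g ->
  expectation (fun v => f v + g v) = expectation f + expectation g.
Proof. by move=> /int If /int Ig; rewrite /expectation RintegralD. Qed.

Lemma expectationB f g : exp_growth f -> exp_growth g ->
  expectation (fun v => f v - g v) = expectation f - expectation g.
Proof. by move=> /int If /int Ig; rewrite /expectation RintegralB. Qed.

Lemma expectationZ (k : R) f : exp_growth f ->
  expectation (fun v => k * f v) = k * expectation f.
Proof. by move=> /int If; rewrite /expectation RintegralZl. Qed.

Lemma expectation_cst (k : R) : expectation (cst k) = k.
Proof.
transitivity (k * fine (gamma setT)); first exact: Rintegral_cst.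
by rewrite (gaussianT nV ou dv_inv dv_nontrivial) mulr1.
Qed.

Lemma expectation_sum (I : Type) (s : seq I) (F : I -> H -> R) :
  (forall i, exp_growth (F i)) ->
  expectation (fun v => \sum_(i <- s) F i v) = \sum_(i <- s) expectation (F i).
Proof.
move=> eF; elim: s => [|i s IHs].
  rewrite big_nil (_ : (fun v => _) = cst 0) ?expectation_cst //.
  by apply/funext => v; rewrite big_nil.
rewrite big_cons -IHs -expectationD //; last exact: exp_growth_sum.
by congr expectation; apply/funext => v; rewrite big_cons.
Qed.

Lemma le_expectation f g : exp_growth f -> exp_growth g ->
  (forall v, `|f v| <= g v) -> `|expectation f| <= expectation g.
Proof.
move=> ef eg fg; apply: le_trans (le_normr_Rintegral _ (int ef)) _ => //.
apply: le_Rintegral => //; [|exact: int].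
by apply: int; exact: exp_growth_norm.
Qed.

Lemma exp_growth_shift (t : R) i f : exp_growth f ->
  exp_growth (fun v => f ((v : V) + t *: u i)).
Proof.
move=> [mf [c c0 fc]]; split.
  exact: (measurableT_comp mf (@measurable_shift _ _ ip (t *: u i))).
exists (c * (1 + `|t|)) => [|v]; first by rewrite mulr_ge0 ?addr_ge0.
apply: le_trans (fc _) _; rewrite ler_expR -mulrA ler_wpM2l //.
have S0 : 0 <= \sum_j `|y j v| by apply: sumr_ge0.
have : \sum_j `|y j ((v : V) + t *: u i)| <= `|t| + \sum_j `|y j v|.
  rewrite (bigD1 i) //= [X in _ <= _ + X](bigD1 i) //= addrA lerD //.
    by rewrite ipDl ipZl ou eqxx mulr1 addrC ler_normD.
  by apply: ler_sum => j ji; rewrite ipDl ipZl ou eq_sym (negbTE ji) mulr0 addr0.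
have t0 := normr_ge0 t; nra.
Qed.

Lemma exp_growth_gauss_factor (t : R) i :
  exp_growth (fun v => expR (- (t * y i v) - t ^+ 2 / 2)).
Proof.
split.
  apply: measurableT_comp => //; apply: measurable_funB => //.
  apply: measurableT_comp => //; apply: measurable_funM => //.
  exact: (measurable_coord nV ou).
exists `|t| => // v; rewrite ger0_norm ?expR_ge0 // ler_expR.
apply: (@le_trans _ _ (`|t| * `|y i v|)).
  rewrite -normrM; have := ler_norm (- (t * y i v)); rewrite normrN.
  have := sqr_ge0 t; lra.
rewrite ler_wpM2l // (bigD1 i) //=.
have : 0 <= \sum_(j < n | j != i) `|y j v| by apply: sumr_ge0.
by move: (\sum_(_ < n | _) _) `|y i v| => s z; lra.
Qed.

(** For nonnegative functions this is the invariance of the measure; the general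
    case follows by writing [f] as a difference of two such functions. *)
Lemma expectation_shift (t : R) i f : exp_growth f ->
  expectation f =
  expectation (fun v => f ((v : V) + t *: u i) * expR (- (t * y i v) - t ^+ 2 / 2)).
Proof.
move=> ef.
have pos g : exp_growth g -> (forall v, 0 <= g v) -> expectation g =
  expectation (fun v => g ((v : V) + t *: u i) * expR (- (t * y i v) - t ^+ 2 / 2)).
  move=> [mg _] g0; congr fine.
  rewrite (ge0_integral_gaussian_shift nV ou dv_inv dv_nontrivial (t *: u i) mg g0).
  apply: eq_integral => v _; congr (_ * expR _)%:E.
  by rewrite !ipZr ipZl ou eqxx mulr1 expr2.
have ea := exp_growth_norm ef.
have es : exp_growth (fun v => f v + `|f v|) by exact: exp_growthD.
have E1 := pos _ ea (fun v => normr_ge0 _).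
have p0 v : 0 <= f v + `|f v| by have := ler_norm (- f v); rewrite normrN; lra.
have E2 := pos _ es p0.
have sh g : exp_growth g ->
    exp_growth (fun v => g ((v : V) + t *: u i) * expR (- (t * y i v) - t ^+ 2 / 2)).
  move=> eg; apply: exp_growthM; last exact: exp_growth_gauss_factor.
  exact: exp_growth_shift.
have -> : expectation f = expectation (fun v => f v + `|f v|) - expectation (fun v => `|f v|).
  by rewrite -expectationB //; congr expectation; apply/funext => v; rewrite addrK.
rewrite E1 E2 -expectationB; [|exact: (sh _ es)|exact: (sh _ ea)].
by congr expectation; apply/funext => v; rewrite -mulrBl addrK.
Qed.

Section Monomials.
Context (F : Type) (m : F -> 'I_n).

Definition mono (s : seq F) (v : H) : R := \prod_(f <- s) y (m f) v.

Lemma exp_growth_mono s : exp_growth (mono s).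
Proof. by apply: exp_growth_prod => f; exact: (exp_growth_coord nV ou). Qed.

Definition mono_deriv i (s : seq F) (v : H) : R :=
  prod_deriv (fun f => y (m f) v) (fun f => (m f == i)%:R) s.

Lemma exp_growth_mono_deriv i s : exp_growth (mono_deriv i s).
Proof.
elim: s => [|f s IHs]; first exact: exp_growth_cst.
apply: exp_growthD; apply: exp_growthM => //.
- exact: exp_growth_cst.
- exact: exp_growth_mono.
- exact: (exp_growth_coord nV ou).
Qed.

(** Translating the measure by [t *: u i] does not change the expectation of the
    monomial, whereas the integrand changes by [t] times the difference of the
    two sides, up to an error of order [t ^+ 2]. *)
Lemma gaussian_integration_by_parts i s :
  expectation (fun v => y i v * mono s v) = expectation (mono_deriv i s).
Proof.
pose B v := \prod_(f <- s) (1 + `|y (m f) v|) * (4 * expR (3 * (`|y i v| + 1)) * (1 + `|y i v|)).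
have eB : exp_growth B.
  apply: exp_growthM.
    apply: exp_growth_prod => f; apply: exp_growthD; first exact: exp_growth_cst.
    exact/exp_growth_norm/(exp_growth_coord nV ou).
  apply: exp_growthM; last first.
    apply: exp_growthD; first exact: exp_growth_cst.
    exact/exp_growth_norm/(exp_growth_coord nV ou).
  rewrite (_ : (fun v => _) = (fun v : H => (4 * expR 3) * expR (3 * `|y i v|))).
  apply: exp_growthZ; apply: (exp_growth_exp nV ou i); exact: ler0n.
  by apply/funext => v; rewrite mulrDr mulr1 expRD; ring.
have ey : exp_growth (fun v => y i v * mono s v).
  by apply: exp_growthM; [exact: (exp_growth_coord nV ou)|exact: exp_growth_mono].
have ed := exp_growth_mono_deriv i s.
have em := exp_growth_mono s.
pose e := expectation (mono_deriv i s) - expectation (fun v => y i v * mono s v).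
(* [B] dominates the second-order terms, uniformly for [t] in the unit interval. *)
have bound t : 0 < t <= 1 -> `|e| <= t * expectation B.
  move=> /andP[t0 t1].
  have nt1 : `|t| <= 1 by rewrite ger0_norm ?(ltW t0).
  pose S v := mono s ((v : V) + t *: u i) * expR (- (t * y i v) - t ^+ 2 / 2).
  have eS : exp_growth S.
    by apply: exp_growthM; [exact: exp_growth_shift|exact: exp_growth_gauss_factor].
  pose D v := mono_deriv i s v - y i v * mono s v.
  have eD : exp_growth D by exact: exp_growthB.
  have : `|expectation (fun v => S v - mono s v - t * D v)| <= expectation (fun v => t ^+ 2 * B v).
    apply: le_expectation.
    - by apply: exp_growthB; [exact: exp_growthB|exact: exp_growthZ].
    - exact: exp_growthZ.
    move=> v; rewrite /S /D /B /mono /mono_deriv.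
    have -> : \prod_(f <- s) y (m f) ((v : V) + t *: u i) =
        \prod_(f <- s) (y (m f) v + t * (m f == i)%:R).
      by apply: eq_bigr => f _; rewrite ipDl ipZl ou eq_sym.
    have d01 f : 0 <= ((m f == i)%:R : R) <= 1 by rewrite ler0n lern1; case: eqP.
    have h1 := prod_shift_le (fun f => y (m f) v) d01 s nt1.
    have h2 := prod_shift_sub_le (fun f => y (m f) v) d01 s nt1.
    have h3 := prod_shift_taylor (fun f => y (m f) v) d01 s nt1.
    have g1 := gauss_factor_taylor (y i v) nt1.
    have ex1 : 1 <= expR (3 * (`|y i v| + 1)).
      by rewrite -expR0 ler_expR mulr_ge0 ?addr_ge0.
    move: h1 h2 h3 g1 ex1 => /=.
    set X := \prod_(_ <- s) (_ + _); set P := \prod_(f <- s) y (m f) v.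
    set b := \prod_(_ <- s) (1 + _); set d := prod_deriv _ _ _.
    set g := expR (- _ - _); set ex := expR _; set w := y i v.
    move: X P b d g ex w => X P b d g ex w h1 h2 h3 g1 ex1.
    rewrite (_ : _ - _ - _ = X * (g - 1 + t * w) + (X - P - t * d) - t * w * (X - P)); last by ring.
    have t2 := sqr_ge0 t; have w0 := normr_ge0 w.
    have b0 : 0 <= b by apply: le_trans h1.
    have k1 : `|X * (g - 1 + t * w)| <= b * (t ^+ 2 * (2 * ex)).
      by rewrite normrM ler_pM.
    have k2 : `|t * w * (X - P)| <= t ^+ 2 * (`|w| * b).
      rewrite !normrM -[t ^+ 2]real_normK ?num_real // expr2 -!mulrA ler_wpM2l //.
      by rewrite mulrCA ler_wpM2l.
    rewrite (le_trans (ler_normB _ _)) // (le_trans (lerD (ler_normD _ _) (lexx _))) //.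
    apply: le_trans (lerD (lerD k1 h3) k2) _.
    rewrite (_ : _ + _ + _ = t ^+ 2 * (b * (2 * ex + 1 + `|w|))); last by ring.
    do 2 rewrite ler_wpM2l //.
    have := ler_wpM2r w0 ex1; nra.
  have -> : expectation (fun v => S v - mono s v - t * D v) = - (t * e).
    rewrite expectationB; [|exact: exp_growthB|exact: exp_growthZ].
    rewrite (expectationB eS em) -(expectation_shift t i em) subrr sub0r.
    by rewrite expectationZ // (expectationB ed ey).
  rewrite normrN normrM (ger0_norm (ltW t0)) expectationZ // expr2 -mulrA.
  by rewrite ler_pM2l.
suff e0 : `|e| <= 0 by apply/esym/eqP; rewrite -subr_eq0 -normr_le0.
rewrite leNgt; apply/negP => e0.
have := bound 1; rewrite ltr01 lexx mul1r => /(_ isT) eK.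
have K0 : 0 < expectation B by apply: lt_le_trans eK.
(* This value of [t] would give [`|e| <= `|e| / 2]. *)
have := bound (`|e| / (2 * expectation B)).
rewrite divr_gt0 ?mulr_gt0 // ler_pdivrMr ?mulr_gt0 // => /(_ _)/wrap[]; first lra.
rewrite [leRHS](_ : _ = `|e| / 2); last by field; rewrite gt_eqF.
by move: e0; move: `|e| => q; lra.
Qed.

End Monomials.
End Stein.

(** * Wick's formula *)

Section Pairings.
Context (F : finType) (T : eqType) (m : F -> T).

Definition pairing_on (A : {set F}) (o : {ffun F -> F}) : bool :=
  [forall f, if f \in A then [&& o f \in A, o (o f) == f & o f != f]
             else o f == f].

Definition compatible (o : {ffun F -> F}) : bool := [forall f, m (o f) == m f].

Definition num_pairings (A : {set F}) : nat :=
  #|[pred o : {ffun F -> F} | pairing_on A o && compatible o]|.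

Lemma num_pairings0 : num_pairings finset.set0 = 1%N.
Proof.
rewrite /num_pairings (eq_card (B := pred1 [ffun f => f])) ?card1 // => o.
rewrite !inE; apply/andP/eqP => [[/forallP oid _]|->].
  by apply/ffunP => f; rewrite ffunE; have := oid f; rewrite inE => /eqP.
by split; apply/forallP => f; rewrite ffunE ?inE.
Qed.

(** A pairing of [A] consists of the partner [f] of [f0] and of a pairing of
    the rest. *)
Lemma num_pairings_rec (A : {set F}) f0 : f0 \in A ->
  num_pairings A =
  (\sum_(f in A :\ f0 | m f == m f0) num_pairings (A :\ f0 :\ f))%N.
Proof.
move=> f0A; rewrite /num_pairings -sum1_card.
rewrite (partition_big (fun o : {ffun F -> F} => o f0)
  (fun f => (f \in A :\ f0) && (m f == m f0))) /=; last first.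
  move=> o /andP[/forallP /(_ f0)]; rewrite f0A => /and3P[oA _ of0] /forallP /(_ f0) ->.
  by rewrite !inE of0 oA.
apply: eq_bigr => f /andP[]; rewrite !inE => /andP[ff0 fA] mf.
rewrite -sum1_card.
pose h (o : {ffun F -> F}) : {ffun F -> F} :=
  [ffun x => if x == f0 then f else if x == f then f0 else o x].
pose h' (o : {ffun F -> F}) : {ffun F -> F} :=
  [ffun x => if (x == f0) || (x == f) then x else o x].
rewrite (reindex_onto h h') /=; last first.
  move=> o /andP[/andP[/forallP oP _] /eqP of0]; apply/ffunP => x; rewrite !ffunE.
  case: eqP => [->//|x0]; case: eqP => [->|//] /=.
  by have := oP f0; rewrite f0A of0 => /and3P[_ /eqP ->].
apply: eq_bigl => o; rewrite !inE.
have -> : h o f0 == f by rewrite ffunE eqxx.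
rewrite andbT.
have hh : (h' (h o) == o) = (o f0 == f0) && (o f == f).
  apply/eqP/andP => [<-|[/eqP o1 /eqP o2]]; first by rewrite !ffunE !eqxx orbT.
  by apply/ffunP => x; rewrite !ffunE; case: eqP => [->|] //=; case: eqP => [->|].
rewrite hh; apply/andP/andP => -[].
  move=> /andP[/forallP hP /forallP hc] /andP[/eqP o1 /eqP o2].
  split; apply/forallP => x; last first.
    have := hc x; rewrite ffunE.
    case: (eqVneq x f0) => [->|_]; first by rewrite o1.
    by case: (eqVneq x f) => [->|]; rewrite ?o2.
  have := hP x; rewrite !inE !ffunE.
  case: (eqVneq x f) => [->|xf] /=; first by rewrite o2.
  case: (eqVneq x f0) => [->|xf0] /=; first by rewrite o1.
  case: ifP => // xA /and3P[h1 h2 h3].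
  case: (eqVneq (o x) f0) h2 => [->|oxf0]; first by rewrite eq_sym (negbTE xf).
  case: (eqVneq (o x) f) => [_|oxf]; first by rewrite eq_sym (negbTE xf0).
  by move=> -> ; rewrite h1.
move=> /forallP oP /forallP oc.
have o1 : o f0 = f0 by have := oP f0; rewrite !inE eqxx andbF => /eqP.
have o2 : o f = f by have := oP f; rewrite !inE eqxx => /eqP.
rewrite o1 o2 !eqxx; split => //; apply/andP; split; apply/forallP => x; last first.
  rewrite ffunE; case: (eqVneq x f0) => [->|_] //.
  by case: (eqVneq x f) => [->|_] //; rewrite eq_sym.
have := oP x; rewrite !inE !ffunE.
case: (eqVneq x f0) => [->|xf0] /=.
  by rewrite f0A fA (negbTE ff0) !eqxx.
case: (eqVneq x f) => [->|xf] /=.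
  by rewrite f0A fA !eqxx (eq_sym f0) (negbTE ff0).
case: ifP => // xA /and3P[/and3P[oxf oxf0 oxA] /eqP oo ->].
by rewrite (negbTE oxf) (negbTE oxf0) oo eqxx oxA.
Qed.

End Pairings.

Section Wick.
Context (R : realType) (V : vectType R) (ip : {dot V for idfun}).
Context (n : nat) (nV : n = \dim {:V}) (u : 'I_n -> V).
Hypothesis ou : orthonormal_family ip u.
Context (dv : {measure set (hilbert ip) -> \bar R}).
Hypothesis dv_inv : translation_invariant dv.
Hypothesis dv_nontrivial : nontrivial_measure dv.

Lemma prod_deriv_rem (F : eqType) (z d : F -> R) (s : seq F) : uniq s ->
  prod_deriv z d s = \sum_(f <- s) d f * \prod_(g <- s | g != f) z g.
Proof.
elim: s => [|f s IHs] /=; first by rewrite big_nil.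
move=> /andP[fs us]; rewrite big_cons big_cons eqxx /= IHs // mulr_sumr.
congr (_ * _ + _).
  rewrite big_seq_cond [RHS]big_seq_cond; apply: eq_bigl => g.
  by case: (eqVneq g f) => [->|]; rewrite ?(negbTE fs) ?andbT.
apply: eq_big_seq => g gs.
rewrite big_cons; case: (eqVneq f g) => [fg|_]; first by rewrite fg gs in fs.
by rewrite mulrCA.
Qed.

(** Integration by parts and the recursion for pairings have the same form. *)
Theorem wick_on (F : finType) (m : F -> 'I_n) (A : {set F}) :
  expectation dv (fun v => \prod_(f in A) ip (v : V) (u (m f))) =
  (num_pairings m A)%:R.
Proof.
elim: {A}_.+1 {-2}A (ltnSn #|A|) => // k IHk A.
have [->|[f0 f0A]] := set_0Vmem A.
  rewrite num_pairings0 (_ : (fun v => _) = cst 1) => [_|].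
    exact: (expectation_cst nV ou dv_inv dv_nontrivial).
  by apply/funext => v; rewrite big_set0.
rewrite (cardsD1 f0) f0A add1n ltnS => Ak.
pose s := enum (A :\ f0).
have sE v : \prod_(f in A) ip (v : V) (u (m f)) = ip (v : V) (u (m f0)) * mono (ip := ip) u m s v.
  by rewrite (big_setD1 f0) //= /mono /s big_enum.
rewrite (_ : (fun v => _) = fun v : hilbert ip => ip (v : V) (u (m f0)) * mono (ip := ip) u m s v); last first.
  by apply/funext => v; rewrite sE.
rewrite (gaussian_integration_by_parts nV ou dv_inv dv_nontrivial).
rewrite (num_pairings_rec m f0A) natr_sum.
rewrite (_ : mono_deriv _ _ _ _ = fun v : hilbert ip => \sum_(f <- s)
   (m f == m f0)%:R * \prod_(g in A :\ f0 :\ f) ip (v : V) (u (m g))); last first.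
  apply/funext => v; rewrite /mono_deriv prod_deriv_rem ?enum_uniq //.
  apply: eq_bigr => f _; congr (_ * _); rewrite /s big_enum_cond /=.
  by apply: eq_bigl => g; rewrite !inE andbC.
have eprod B : exp_growth u (fun v : hilbert ip =>
    \prod_(g in B) ip (v : V) (u (m g))).
  rewrite (_ : (fun v => _) = mono (ip := ip) u m (enum B)).
    exact: (exp_growth_mono nV ou).
  by apply/funext => v; rewrite /mono big_enum.
rewrite (expectation_sum nV ou dv_inv dv_nontrivial) => [|f]; last first.
  exact/exp_growthZ/eprod.
rewrite /s big_enum /= [RHS]big_mkcondr /=; apply: eq_bigr => f fA.
rewrite (expectationZ nV ou dv_inv dv_nontrivial) //.
rewrite IHk; last first.
  by move: Ak; rewrite (cardsD1 f) fA; apply: leq_trans; rewrite ltnS leq_addl.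
by case: eqP; rewrite ?mul1r ?mul0r.
Qed.

End Wick.

(** * Contractions along edges *)

Section Exchange.
Context (K : comNzRingType).

Definition upd (I : eqType) (X : Type) (xi : I -> X) (i : I) (x : X) : I -> X :=
  fun j => if j == i then x else xi j.

Lemma updE (I : eqType) X (xi : I -> X) i x : upd xi i x i = x.
Proof. by rewrite /upd eqxx. Qed.

Lemma upd_neq (I : eqType) X (xi : I -> X) i x j : j != i -> upd xi i x j = xi j.
Proof. by rewrite /upd => /negbTE ->. Qed.

(** Singles out the slot [i0] of a labelling [L]; the value [j0] only serves to
    represent the labellings of the other slots. *)
Lemma sum_ffun_slot (I J : finType) (i0 : I) (j0 : J)
    (G : J -> {ffun I -> J} -> K) :
  (forall j (L : {ffun I -> J}) k, G j [ffun i => upd L i0 k i] = G j L) ->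
  \sum_(L : {ffun I -> J}) G (L i0) L =
  \sum_(L : {ffun I -> J} | L i0 == j0) \sum_j G j L.
Proof.
move=> GL; pose r (L : {ffun I -> J}) k : {ffun I -> J} := [ffun i => upd L i0 k i].
rewrite (partition_big (r^~ j0) (fun L => L i0 == j0)) /=; last first.
  by move=> L _; rewrite ffunE updE.
apply: eq_bigr => L /eqP Lj0.
rewrite (reindex_onto (r L) (fun L' => L' i0)) /=; last first.
  move=> L' /eqP <-; apply/ffunP => i; rewrite !ffunE /upd ffunE.
  by case: eqP => [->//|/eqP ii]; rewrite /upd (negbTE ii).
apply: eq_big => [j|j _].
  rewrite ffunE updE eqxx andbT; apply/eqP/ffunP => i; rewrite !ffunE /upd ffunE.
  by case: eqP => [->|/eqP ii] //; rewrite /upd (negbTE ii).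
by rewrite ffunE updE GL.
Qed.

(** The slots are replaced one at a time.  Expansion of a vector in a basis and
    change of basis are both of this form. *)
Lemma multi_exchange (I J : finType) (X : Type) (k k' : I -> J -> K)
    (p p' : I -> J -> X) (Phi : (I -> X) -> K) :
  (forall i xi, \sum_j k i j * Phi (upd xi i (p i j)) =
                \sum_j k' i j * Phi (upd xi i (p' i j))) ->
  \sum_(L : {ffun I -> J}) (\prod_i k i (L i)) * Phi (fun i => p i (L i)) =
  \sum_(L : {ffun I -> J}) (\prod_i k' i (L i)) * Phi (fun i => p' i (L i)).
Proof.
move=> E; pose kk (s : seq I) i := if i \in s then k' i else k i.
pose pp (s : seq I) i := if i \in s then p' i else p i.
pose S s := \sum_(L : {ffun I -> J})
  (\prod_i kk s i (L i)) * Phi (fun i => pp s i (L i)).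
suff H s : uniq s -> S s = S [::].
  transitivity (S (enum I)); last first.
    apply: eq_bigr => L _; congr (_ * Phi _).
      by apply: eq_bigr => i _; rewrite /kk mem_enum.
    by apply/funext => i; rewrite /pp mem_enum.
  by rewrite H ?enum_uniq.
elim: s => // i0 s IHs /= /andP[i0s us]; rewrite -{}IHs // /S.
pose W (L : {ffun I -> J}) := \prod_(i | i != i0) kk s i (L i).
pose xi (L : {ffun I -> J}) i := pp s i (L i).
pose G j (L : {ffun I -> J}) := W L * (k i0 j * Phi (upd (xi L) i0 (p i0 j))).
pose G' j (L : {ffun I -> J}) := W L * (k' i0 j * Phi (upd (xi L) i0 (p' i0 j))).
have upd_xi (L : {ffun I -> J}) j x : upd (xi [ffun i => upd L i0 j i]) i0 x = upd (xi L) i0 x.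
  by apply/funext => i; rewrite /upd; case: eqP => // /eqP ii;
    rewrite /xi ffunE /upd (negbTE ii).
have W_upd (L : {ffun I -> J}) j : W [ffun i => upd L i0 j i] = W L.
  by apply: eq_bigr => i ii; rewrite ffunE /upd (negbTE ii).
transitivity (\sum_(L : {ffun I -> J}) G' (L i0) L).
  apply: eq_bigr => L _; rewrite /G' (bigD1 i0) //= /kk mem_head.
  rewrite [RHS]mulrCA [RHS]mulrA; congr (_ * _ * Phi _).
    by apply: eq_bigr => i ii; rewrite inE (negbTE ii).
  by apply/funext => i; rewrite /upd /xi /pp inE; case: eqP => [->|_].
transitivity (\sum_(L : {ffun I -> J}) G (L i0) L); last first.
  have kk0 : kk s i0 = k i0 by rewrite /kk (negbTE i0s).
  apply: eq_bigr => L _; rewrite /G [in RHS](bigD1 i0) //= kk0.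
  rewrite [LHS]mulrCA [LHS]mulrA; congr (_ * Phi _).
  by apply/funext => i; rewrite /upd; case: eqP => [->|//]; rewrite /pp (negbTE i0s).
have [j0 _|J0] := pickP J; last by apply: eq_bigr => L _; have := J0 (L i0).
rewrite (sum_ffun_slot j0) => [|j L j']; last by rewrite /G' upd_xi W_upd.
rewrite (sum_ffun_slot j0) => [|j L j']; last by rewrite /G upd_xi W_upd.
by apply: eq_bigr => L _; rewrite -!mulr_sumr E.
Qed.

Section Edges.
Context (F J : finType) (X : Type) (opp : F -> F).
Hypotheses (oppK : involutive opp) (opp_neq : forall f, opp f != f).

(** Every edge is represented by one of its two ends. *)
Definition is_rep f := (enum_rank f < enum_rank (opp f))%N.

Lemma is_rep_opp f : is_rep (opp f) = ~~ is_rep f.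
Proof.
rewrite /is_rep oppK -leqNgt [LHS]ltn_neqAle; case: eqP => // h; have ff := enum_rank_inj (ord_inj h).
by have := opp_neq f; rewrite ff eqxx.
Qed.

Definition edge : finType := {f : F | is_rep f}.

Lemma edge_of_subproof f : is_rep (if is_rep f then f else opp f).
Proof. by case: ifP => // /negbT; rewrite is_rep_opp. Qed.

Definition edge_of f : edge := Sub _ (edge_of_subproof f).

Definition on_flags (Y : Type) (xi : edge -> Y * Y) (f : F) : Y :=
  if is_rep f then (xi (edge_of f)).1 else (xi (edge_of f)).2.

Lemma edge_ofK (e : edge) : edge_of (val e) = e.
Proof. by apply: val_inj; rewrite /= (valP e). Qed.

Lemma edge_of_opp (e : edge) : edge_of (opp (val e)) = e.
Proof. by apply: val_inj; rewrite /= is_rep_opp (valP e) /= oppK. Qed.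

Lemma val_edge_of f : is_rep f -> val (edge_of f) = f.
Proof. by rewrite /= => ->. Qed.

Lemma opp_val_edge_of f : ~~ is_rep f -> opp (val (edge_of f)) = f.
Proof. by rewrite /= => /negbTE ->; rewrite oppK. Qed.

Lemma on_flags_upd (Y : Type) (xi : edge -> Y * Y) (e : edge) y :
  on_flags (upd xi e y) = upd (upd (on_flags xi) (val e) y.1) (opp (val e)) y.2.
Proof.
apply/funext => f; rewrite /on_flags /upd; have [fr|fr] := ifPn.
  have -> : (f == opp (val e)) = false.
    by apply/eqP => fE; move: fr; rewrite fE is_rep_opp (valP e).
  by rewrite -val_eqE /= fr; case: ifP.
have -> : (f == val e) = false by apply/eqP => fE; move: fr; rewrite fE (valP e).
by rewrite -val_eqE /= (negbTE fr) (inv_eq oppK); case: ifP.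
Qed.

Lemma sum_edge_labels (k : F -> J -> J -> K) (p : F -> J -> X) (Phi : (F -> X) -> K) :
  \sum_(l : {ffun F -> J})
    (\prod_(f | is_rep f) k f (l f) (l (opp f))) * Phi (fun f => p f (l f)) =
  \sum_(L : {ffun edge -> J * J})
    (\prod_e k (val e) (L e).1 (L e).2) *
    Phi (on_flags (fun e => (p (val e) (L e).1, p (opp (val e)) (L e).2))).
Proof.
pose h (L : {ffun edge -> J * J}) : {ffun F -> J} := [ffun f => on_flags L f].
pose h' (l : {ffun F -> J}) : {ffun edge -> J * J} :=
  [ffun e => (l (val e), l (opp (val e)))].
have hv L e : h L (val e) = (L e).1.
  by rewrite ffunE /on_flags (valP e) edge_ofK.
have ho L e : h L (opp (val e)) = (L e).2.
  by rewrite ffunE /on_flags is_rep_opp (valP e) /= edge_of_opp.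
have hh' l : h (h' l) = l.
  apply/ffunP => f; rewrite ffunE /on_flags ffunE; case: ifPn => fr /=.
    by rewrite fr.
  by rewrite (negbTE fr) oppK.
have h'h L : h' (h L) = L.
  by apply/ffunP => e; rewrite [LHS]ffunE hv ho -surjective_pairing.
rewrite (reindex h) /=; last first.
  by exists h' => L _.
apply: eq_bigr => L _; congr (_ * Phi _).
  rewrite (reindex_omap (val : edge -> F) insub) /=; last first.
    by move=> f fr; rewrite insubT.
  apply: eq_big => [e|e _]; first by rewrite (valP e) valK eqxx.
  by rewrite hv ho.
apply/funext => f; rewrite /on_flags; case: ifPn => fr.
  by rewrite -{1 2}(val_edge_of fr) hv.
by rewrite -{1 2}(opp_val_edge_of fr) ho.
Qed.

(** The case of [multi_exchange] in which a slot is an edge, filled with a pair. *)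
Lemma edge_exchange (k k' : F -> J -> J -> K) (p p' : F -> J -> X)
    (Phi : (F -> X) -> K) :
  (forall f xi, \sum_j \sum_j' k f j j' *
        Phi (upd (upd xi f (p f j)) (opp f) (p (opp f) j')) =
      \sum_j \sum_j' k' f j j' *
        Phi (upd (upd xi f (p' f j)) (opp f) (p' (opp f) j'))) ->
  \sum_(l : {ffun F -> J})
    (\prod_(f | is_rep f) k f (l f) (l (opp f))) * Phi (fun f => p f (l f)) =
  \sum_(l : {ffun F -> J})
    (\prod_(f | is_rep f) k' f (l f) (l (opp f))) * Phi (fun f => p' f (l f)).
Proof.
move=> E; rewrite (sum_edge_labels k p Phi) (sum_edge_labels k' p' Phi).
have := @multi_exchange edge (J * J)%type (X * X)%type
  (fun e j => k (val e) j.1 j.2) (fun e j => k' (val e) j.1 j.2)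
  (fun e j => (p (val e) j.1, p (opp (val e)) j.2))
  (fun e j => (p' (val e) j.1, p' (opp (val e)) j.2))
  (fun xi => Phi (on_flags xi)).
apply=> e xi; have := E (val e) (on_flags xi).
by rewrite !pair_big /= => E'; under eq_bigr do rewrite on_flags_upd;
  under [RHS]eq_bigr do rewrite on_flags_upd.
Qed.

End Edges.

End Exchange.

(** * Multilinearity of the forms of vertices *)

Section Slots.
Context (R : realType) (V : vectType R) (ip : {dot V for idfun}).
Context (n : nat) (e : n.-tuple V) (P : palette) (A : feynman_algebra R n P).

Local Notation C := R[i].
Local Notation vecC := (vecC R n).
Local Notation tensC := (tensC R n).

Definition lincomb (J : finType) (w : J -> C) (z : J -> vecC) : vecC :=
  [ffun i => \sum_j w j * z j i].

Lemma pure_slot (F : eqType) (J : finType) m (s : seq F) (x : F -> vecC) f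
    (w : J -> C) (z : J -> vecC) :
  uniq s -> size s = m -> f \in s ->
  pure m (map (upd x f (lincomb w z)) s) =
  \sum_j w j *: pure m (map (upd x f (z j)) s) :> tensC m.
Proof.
move=> us sm fs; apply/ffunP => I; rewrite sum_ffunE ffunE.
have k0m : (index f s < m)%N by rewrite -sm index_mem.
pose k0 := Ordinal k0m.
have at0 y : (map (upd x f y) s)`_k0 = y.
  by rewrite (nth_map f) ?index_mem // nth_index // updE.
have off (k : 'I_m) y y' : k != k0 ->
    (map (upd x f y) s)`_k = (map (upd x f y') s)`_k.
  move=> kk; have kf : nth f s k != f.
    apply: contraNneq kk => kf; rewrite -val_eqE /=.
    by rewrite -[X in index X s]kf index_uniq ?sm.
  by rewrite !(nth_map f) ?sm // !upd_neq.
rewrite (bigD1 k0) //= at0 ffunE mulr_suml; apply: eq_bigr => j _.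
rewrite !ffunE [in RHS](bigD1 k0) //= at0 -mulrA; congr (_ * (_ * _)).
by apply: eq_bigr => k kk; rewrite (off k _ (z j) kk).
Qed.

Lemma map_upd_notin (F : eqType) X (x : F -> X) f y s : f \notin s ->
  map (upd x f y) s = map x s.
Proof.
move=> fs; apply/eq_in_map => g gs; apply: upd_neq.
by apply: contraNneq fs => <-.
Qed.

Lemma tens_pairing_suml m (J : finType) (w : J -> C) (s : J -> tensC m) t :
  tens_pairing ip e (\sum_j w j *: s j) t = \sum_j w j * tens_pairing ip e (s j) t.
Proof.
under [RHS]eq_bigr do rewrite mulr_sumr; rewrite exchange_big /=.
apply: eq_bigr => I _; under [RHS]eq_bigr do rewrite mulr_sumr.
rewrite exchange_big /=; apply: eq_bigr => J' _.
rewrite sum_ffunE -mulrA mulr_suml; apply: eq_bigr => j _.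
by rewrite ffunE -!mulrA.
Qed.

Lemma tens_pairing_sumr m (J : finType) (w : J -> C) (s : J -> tensC m) t :
  tens_pairing ip e t (\sum_j w j *: s j) = \sum_j w j * tens_pairing ip e t (s j).
Proof.
under [RHS]eq_bigr do rewrite mulr_sumr; rewrite exchange_big /=.
apply: eq_bigr => I _; under [RHS]eq_bigr do rewrite mulr_sumr.
rewrite exchange_big /=; apply: eq_bigr => J' _.
rewrite sum_ffunE mulr_sumr mulr_suml; apply: eq_bigr => j _.
by rewrite ffunE mulrCA -!mulrA.
Qed.

Lemma linear_lincomb (U W : lmodType C) (h : {linear U -> W}) (J : finType)
  (w : J -> C) (s : J -> U) : h (\sum_j w j *: s j) = \sum_j w j *: h (s j).
Proof. by rewrite linear_sum; apply: eq_bigr => j _; rewrite linearZ. Qed.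

Lemma scalar_lincomb (U : lmodType C) (h : {scalar U}) (J : finType)
  (w : J -> C) (s : J -> U) : h (\sum_j w j *: s j) = \sum_j w j * h (s j).
Proof. by rewrite linear_sum; apply: eq_bigr => j _; rewrite linearZ. Qed.

Lemma vertex_form_slot (F : eqType) (J : finType) (c : vcolour P) (s t : seq F)
    (x : F -> vecC) f (w : J -> C) (z : J -> vecC) :
  uniq (s ++ t) -> size s = nin c -> size t = nout c -> f \in s ++ t ->
  vertex_form ip e A c (map (upd x f (lincomb w z)) s)
    (map (upd x f (lincomb w z)) t) =
  \sum_j w j * vertex_form ip e A c (map (upd x f (z j)) s) (map (upd x f (z j)) t).
Proof.
rewrite cat_uniq mem_cat => /and3P[us st ut] sc tc.
case: c sc tc => [m k a|k b|k g] /= sc tc.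
- have [fs|fs] := boolP (f \in s) => /= [_|ft].
    have ft : f \notin t by apply: contra st => ft; apply/hasP; exists f.
    rewrite (pure_slot _ _ _ us sc fs) linear_lincomb tens_pairing_suml.
    by apply: eq_bigr => j _; rewrite !(map_upd_notin _ _ ft).
  rewrite (pure_slot _ _ _ ut tc ft) tens_pairing_sumr.
  by apply: eq_bigr => j _; rewrite !(map_upd_notin _ _ fs).
- by rewrite (size0nil tc) in_nil orbF => fs; rewrite (pure_slot _ _ _ us sc fs) scalar_lincomb.
- by rewrite (size0nil tc) in_nil orbF => fs; rewrite (pure_slot _ _ _ us sc fs) scalar_lincomb.
Qed.

Section StarForm.
Context (vert endp flag : finType) (colour : vert -> vcolour P).
Context (base : flag -> vert + endp) (ins outs : vert -> seq flag).
Hypothesis star_uniq : forall v, uniq (ins v ++ outs v).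
Hypothesis starP : forall v f, (f \in ins v ++ outs v) = (base f == inl v).
Hypothesis size_ins : forall v, size (ins v) = nin (colour v).
Hypothesis size_outs : forall v, size (outs v) = nout (colour v).

(** Defined from the incidences only: the sums over complements use it before
    the edges are chosen. *)
Definition star_form (x : flag -> vecC) : C :=
  \prod_v vertex_form ip e A (colour v) (map x (ins v)) (map x (outs v)).

Lemma star_form_external (x : flag -> vecC) f p y : base f = inr p ->
  star_form (upd x f y) = star_form x.
Proof.
move=> fp; apply: eq_bigr => v _.
have : f \notin ins v ++ outs v by rewrite starP fp.
by rewrite mem_cat negb_or => /andP[fs ft]; rewrite !map_upd_notin.
Qed.

Lemma star_form_slot (J : finType) (x : flag -> vecC) f v0
    (w : J -> C) (z : J -> vecC) : base f = inl v0 ->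
  star_form (upd x f (lincomb w z)) =
  \sum_j w j * star_form (upd x f (z j)).
Proof.
move=> bf; rewrite /star_form (bigD1 v0) //= vertex_form_slot //; last first.
  by rewrite starP bf.
rewrite mulr_suml; apply: eq_bigr => j _.
rewrite -mulrA [in RHS](bigD1 v0) //=; congr (_ * (_ * _)).
apply: eq_bigr => v vv0.
have : f \notin ins v ++ outs v.
  by rewrite starP bf; apply: contra vv0 => /eqP[->].
by rewrite mem_cat negb_or => /andP[fs ft]; rewrite !map_upd_notin.
Qed.

End StarForm.

Section DiagramForm.
Context (vert endp flag : finType) (D : diagram P vert endp flag).

Definition diagram_form : (flag -> vecC) -> C :=
  star_form (colour D) (ins D) (outs D).

Lemma diagram_form_external (x : flag -> vecC) f y : ~~ internal D f ->
  diagram_form (upd x f y) = diagram_form x.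
Proof.
rewrite /internal; case bf: (base D f) => [//|p] _.
by apply: (star_form_external (base := base D) _ _ _ _ bf) => // v g; exact: starP.
Qed.

Lemma diagram_form_slot (J : finType) (x : flag -> vecC) f
    (w : J -> C) (z : J -> vecC) : internal D f ->
  diagram_form (upd x f (lincomb w z)) =
  \sum_j w j * diagram_form (upd x f (z j)).
Proof.
rewrite /internal; case bf: (base D f) => [v0|] // _.
by apply: (star_form_slot (base := base D) _ _ _ _ _ _ _ bf) => v;
  [exact: star_uniq|exact: starP|exact: size_ins|exact: size_outs].
Qed.

End DiagramForm.
End Slots.

(** * Amplitudes in an orthonormal basis *)

Lemma big_option (K : nmodType) (T : finType) (G : option T -> K) :
  \sum_j G j = G None + \sum_i G (Some i).
Proof.
rewrite (bigD1 None) //=; congr (_ + _).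
rewrite (reindex_omap Some id) => [|[]] //.
by apply: eq_bigl => i; rewrite eqxx.
Qed.

HB.instance Definition _ (I : choiceType) :=
  Monoid.isComLaw.Build (cmonom I) (onecm I) (@mulcm I)
    (@mulcmA I) (@mulcmC I) (@mul0cm I).

Section Monomials.
Context (R : realType) (P : palette).

Local Notation C := R[i].

Definition colour_monomial (c : vcolour P) : cmonom (var P) :=
  if var_of c is Some w then ucm w else onecm _.

Lemma vertex_weightE c : vertex_weight R c = mkmalgU (colour_monomial c) 1.
Proof. by rewrite /vertex_weight /colour_monomial; case: var_of. Qed.

Lemma mkmalgUM (w w' : cmonom (var P)) (a a' : C) :
  (mkmalgU w a : xpoly R P) * mkmalgU w' a' = mkmalgU (mulcm w w') (a * a').
Proof. by rewrite [LHS]malgM_def fgmulUU. Qed.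

Lemma scale_mkmalgU (a b : C) (w : cmonom (var P)) :
  a *: (mkmalgU w b : xpoly R P) = mkmalgU w (a * b).
Proof.
apply/malgP => k; transitivity (a * mcoeff k (mkmalgU w b)).
  exact: mcoeffZ.
transitivity (a * (b *+ (w == k))); first by congr (_ * _); exact: mcoeffU.
by rewrite mulrnAr; apply/esym; exact: mcoeffU.
Qed.

Lemma prod_mkmalgU (I : finType) (w : I -> cmonom (var P)) (a : I -> C) :
  \prod_i (mkmalgU (w i) (a i) : xpoly R P) =
  mkmalgU (\big[@mulcm _/onecm _]_i w i) (\prod_i a i).
Proof.
apply: (big_ind3 (fun (x : xpoly R P) m b => x = mkmalgU m b)).
- exact: (esym (mpolyC1E _ _)).
- by move=> x1 m1 b1 x2 m2 b2 -> ->; exact: mkmalgUM.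
- by [].
Qed.

End Monomials.

Lemma sum_ffun_some (K : nmodType) (I J : finType) (G : {ffun I -> option J} -> K) :
  (forall (l : {ffun I -> option J}) i, l i = None -> G l = 0) ->
  \sum_l G l = \sum_(m : {ffun I -> J}) G [ffun i => Some (m i)].
Proof.
move=> G0; pose h (m : {ffun I -> J}) : {ffun I -> option J} := [ffun i => Some (m i)].
have h_inj : injective h.
  move=> m m' /ffunP mm; apply/ffunP => i.
  by have := mm i; rewrite !ffunE => -[].
rewrite (bigID (mem [set h m | m in {ffun I -> J}]%SET)) /=.
rewrite [X in _ + X]big1 ?addr0 => [|l lh]; last first.
  have [i /G0 //] : exists i, l i = None.
  apply: contrapT => lN; case/negP: lh.
  have lS i : isSome (l i) by case li : (l i) => //; case: lN; exists i.
  apply/imsetP; exists [ffun i => oget (lS i)] => //.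
  by apply/ffunP => i; rewrite !ffunE ogetK.
by rewrite big_imset //= => m m' _ _; exact: h_inj.
Qed.

Section Orthonormal.
Context (R : realType) (V : vectType R) (ip : {dot V for idfun}).
Context (n : nat) (e : n.-tuple V) (e_basis : basis_of {:V} e).
Context (u : 'I_n -> V).
Hypothesis ou : orthonormal_family ip u.
Context (P : palette) (A : feynman_algebra R n P).

Local Notation C := R[i].
Local Notation vecC := (vecC R n).

Lemma size_basis_dim : n = \dim {:V}.
Proof. by rewrite (size_basis e_basis). Qed.

Let nV := size_basis_dim.

Definition onb (k : 'I_n) : vecC := to_vecC e (u k).

Lemma to_vecC_lincomb v :
  to_vecC e v = lincomb (fun k => (ip v (u k))%:C%C) onb.
Proof.
apply/ffunP => i; rewrite !ffunE {1}(orthonormal_expansion nV ou v).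
rewrite linear_sum /= rmorph_sum /=; apply: eq_bigr => k _.
by rewrite linearZ /= rmorphM ffunE.
Qed.

(** With [B] the matrix of the products of the two bases, [gram = B *m B^T], hence
    [B^T *m invmx gram *m B] is the identity. *)
Lemma inverse_gram_contraction k l :
  \sum_i \sum_j invmx (gram ip e) i j * (ip e`_i (u k) * ip e`_j (u l)) =
  (k == l)%:R.
Proof.
pose B : 'M[R]_n := \matrix_(i, k) ip e`_i (u k).
pose B' : 'M[R]_n := \matrix_(k, i) coord e i (u k).
have B'B : B' *m B = 1%:M.
  apply/matrixP => k' l'; rewrite !mxE -ou [in RHS](coord_basis e_basis (memvf (u k'))).
  by rewrite ip_suml; apply: eq_bigr => i _; rewrite !mxE ipZl.
have gB : gram ip e = B *m B^T.
  apply/matrixP => i j; rewrite !mxE (parseval nV ou).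
  by apply: eq_bigr => k' _; rewrite !mxE.
have [_ Bu] := mulmx1_unit B'B.
have gu : gram ip e \in unitmx by rewrite gB unitmx_mul unitmx_tr Bu.
have h : B^T *m invmx (gram ip e) *m B = 1%:M.
  have : gram ip e *m (invmx B^T *m invmx B) = 1%:M.
    by rewrite gB mulmxA mulmxK ?unitmx_tr // mulmxV.
  move=> /(congr1 (mulmx (invmx (gram ip e)))); rewrite mulmx1 mulKmx // => <-.
  by rewrite mulmxA mulmxV ?unitmx_tr // mul1mx mulVmx.
move: h => /matrixP /(_ k l); rewrite !mxE => <-.
rewrite exchange_big /=; apply: eq_bigr => j _; rewrite !mxE mulr_suml.
by apply: eq_bigr => i _; rewrite !mxE; ring.
Qed.

Section Amplitude.
Context (vert endp flag : finType) (D : diagram P vert endp flag).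

Definition matched (m : {ffun flag -> 'I_n}) : bool :=
  [forall f, m (opp D f) == m f].

Local Notation form := (diagram_form ip e A D).

(** The weights and vectors of an edge in the definition of the amplitude. *)
Let oedge (v : V) (f : flag) (j j' : option 'I_n) : C :=
  if (isSome j == inner D f) && (isSome j' == inner D f) then
    if (j, j') is (Some a, Some b) then (invmx (gram ip e) a b)%:C%C
    else if internal D f || internal D (opp D f) then 1 else (ip v v)%:C%C
  else 0.

Let slot_vec (v : V) (f : flag) (j : option 'I_n) : vecC :=
  to_vecC e (if j is Some a then e`_a else v).

Let end_weight (v : V) (f : flag) (a : 'I_n) : C :=
  if internal D f then 1 else (ip v (u a))%:C%C.

(** The weight of an edge in the orthonormal basis: equal labels at both ends,
    and a coordinate of [v] at every end that is an endpoint. *)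
Let nedge (v : V) (f : flag) (j j' : option 'I_n) : C :=
  if (j, j') is (Some a, Some b) then
    (a == b)%:R * (end_weight v f a * end_weight v (opp D f) b)
  else 0.

Let onb_vec (f : flag) (j : option 'I_n) : vecC :=
  if j is Some a then onb a else 0.

(** The functionals by which both sides contract one edge agree: this is a
    change of basis for an inner edge and the expansion of [v] otherwise. *)
Let edge_functional v f (xi : flag -> vecC) :
  \sum_j \sum_j' oedge v f j j' *
     form (upd (upd xi f (slot_vec v f j)) (opp D f) (slot_vec v (opp D f) j')) =
  \sum_j \sum_j' nedge v f j j' *
     form (upd (upd xi f (onb_vec f j)) (opp D f) (onb_vec (opp D f) j')).
Proof.
have updC (x y : vecC) : upd (upd xi f x) (opp D f) y = upd (upd xi (opp D f) y) f x.
  apply/funext => g; rewrite /upd; case: eqP => [->|//].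
  by rewrite (negbTE (opp_neq D f)).
have nedgeE : \sum_j \sum_j' nedge v f j j' *
     form (upd (upd xi f (onb_vec f j)) (opp D f) (onb_vec (opp D f) j')) =
   \sum_a end_weight v f a * end_weight v (opp D f) a *
     form (upd (upd xi f (onb a)) (opp D f) (onb a)).
  rewrite big_option [X in X + _]big1 => [|j' _]; last by rewrite mul0r.
  rewrite add0r; apply: eq_bigr => a _.
  rewrite big_option /nedge mul0r add0r (bigD1 a) //= eqxx mul1r big1 ?addr0 //.
  by move=> b ba; rewrite eq_sym (negbTE ba) !mul0r.
have innerE : inner D (opp D f) = inner D f by rewrite /inner oppK andbC.
have outerE : ~~ inner D f -> \sum_j \sum_j' oedge v f j j' *
     form (upd (upd xi f (slot_vec v f j)) (opp D f) (slot_vec v (opp D f) j')) =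
   (if internal D f || internal D (opp D f) then 1 else (ip v v)%:C%C) *
     form (upd (upd xi f (to_vecC e v)) (opp D f) (to_vecC e v)).
  move=> /negbTE inf; rewrite big_option [X in _ + X]big1 => [|a _]; last first.
    by rewrite big1 // => j' _; rewrite /oedge inf mul0r.
  rewrite addr0 big_option [X in _ + X]big1 => [|a _]; last first.
    by rewrite /oedge inf /= mul0r.
  by rewrite addr0 /oedge inf.
rewrite nedgeE; have [inf|inf] := boolP (inner D f).
  have /andP[fi fo] := inf.
  rewrite big_option [X in X + _]big1 => [|j' _]; last first.
    by rewrite /oedge inf mul0r.
  rewrite add0r.
  pose B i k : C := (ip e`_i (u k))%:C%C.
  transitivity (\sum_i \sum_j (invmx (gram ip e) i j)%:C%C *
     \sum_k \sum_l (B i k * B j l) * form (upd (upd xi f (onb k)) (opp D f) (onb l))).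
    apply: eq_bigr => i _; rewrite big_option {1}/oedge inf /= mul0r add0r.
    apply: eq_bigr => j _; rewrite {1}/oedge inf /=; congr (_ * _).
    rewrite /slot_vec [X in upd _ (opp D f) X]to_vecC_lincomb diagram_form_slot //.
    rewrite [RHS]exchange_big /=; apply: eq_bigr => l _.
    rewrite updC to_vecC_lincomb diagram_form_slot // mulr_sumr.
    by apply: eq_bigr => k _; rewrite updC /B mulrCA mulrA.
  transitivity (\sum_k \sum_l (\sum_i \sum_j (invmx (gram ip e) i j)%:C%C * (B i k * B j l)) *
      form (upd (upd xi f (onb k)) (opp D f) (onb l))).
    under eq_bigr do under eq_bigr do rewrite mulr_sumr.
    under eq_bigr do rewrite exchange_big /=.
    rewrite exchange_big /=; apply: eq_bigr => k _.
    under eq_bigr do under eq_bigr do rewrite mulr_sumr.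
    under eq_bigr do rewrite exchange_big /=.
    rewrite exchange_big /=; apply: eq_bigr => l _.
    rewrite mulr_suml; apply: eq_bigr => i _; rewrite mulr_suml.
    by apply: eq_bigr => j _; rewrite mulrA.
  apply: eq_bigr => k _; rewrite (bigD1 k) //= [X in _ + X]big1 ?addr0 => [|l lk].
    congr (_ * _); rewrite /end_weight fi fo mulr1.
    transitivity ((\sum_i \sum_j invmx (gram ip e) i j * (ip e`_i (u k) * ip e`_j (u k)))%:C%C).
      rewrite rmorph_sum; apply: eq_bigr => i _.
      by rewrite rmorph_sum; apply: eq_bigr => j _; rewrite !rmorphM.
    by rewrite inverse_gram_contraction eqxx.
  rewrite (_ : \sum_i _ = (\sum_i \sum_j invmx (gram ip e) i j * (ip e`_i (u k) * ip e`_j (u l)))%:C%C).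
    by rewrite inverse_gram_contraction eq_sym (negbTE lk) mul0r.
  rewrite rmorph_sum; apply: eq_bigr => i _.
  by rewrite rmorph_sum; apply: eq_bigr => j _; rewrite !rmorphM.
rewrite outerE // /end_weight.
have [fi|fi] := boolP (internal D f) => /=.
  have fo : ~~ internal D (opp D f) by move: inf; rewrite /inner fi.
  rewrite mul1r diagram_form_external // [X in upd _ f X]to_vecC_lincomb diagram_form_slot //.
  apply: eq_bigr => a _; rewrite (negbTE fo) mul1r; congr (_ * _).
  by apply/esym; exact: diagram_form_external.
have [fo|fo] := boolP (internal D (opp D f)).
  rewrite mul1r updC diagram_form_external // [X in upd _ _ X]to_vecC_lincomb diagram_form_slot //.
  apply: eq_bigr => a _; rewrite mulr1 updC; congr (_ * _).
  by apply/esym; exact: diagram_form_external.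
rewrite !diagram_form_external //.
transitivity ((\sum_a ip v (u a) * ip v (u a))%:C%C * form xi).
  by rewrite -parseval.
rewrite rmorph_sum mulr_suml; apply: eq_bigr => a _.
by rewrite !diagram_form_external // rmorphM.
Qed.

Definition amplitude_coef (v : V) : C :=
  \sum_(m : {ffun flag -> 'I_n} | matched m)
    (\prod_(f | ~~ internal D f) (ip v (u (m f)))%:C%C) * form (onb \o m).

Definition weight : cmonom (var P) :=
  \big[@mulcm _/onecm _]_x colour_monomial (colour D x).

(** The amplitude is a single monomial in the variables, so that its coefficient
    can be treated as a number. *)
Lemma amplitude_orthonormal v :
  amplitude ip e A D v = mkmalgU weight (amplitude_coef v).
Proof.
transitivity (mkmalgU weight (\sum_(l : {ffun flag -> option 'I_n})
    (\prod_(f | is_rep (opp D) f) oedge v f (l f) (l (opp D f))) *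
      form (fun f => slot_vec v f (l f))) : xpoly R P).
  rewrite raddf_sum /amplitude [LHS]big_mkcond; apply: eq_bigr => l _.
  case: ifPn => [/forallP lin|/forallPn[f lf]].
    have -> : \prod_x (vertex_form ip e A (colour D x) (map (slot e v l) (ins D x))
        (map (slot e v l) (outs D x)) *: vertex_weight R (colour D x)) =
        mkmalgU weight (form (fun f => slot_vec v f (l f))).
      rewrite -prod_mkmalgU; apply: eq_bigr => x _.
      by rewrite vertex_weightE scale_mkmalgU mulr1.
    rewrite scale_mkmalgU; congr (mkmalgU _ (_ * _)).
    apply: eq_bigr => f _.
    rewrite /edge_weight /oedge (eqP (lin f)) eqxx.
    have -> : isSome (l (opp D f)) == inner D f.
      by rewrite (eqP (lin (opp D f))) /inner oppK andbC.
    by case: (l f) => //; case: (l (opp D f)).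
  have inner_opp g : inner D (opp D g) = inner D g by rewrite /inner oppK andbC.
  have [g gr gl] : exists2 g, is_rep (opp D) g &
      ~~ ((isSome (l g) == inner D g) && (isSome (l (opp D g)) == inner D g)).
    have [fr|fr] := boolP (is_rep (opp D) f).
      by exists f => //; rewrite negb_and lf.
    exists (opp D f); first by rewrite (is_rep_opp (oppK D) (opp_neq D)).
    by rewrite oppK inner_opp negb_and lf orbT.
  have -> : \prod_(f | is_rep (opp D) f) oedge v f (l f) (l (opp D f)) = 0.
    by rewrite (bigD1 g gr) /= /oedge (negbTE gl) mul0r.
  by rewrite mul0r raddf0.
rewrite (edge_exchange (oppK D) (opp_neq D) (k' := nedge v) (p' := onb_vec)); last first.
  exact: edge_functional.
congr mkmalgU; rewrite /amplitude_coef.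
pose h (m : {ffun flag -> 'I_n}) : {ffun flag -> option 'I_n} := [ffun f => Some (m f)].
rewrite sum_ffun_some => [|l f lf]; last first.
  pose g := if is_rep (opp D) f then f else opp D f.
  have gr : is_rep (opp D) g := edge_of_subproof (oppK D) (opp_neq D) f.
  rewrite (bigD1 g gr) /=.
  have -> : nedge v g (l g) (l (opp D g)) = 0.
    rewrite /g /nedge; case: ifP => _; rewrite ?oppK lf //.
    by case: (l _).
  by rewrite !mul0r.
rewrite [RHS]big_mkcond /=; apply: eq_bigr => m _; rewrite -/(h m).
have -> : form (fun f => onb_vec f (h m f)) = form (onb \o m).
  by congr form; apply/funext => f; rewrite ffunE.
case: ifPn => [/forallP mm|/forallPn[f mf]].
  congr (_ * _); transitivity (\prod_f end_weight v f (m f)); last first.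
    rewrite [RHS]big_mkcond /=; apply: eq_bigr => f _.
    by rewrite /end_weight; case: ifP.
  rewrite [RHS](bigID (is_rep (opp D))) /=.
  rewrite [X in _ = _ * X](reindex_inj (inv_inj (oppK D))) /=.
  rewrite [X in _ = _ * X](eq_bigl (is_rep (opp D))) => [|f]; last first.
    by rewrite (is_rep_opp (oppK D) (opp_neq D)) negbK.
  rewrite -big_split /=; apply: eq_bigr => f _.
  by rewrite !ffunE /nedge eq_sym (mm f) mul1r.
pose g := if is_rep (opp D) f then f else opp D f.
have gr : is_rep (opp D) g := edge_of_subproof (oppK D) (opp_neq D) f.
rewrite (bigD1 g gr) /=.
have -> : nedge v g (h m g) (h m (opp D g)) = 0.
  rewrite /nedge !ffunE /g; case: ifP => _; rewrite ?oppK.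
    by rewrite eq_sym (negbTE mf) mul0r.
  by rewrite (negbTE mf) mul0r.
by rewrite !mul0r.
Qed.

(** The coefficients, in the orthonormal basis, of the tensor that the diagram
    defines on its endpoints. *)
Definition tensor (a : {ffun endp -> 'I_n}) : C :=
  \sum_(m : {ffun flag -> 'I_n} | matched m && [forall p, m (leg D p) == a p])
    form (onb \o m).

Lemma not_internal f : ~~ internal D f = [exists p, f == leg D p].
Proof.
rewrite /internal; case bf: (base D f) => [x|p] /=; apply/esym/existsP.
  by case=> p; rewrite -legP bf.
by exists p; rewrite -legP bf.
Qed.

Lemma leg_inj : injective (leg D).
Proof.
move=> p q pq; have := eqxx (leg D p); rewrite -[X in _ == X]/(leg D p) -legP => /eqP b1.
by have := eqxx (leg D q); rewrite -legP -pq b1 => /eqP[].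
Qed.

Lemma amplitude_coef_tensor v :
  amplitude_coef v = \sum_(a : {ffun endp -> 'I_n})
    tensor a * (\prod_p ip v (u (a p)))%:C%C.
Proof.
pose ends (m : {ffun flag -> 'I_n}) : {ffun endp -> 'I_n} := [ffun p => m (leg D p)].
rewrite /amplitude_coef (partition_big ends xpredT) //=; apply: eq_bigr => a _.
rewrite /tensor mulr_suml; apply: eq_big => [m|m /andP[_ /eqP <-]].
  congr (_ && _); apply/eqP/forallP => [<- p|h]; first by rewrite ffunE.
  by apply/ffunP => p; rewrite ffunE; apply/eqP.
rewrite mulrC; congr (_ * _); rewrite rmorph_prod /=.
under [RHS]eq_bigr do rewrite ffunE.
rewrite -(big_imset (fun f => (ip v (u (m f)))%:C%C) (in2W leg_inj)) /=.
apply: eq_bigl => f; rewrite not_internal; apply/existsP/imsetP => [[p /eqP ->]|[p _ ->]].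
  by exists p.
by exists p.
Qed.

End Amplitude.
End Orthonormal.

(** * Gluing *)

Section Components.
Context (P : palette) (V1 V2 E F1 F2 : finType).
Context (D1 : diagram P V1 E F1) (D2 : diagram P V2 E F2).

Local Notation F := (F1 + F2)%type.
Local Notation seam := (seam D1 D2).
Local Notation cross := (cross D1 D2).
Local Notation jump := (jump D1 D2).
Local Notation pre_opp := (pre_opp D1 D2).
Local Notation at_vertex := (at_vertex D1 D2).
Local Notation other_end := (other_end D1 D2).
Local Notation gflag := (glued_flag D1 D2).

Lemma seam_sym : symmetric seam.
Proof.
suff sub f g : seam f g -> seam g f by move=> f g; apply/idP/idP; exact: sub.
case/orP => /eqP ->; apply/orP; [left|right]; apply/eqP.
  by rewrite pre_oppK.
by rewrite jumpK.
Qed.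

Lemma connect_seam_sym : connect_sym seam.
Proof. exact/sym_connect_sym/seam_sym. Qed.

Lemma seam_closed (T : eqType) (M : F -> T) :
  (forall f, M (pre_opp f) = M f) -> (forall f, M (jump f) = M f) ->
  forall f g, connect seam f g -> M f = M g.
Proof.
move=> Mo Mj f g fg.
have cl : fingraph.closed seam [pred h | M h == M f].
  move=> x y /orP[] /eqP ->; rewrite !inE ?Mo ?Mj //.
by have := closed_connect cl fg; rewrite !inE eqxx => /esym/eqP.
Qed.

(** From a germ at a vertex, the walk along edges and glued points ends at
    [other_end f], and together with its reversal it exhausts the component. *)
Lemma seam_vertices f g : at_vertex f -> at_vertex g -> connect seam f g ->
  g = f \/ g = other_end f.
Proof.
move=> fv gv fg; have [k [oE kv klt]] := other_endP fv.
have jf : jump f = f by apply/eqP; rewrite -at_vertex_jump.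
have jk : jump (iter k.+1 cross f) = iter k.+1 cross f.
  by apply/eqP; rewrite -at_vertex_jump.
pose T := [pred h | [exists j : 'I_k.+2,
  (h == iter j cross f) || (h == jump (iter j cross f))]].
have inT (j : nat) h : (j < k.+2)%N -> h = iter j cross f \/ h = jump (iter j cross f) ->
    h \in T.
  move=> jk2 hE; apply/existsP; exists (Ordinal jk2) => /=.
  by case: hE => ->; rewrite eqxx ?orbT.
have clT : fingraph.closed seam T.
  apply: (intro_closed connect_seam_sym) => x y /orP[] /eqP -> /existsP[[j jk2] /= hj].
    have back : (j < k.+2)%N -> pre_opp (iter j cross f) \in T.
      case: j {hj jk2} => [_|j jk2].
        by apply: (inT 1%N) => //; left; rewrite /= /cross jf.
      by apply: (inT j); [exact: ltnW|right; rewrite iterS /cross pre_oppK].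
    case/orP: hj => /eqP ->; first exact: back.
    have [jk1|] := ltnP j k.+1.
      by apply: (inT j.+1) => //; left.
    move=> kj; have -> : j = k.+1 by apply/eqP; rewrite eqn_leq -ltnS jk2.
    rewrite jk; move: back; have -> : j = k.+1 by apply/eqP; rewrite eqn_leq -ltnS jk2.
    exact.
  by case/orP: hj => /eqP ->; apply: (inT j) => //; [right|left; rewrite jumpK].
have : g \in T.
  by rewrite -(closed_connect clT fg); apply: (inT 0%N) => //; left.
move=> /existsP[[j jk2] /= gj].
have jv : at_vertex (iter j cross f).
  by case/orP: gj => /eqP gE; move: gv; rewrite gE ?at_vertexJ.
have gE : g = iter j cross f.
  case/orP: gj => /eqP -> //; apply/eqP; rewrite -at_vertex_jump //.
rewrite gE; case: j jk2 jv {gj gE} => [|j] jk2 jv; first by left.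
right; rewrite oE; have [jk'|kj] := ltnP j k; first by have := klt _ jk'; rewrite jv.
by have -> : j = k by apply/eqP; rewrite eqn_leq kj andbT -ltnS.
Qed.

Lemma connect_other_end f : at_vertex f -> connect seam f (other_end f).
Proof.
move=> /other_endP[k [-> _ _]]; elim: k.+1 => [|j IHj]; first exact: connect0.
apply: connect_trans IHj _; rewrite iterS.
apply: (@connect_trans _ _ (jump (iter j cross f))); apply: connect1; apply/orP.
  by right.
by left.
Qed.

Definition seam_invariant (T : eqType) (M : {ffun F -> T}) : bool :=
  [forall f, (M (pre_opp f) == M f) && (M (jump f) == M f)].

Lemma seam_invariantP (T : eqType) (M : {ffun F -> T}) :
  reflect (forall f g, connect seam f g -> M f = M g) (seam_invariant M).
Proof.
apply: (iffP forallP) => [h|h f].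
  by apply: seam_closed => f; have /andP[/eqP ? /eqP ?] := h f.
by apply/andP; split; apply/eqP/esym/h/connect1/orP; [left|right].
Qed.

Definition glued_restrict (T : Type) (M : {ffun F -> T}) : {ffun gflag -> T} :=
  [ffun f => M (val f)].

Lemma glued_restrict_matched n (M : {ffun F -> 'I_n}) :
  seam_invariant M -> matched (glue D1 D2) (glued_restrict M).
Proof.
move=> /seam_invariantP h; apply/forallP => f; rewrite !ffunE /= val_glued_opp.
by apply/eqP/esym/h/connect_other_end/(valP f).
Qed.

(** On a component of the seam that meets a vertex, the label is that of its two
    germs at vertices, which are exchanged by [glued_opp]; the label of a circle
    is arbitrary. *)
Lemma card_seam_extensions n (m : {ffun gflag -> 'I_n}) :
  matched (glue D1 D2) m ->
  #|[pred M : {ffun F -> 'I_n} | seam_invariant M && (glued_restrict M == m)]| =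
  (n ^ circles D1 D2)%N.
Proof.
move=> /forallP mm.
pose free : pred F := [pred f | [forall g, connect seam f g ==> ~~ at_vertex g]].
have free_connect f g : connect seam f g -> free f = free g.
  move=> fg; apply/forallP/forallP => h x; apply/implyP => cx; apply: (implyP (h x)).
    exact: connect_trans fg cx.
  by apply: connect_trans cx; rewrite connect_seam_sym.
have Efree f (g : gflag) : connect seam f (val g) -> ~~ free f.
  by move=> fg; apply/forallPn; exists (val g); rewrite fg (valP g).
have mconst (g g' : gflag) : connect seam (val g) (val g') -> m g = m g'.
  move=> gg; have [/val_inj -> //|gE] := seam_vertices (valP g) (valP g') gg.
  have -> : g' = glued_opp g by apply: val_inj; rewrite val_glued_opp.
  by rewrite (eqP (mm g)).
pose Cset := [pred f | (f \in roots seam) && free f].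
pose Circ : finType := {f : F | Cset f}.
have -> : circles D1 D2 = #|Circ|.
  by rewrite card_sig; apply: eq_card => f; rewrite !inE.
rewrite -[n in (n ^ _)%N]card_ord -card_ffun.
pose rho (M : {ffun F -> 'I_n}) : {ffun Circ -> 'I_n} := [ffun c => M (val c)].
rewrite -(@card_in_imset _ _ rho); last first.
  move=> M M' /andP[/seam_invariantP hM /eqP Mm] /andP[/seam_invariantP hM' /eqP Mm'] rr.
  apply/ffunP => f; have [ff|/forallPn[g]] := boolP (free f).
    have rf : Cset (fingraph.root seam f).
      apply/andP; split; first exact: (roots_root connect_seam_sym).
      by rewrite (free_connect _ f) // connect_seam_sym connect_root.
    have /ffunP/(_ (Sub _ rf : Circ)) := rr; rewrite !ffunE /=.
    by rewrite -(hM _ _ (connect_root _ f)) -(hM' _ _ (connect_root _ f)).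
  rewrite negb_imply negbK => /andP[fg gv].
  rewrite (hM _ _ fg) (hM' _ _ fg).
  have /ffunP/(_ (Sub _ gv : gflag)) : glued_restrict M = glued_restrict M' by rewrite Mm.
  by rewrite !ffunE.
rewrite -cardsT; apply: eq_card => c; rewrite inE; apply/imsetP.
have ex f : exists k : 'I_n, (forall x : Circ, val x = fingraph.root seam f -> k = c x) /\
    (forall g : gflag, connect seam f (val g) -> k = m g).
  have [ff|/forallPn[g]] := boolP (free f).
    have rf : Cset (fingraph.root seam f).
      apply/andP; split; first exact: (roots_root connect_seam_sym).
      by rewrite (free_connect _ f) // connect_seam_sym connect_root.
    exists (c (Sub _ rf)); split=> [x xE|g fg].
      by congr (c _); apply: val_inj.
    by have := Efree _ _ fg; rewrite ff.
  rewrite negb_imply negbK => /andP[fg gv].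
  exists (m (Sub _ gv)); split=> [x xE|g' fg'].
    have xg : connect seam (val x) (val (Sub _ gv : gflag)).
      by rewrite xE; apply: connect_trans fg; rewrite connect_seam_sym connect_root.
    by have := Efree _ _ xg; have /andP[_ ->] := valP x.
  by apply: mconst; apply: connect_trans fg'; rewrite connect_seam_sym.
have [M MP] := choice ex.
exists [ffun f => M f]; last first.
  apply/ffunP => x; rewrite !ffunE; apply/esym/(MP _).1.
  by have /andP[/eqP -> _] := valP x.
apply/andP; split.
  apply/seam_invariantP => f g fg; rewrite !ffunE.
  have rfg : fingraph.root seam f = fingraph.root seam g by apply/eqP; rewrite root_connect //; exact: connect_seam_sym.
  have [ff|/forallPn[x]] := boolP (free f).
    have rf : Cset (fingraph.root seam f).
      apply/andP; split; first exact: (roots_root connect_seam_sym).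
      by rewrite (free_connect _ f) // connect_seam_sym connect_root.
    by rewrite ((MP f).1 (Sub _ rf)) // ((MP g).1 (Sub _ rf)).
  rewrite negb_imply negbK => /andP[fx xv].
  rewrite ((MP f).2 (Sub _ xv)) // ((MP g).2 (Sub _ xv)) //=.
  by apply: connect_trans fx; rewrite connect_seam_sym.
apply/eqP/ffunP => g; rewrite !ffunE; apply: (MP _).2; exact: connect0.
Qed.

End Components.

Section Gluing.
Context (R : realType) (V : vectType R) (ip : {dot V for idfun}).
Context (n : nat) (e : n.-tuple V) (u : 'I_n -> V).
Context (P : palette) (A : feynman_algebra R n P).
Context (V1 V2 E F1 F2 : finType).
Context (D1 : diagram P V1 E F1) (D2 : diagram P V2 E F2).

Local Notation F := (F1 + F2)%type.
Local Notation C := R[i].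
Local Notation onb := (onb e u).

Lemma diagram_form_glue (X : F -> vecC R n) :
  diagram_form ip e A (glue D1 D2) (X \o val) =
  diagram_form ip e A D1 (X \o inl) * diagram_form ip e A D2 (X \o inr).
Proof.
have slots v : map (X \o val) (glued_ins D1 D2 v) = map X (pre_ins D1 D2 v) /\
    map (X \o val) (glued_outs D1 D2 v) = map X (pre_outs D1 D2 v).
  have [iv ov] := pre_star_at_vertex D1 D2 v.
  by rewrite !(map_comp X val) /glued_ins /glued_outs !val_restrict_flags.
rewrite /diagram_form /star_form big_sumType /=; congr (_ * _); apply: eq_bigr => v _.
  by rewrite (slots (inl v)).1 (slots (inl v)).2 /= -!map_comp.
by rewrite (slots (inr v)).1 (slots (inr v)).2 /= -!map_comp.
Qed.

Let Psi (M : {ffun F -> 'I_n}) : C :=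
  diagram_form ip e A D1 (onb \o (M \o inl)) *
  diagram_form ip e A D2 (onb \o (M \o inr)).

Lemma sum_glued_labels (v : V) :
  (n ^ circles D1 D2)%:R * amplitude_coef ip e u A (glue D1 D2) v =
  \sum_(M : {ffun F -> 'I_n} | seam_invariant D1 D2 M) Psi M.
Proof.
rewrite (partition_big (@glued_restrict _ _ _ _ _ _ D1 D2 _)
  (matched (glue D1 D2))) /=; last by move=> M; exact: glued_restrict_matched.
rewrite /amplitude_coef mulr_sumr; apply: eq_bigr => m mm.
rewrite (eq_bigr (fun=> diagram_form ip e A (glue D1 D2) (onb \o m))); last first.
  move=> M /andP[_ /eqP <-].
  transitivity (diagram_form ip e A (glue D1 D2) ((onb \o M) \o val)).
    exact: (esym (diagram_form_glue (onb \o M))).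
  congr diagram_form.
  by apply/funext => f; rewrite /= ffunE.
rewrite sumr_const (card_seam_extensions mm) big1 ?mul1r ?mulr_natl //.
Qed.

Lemma sum_matching_labels :
  \sum_(M : {ffun F -> 'I_n} | seam_invariant D1 D2 M) Psi M =
  \sum_(a : {ffun E -> 'I_n}) tensor ip e u A D1 a * tensor ip e u A D2 a.
Proof.
pose pr (M : {ffun F -> 'I_n}) : {ffun F1 -> 'I_n} * {ffun F2 -> 'I_n} :=
  ([ffun f => M (inl f)], [ffun f => M (inr f)]).
pose join (p : {ffun F1 -> 'I_n} * {ffun F2 -> 'I_n}) : {ffun F -> 'I_n} :=
  [ffun f => match f with inl f1 => p.1 f1 | inr f2 => p.2 f2 end].
have prK : cancel pr join.
  by move=> M; apply/ffunP => -[f|f]; rewrite !ffunE /= ?ffunE.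
have joinK : cancel join pr.
  by case=> M1 M2; congr pair; apply/ffunP => f; rewrite !ffunE.
rewrite (reindex join) /=; last by exists pr => M _; [exact: joinK|exact: prK].
pose ends (M : {ffun F1 -> 'I_n}) : {ffun E -> 'I_n} := [ffun p => M (leg D1 p)].
rewrite (partition_big (fun p => ends p.1) xpredT) //=; apply: eq_bigr => a _.
rewrite /tensor big_distrlr pair_big_dep /=; apply: eq_big => [[M1 M2]|[M1 M2] _] /=; last first.
  rewrite /Psi; congr (_ * _); congr diagram_form;
    by apply/funext => f; rewrite /= ffunE.
have bl1 p : base D1 (leg D1 p) = inr p by apply/eqP; rewrite legP.
have bl2 p : base D2 (leg D2 p) = inr p by apply/eqP; rewrite legP.
apply/andP/andP => [[/forallP h /eqP <-]|[/andP[/forallP m1 /forallP l1] /andP[/forallP m2 /forallP l2]]].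
  split; apply/andP; split; apply/forallP => f.
  - by have /andP[+ _] := h (inl f); rewrite !ffunE.
  - by rewrite ffunE.
  - by have /andP[+ _] := h (inr f); rewrite !ffunE.
  - by have /andP[_] := h (inr (leg D2 f)); rewrite !ffunE /= bl2 => /eqP ->.
split.
  apply/forallP => -[f|f]; rewrite !ffunE /=; apply/andP; split => //.
  - case bf: (base D1 f) => [v|p] //; have /eqP -> : f == leg D1 p by rewrite -legP bf.
    by rewrite (eqP (l1 p)) (eqP (l2 p)).
  - case bf: (base D2 f) => [v|p] //; have /eqP -> : f == leg D2 p by rewrite -legP bf.
    by rewrite (eqP (l1 p)) (eqP (l2 p)).
by apply/eqP/ffunP => p; rewrite ffunE; exact/eqP.
Qed.

(** Both sides sum over the labellings of the germs of [D1] and [D2] that are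
    constant along edges and across glued points. *)
Lemma glue_contraction (v : V) :
  (n ^ circles D1 D2)%:R * amplitude_coef ip e u A (glue D1 D2) v =
  \sum_(a : {ffun E -> 'I_n}) tensor ip e u A D1 a * tensor ip e u A D2 a.
Proof. by rewrite sum_glued_labels sum_matching_labels. Qed.

Lemma weight_glue : weight (glue D1 D2) = mulcm (weight D1) (weight D2).
Proof. by rewrite /weight big_sumType. Qed.

End Gluing.

(** * Isomorphism invariance *)

Section SameOrder.
Context (P : palette).

Lemma same_order_refl (T : eqType) (c : vcolour P) (s : seq T) : same_order c s s.
Proof. by case: c => //= *; exists 0%N; rewrite rot0. Qed.

Lemma same_order_map (T T' : eqType) (h : T -> T') (c : vcolour P) s s' :
  same_order c s s' -> same_order c (map h s) (map h s').
Proof.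
case: c => [m k a|k b|k g] /=; first by move=> ->.
  by case=> i ->; exists i; rewrite map_rot.
exact: perm_map.
Qed.

Lemma same_order_sym (T : eqType) (c : vcolour P) (s s' : seq T) :
  same_order c s s' -> same_order c s' s.
Proof.
case: c => [m k a|k b|k g] /=; first by move=> ->.
  by case=> i ->; exists (size (rot i s) - i)%N; rewrite -/(rotr i _) rotK.
by rewrite perm_sym.
Qed.

Lemma same_order_trans (T : eqType) (c : vcolour P) (s1 s2 s3 : seq T) :
  same_order c s1 s2 -> same_order c s2 s3 -> same_order c s1 s3.
Proof.
case: c => [m k a|k b|k g] /=; first by move=> -> ->.
  case=> i -> [j ->].
  have [si|] := leqP i (size s1); last by move=> /ltnW/rot_oversize ->; exists j.
  have [sj|] := leqP j (size s1); last first.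
    by move=> /ltnW js; rewrite [rot j _]rot_oversize ?size_rot //; exists i.
  by rewrite rot_add_mod //; eexists.
by move=> h1 h2; apply: perm_trans h2 h1.
Qed.

Lemma same_order_perm (T : eqType) (c : vcolour P) (s s' : seq T) :
  same_order c s s' -> perm_eq s' s.
Proof.
case: c => [m k a|k b|k g] //= => [->|[i ->]]; first exact: perm_refl.
by rewrite perm_rot.
Qed.

End SameOrder.

Section IsoInvariance.
Context (R : realType) (V : vectType R) (ip : {dot V for idfun}).
Context (n : nat) (e : n.-tuple V) (u : 'I_n -> V).
Context (P : palette) (A : feynman_algebra R n P).

(** The invariance of the cyclic and symmetric tensors enters here. *)
Lemma vertex_form_same_order (c : vcolour P) (us us' ws : seq (vecC R n)) :
  size us = nin c -> same_order c us us' ->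
  vertex_form ip e A c us' ws = vertex_form ip e A c us ws.
Proof.
case: c => [m k a|k b|k g] /=; first by move=> _ ->.
  move=> sz [i ->]; have [isz|/ltnW/rot_oversize -> //] := leqP i (size us).
  elim: i isz => [|i IHi] isz; first by rewrite rot0.
  rewrite (rotS isz) -IHi ?(ltnW isz) //.
  have sz' : size (rot i us) == k by rewrite size_rot sz.
  exact: (cyT_rot A b (Tuple sz')).
move=> sz pus; have sz1 : size us == k by rewrite sz.
have sz2 : size us' == k by rewrite (perm_size pus) sz.
have /tuple_permP[s ->] : perm_eq us' (Tuple sz1) by [].
exact: (syT_perm A g (Tuple sz1) s).
Qed.

Section Iso.
Context (V1 E1 F1 V2 E2 F2 : finType).
Context (D : diagram P V1 E1 F1) (D' : diagram P V2 E2 F2).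
Context (fv : V1 -> V2) (fe : E1 -> E2) (ff : F1 -> F2).
Hypothesis iso : is_iso D D' fv fe ff.

Lemma iso_leg p : ff (leg D p) = leg D' (fe p).
Proof.
apply/eqP; rewrite -legP (iso_base iso).
by have /eqP -> : base D (leg D p) == inr p by rewrite legP.
Qed.

Lemma diagram_form_iso (x : F2 -> vecC R n) :
  diagram_form ip e A D' x = diagram_form ip e A D (x \o ff).
Proof.
rewrite /diagram_form /star_form (reindex fv) /=; last exact/onW_bij/(iso_vert iso).
apply: eq_bigr => v _; rewrite (iso_colour iso) (iso_outs iso) -map_comp.
rewrite [in RHS]map_comp; apply: vertex_form_same_order.
  by rewrite !size_map size_ins.
exact/same_order_map/(iso_ins iso).
Qed.

Lemma tensor_iso (a : {ffun E2 -> 'I_n}) :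
  tensor ip e u A D' a = tensor ip e u A D [ffun p => a (fe p)].
Proof.
have [gf ffK gfK] := iso_flag iso.
have [ge feK geK] := iso_endp iso.
pose h (m : {ffun F1 -> 'I_n}) : {ffun F2 -> 'I_n} := [ffun f => m (gf f)].
rewrite /tensor (reindex h) /=; last first.
  exists (fun m : {ffun F2 -> 'I_n} => [ffun f => m (ff f)]) => m _.
    by apply/ffunP => f; rewrite !ffunE ffK.
  by apply/ffunP => f; rewrite !ffunE gfK.
apply: eq_big => m; last first.
  move=> _; rewrite diagram_form_iso; congr diagram_form.
  by apply/funext => f; rewrite /= ffunE ffK.
congr (_ && _); apply/forallP/forallP => hm f.
- by have := hm (ff f); rewrite -(iso_opp iso) !ffunE !ffK.
- by rewrite -{1}(gfK f) -(iso_opp iso) !ffunE !ffK.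
- by have := hm (fe f); rewrite !ffunE -iso_leg ffK.
- have := hm (ge f); rewrite !ffunE geK => /eqP <-.
  by rewrite -{1}(geK f) -iso_leg ffK.
Qed.

Lemma weight_iso : weight D' = weight D.
Proof.
rewrite /weight (reindex fv) /=; last exact/onW_bij/(iso_vert iso).
by apply: eq_bigr => v _; rewrite (iso_colour iso).
Qed.

End Iso.

End IsoInvariance.

Section IsoGroupoid.
Context (P : palette).

Lemma is_iso_comp (V1 E1 F1 V2 E2 F2 V3 E3 F3 : finType)
    (D1 : diagram P V1 E1 F1) (D2 : diagram P V2 E2 F2) (D3 : diagram P V3 E3 F3)
    fv fe ff gv ge gf :
  is_iso D1 D2 fv fe ff -> is_iso D2 D3 gv ge gf ->
  is_iso D1 D3 (gv \o fv) (ge \o fe) (gf \o ff).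
Proof.
move=> i1 i2; split.
- exact: bij_comp (iso_vert i2) (iso_vert i1).
- exact: bij_comp (iso_endp i2) (iso_endp i1).
- exact: bij_comp (iso_flag i2) (iso_flag i1).
- by move=> f /=; rewrite (iso_opp i1) (iso_opp i2).
- by move=> f /=; rewrite (iso_base i2) (iso_base i1); case: base.
- by move=> v /=; rewrite (iso_colour i2) (iso_colour i1).
- move=> v /=; rewrite map_comp.
  apply: same_order_trans (same_order_map gf (iso_ins i1 v)) _.
  by rewrite -(iso_colour i1); exact: (iso_ins i2).
- by move=> v /=; rewrite (iso_outs i2) (iso_outs i1) map_comp.
Qed.

Lemma is_iso_inv (V1 E1 F1 V2 E2 F2 : finType)
    (D1 : diagram P V1 E1 F1) (D2 : diagram P V2 E2 F2) fv fe ff gv ge gf :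
  cancel fv gv -> cancel gv fv -> cancel fe ge -> cancel ge fe ->
  cancel ff gf -> cancel gf ff ->
  is_iso D1 D2 fv fe ff -> is_iso D2 D1 gv ge gf.
Proof.
move=> vK vK' eK eK' fK fK' i; split.
- by exists fv.
- by exists fe.
- by exists ff.
- by move=> f; apply: (can_inj fK); rewrite (iso_opp i) !fK'.
- move=> f; have := iso_base i (gf f); rewrite fK'.
  by case: (base D1 (gf f)) => [v|p] ->; rewrite ?vK ?eK.
- by move=> v; rewrite -{2}(vK' v) (iso_colour i).
- move=> v; have := same_order_map gf (iso_ins i (gv v)).
  rewrite -map_comp (eq_map (g := id) fK) map_id vK' -(iso_colour i) vK'.
  exact: same_order_sym.
- move=> v; have := congr1 (map gf) (iso_outs i (gv v)).
  by rewrite -map_comp (eq_map (g := id) fK) map_id vK' => ->.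
Qed.

Lemma is_iso_id (V1 E1 F1 : finType) (D : diagram P V1 E1 F1) :
  is_iso D D id id id.
Proof.
split=> //; try (by exists id).
- by move=> f; case: base.
- by move=> v; rewrite map_id; exact: same_order_refl.
- by move=> v; rewrite map_id.
Qed.

End IsoGroupoid.

(** * Sums over isomorphism classes *)

Section GroupoidSum.
Context (T : choiceType) (iso : T -> T -> Prop).
Hypothesis isoxx : forall x, iso x x.
Hypothesis isoC : forall x y, iso x y -> iso y x.
Hypothesis isoT : forall x y z, iso x y -> iso y z -> iso x z.

(** The representative chosen by [iso_classes]. *)
Definition class_repr (x : T) : T := xget x [set y | iso x y].

Lemma iso_class_repr x : iso x (class_repr x).
Proof.
have xx : [set y | iso x y] x by exact: isoxx.
exact: (xgetPex x (ex_intro _ x xx)).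
Qed.

Lemma class_repr_eq x y : iso x y -> class_repr x = class_repr y.
Proof.
move=> xy; have -> : class_repr y = xget y [set z | iso x z].
  congr (xget y _); apply/seteqP; split=> z /=; first exact: isoT.
  by apply: isoT; exact: isoC.
rewrite /class_repr /xget; case: pselect => // -[]; exists x.
by apply/asboolP; exact: isoxx.
Qed.

(** The last hypothesis spreads the value at an object over the members of its
    class in the family [r], so that the sum over the family counts every class
    once. *)
Lemma groupoid_sum (L : nmodType) (S : set T) (f : T -> L)
    (Th : finType) (r : Th -> T) (g : Th -> L) :
  (forall x y, iso x y -> S x -> S y) ->
  (forall x y, iso x y -> f x = f y) ->
  (forall th, S (r th)) ->
  (forall x, S x -> f x <> 0 -> exists th, iso x (r th)) ->
  (forall th0, f (r th0) = \sum_(th | `[< iso (r th0) (r th) >]) g th) ->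
  \sum_(x \in iso_classes iso S) f x = \sum_th g th.
Proof.
move=> SI fI Sr cov fr.
pose rep th := class_repr (r th).
pose s := undup [seq rep th | th <- enum Th].
have ms th : rep th \in s by rewrite mem_undup map_f ?mem_enum.
rewrite -(fsbig_widen [set` s]) /=; first last.
- move=> x [[y Sy yx] /negP xs] /=; apply: contrapT => fx.
  have xy : iso x y by apply: isoC; rewrite -yx; exact: iso_class_repr.
  have fy : f y <> 0 by rewrite -(fI _ _ xy).
  have [th yth] := cov y Sy fy.
  by case/negP: xs; rewrite -yx [xget _ _](class_repr_eq yth); exact: ms.
- move=> x; rewrite /= mem_undup => /mapP[th _ ->]; exists (r th) => //.
rewrite -fsbig_seq ?undup_uniq //.
rewrite (eq_big_seq (fun x => \sum_(th | rep th == x) g th)).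
  rewrite (exchange_big_dep xpredT) //=; apply: eq_bigr => th _.
  rewrite -big_filter (_ : [seq i <- s | rep th == i] = [:: rep th]) ?big_seq1 //.
  rewrite (eq_filter (a2 := pred1 (rep th))) => [|x]; last by rewrite /= eq_sym.
  by rewrite filter_pred1_uniq ?undup_uniq ?ms.
move=> x; rewrite mem_undup => /mapP[th0 _ ->].
rewrite -(fI _ _ (iso_class_repr (r th0))) fr; apply: eq_bigl => th.
apply/asboolP/eqP => [h|h]; first by rewrite /rep (class_repr_eq h).
by apply: isoT (iso_class_repr _) _; rewrite -/(rep th0) -h; apply: isoC; exact: iso_class_repr.
Qed.

End GroupoidSum.

(** * Enumeration of the complements *)

Section ExtensionGroupoid.
Context (P : palette) (V E F : finType) (G : diagram P V E F).

Lemma ext_iso_refl (B : extension P E) : ext_iso G B B.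
Proof. by exists id, id, id, id, id; split; exact: is_iso_id. Qed.

Lemma ext_iso_sym (B B' : extension P E) : ext_iso G B B' -> ext_iso G B' B.
Proof.
move=> [gv [gf [fe [hv [hf [i1 i2]]]]]].
have [gv' K1 K1'] := iso_vert i1; have [gf' K2 K2'] := iso_flag i1.
have [fe' K3 K3'] := iso_endp i1; have [hv' K4 K4'] := iso_vert i2.
have [hf' K5 K5'] := iso_flag i2.
exists gv', gf', fe', hv', hf'; split.
  exact: (is_iso_inv K1 K1' K3 K3' K2 K2' i1).
exact: (is_iso_inv K4 K4' K3 K3' K5 K5' i2).
Qed.

Lemma ext_iso_trans (B1 B2 B3 : extension P E) :
  ext_iso G B1 B2 -> ext_iso G B2 B3 -> ext_iso G B1 B3.
Proof.
move=> [gv [gf [fe [hv [hf [i1 i2]]]]]] [gv' [gf' [fe' [hv' [hf' [i1' i2']]]]]].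
exists (gv' \o gv), (gf' \o gf), (fe' \o fe), (hv' \o hv), (hf' \o hf).
by split; [exact: is_iso_comp i1 i1'|exact: is_iso_comp i2 i2'].
Qed.

Lemma ext_iso_nvert (B B' : extension P E) : ext_iso G B B' -> nvert B = nvert B'.
Proof.
move=> [gv [gf [fe [hv [hf [_ i]]]]]].
by have := bij_eq_card (iso_vert i); rewrite !card_ord.
Qed.

End ExtensionGroupoid.

Section Symmetry.
Context (P : palette).

(** The order of the automorphism group of a single vertex with its legs. *)
Definition symfactor (c : vcolour P) : nat :=
  match c with Coupon _ _ _ => 1 | Cyclic k _ => k | Symmetric k _ => k`! end.

Lemma ordinary_cyclic_gt0 k (b : Cy P k) : ordinary (Cyclic k b) -> (0 < k)%N.
Proof.
case: b => // b _; case: k b => // b.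
by have := card0_eq (oCy0 P) b; rewrite inE.
Qed.

(** The entry at the head determines a rotation. *)
Lemma rot_uniq_inj (T : eqType) (s : seq T) i j : uniq s ->
  (i < size s)%N -> (j < size s)%N -> rot i s = rot j s -> i = j.
Proof.
case: s => // x s us si sj ij; set t := x :: s in us si sj ij.
have E l : (l < size t)%N -> nth x (rot l t) 0 = nth x t l.
  by move=> lt; rewrite /rot nth_cat size_drop subn_gt0 lt nth_drop addn0.
by apply/eqP; rewrite -(nth_uniq x si sj us) -!E // ij.
Qed.

(** The symmetries of a vertex act freely and transitively on the lists that
    present it. *)
Lemma card_same_order (T : finType) (N : nat) (c : vcolour P) (s : seq T) :
  ordinary c -> uniq s -> size s = nin c -> (size s <= N)%N ->
  #|[pred s' : {bseq N of T} | `[< same_order c s s' >]]| = symfactor c.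
Proof.
move=> oc us sc sN.
case: c oc sc => [m k a|k b|k g] oc sc /=.
- rewrite (eq_card (B := pred1 (Bseq sN))) ?card1 // => s'; rewrite !inE.
  by apply/asboolP/eqP => [h|->//]; apply: val_inj.
- have rN i : (size (rot i s) <= N)%N by rewrite size_rot.
  pose h (i : 'I_k) : {bseq N of T} := Bseq (rN i).
  have k0 := ordinary_cyclic_gt0 oc.
  rewrite -[RHS]card_ord -(card_imset predT (f := h)); last first.
    move=> i j /(congr1 val) /= ij; apply: val_inj => /=.
    by apply: (rot_uniq_inj us _ _ ij); rewrite sc.
  apply: eq_card => s'; rewrite !inE; apply/asboolP/imsetP => [[i s'E]|[i _ ->]]; last by exists i.
  have [ik|ki] := ltnP i k.
    by exists (Ordinal ik) => //; apply: val_inj.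
  exists (Ordinal k0) => //; apply: val_inj => /=.
  by rewrite s'E rot_oversize ?rot0 // sc.
- have <- : size s = k by exact: sc.
  rewrite -(size_permutations us) cardE -(size_map val).
  apply/perm_size/uniq_perm.
  + by rewrite map_inj_uniq ?enum_uniq //; exact: val_inj.
  + exact: permutations_uniq.
  move=> t; rewrite mem_permutations; apply/mapP/idP => [[s' + ->]|ts].
    by rewrite mem_enum => h; exact: (asboolW h).
  have tN : (size t <= N)%N by rewrite (perm_size ts).
  by exists (Bseq tN) => //; rewrite mem_enum; exact: (asboolT ts).
Qed.

End Symmetry.

(** A code lists the data of a diagram with internal vertices ['I_k], germs
    ['I_nf] and colours in a finite family [col]; the part of it that does not
    involve the edges is a skeleton. *)
Section Codes.
Context (P : palette) (E W : finType) (col : W -> vcolour P) (k nf : nat).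
Hypothesis col_inj : injective col.
Hypothesis col_ord : forall w, ordinary (col w).

Local Notation slots := {bseq nf of 'I_nf}.

Definition skeleton : finType :=
  ({ffun 'I_nf -> 'I_k + E} * {ffun E -> 'I_nf} *
   ({ffun 'I_k -> slots} * {ffun 'I_k -> slots}))%type.

Definition sk_base (s : skeleton) := s.1.1.
Definition sk_leg (s : skeleton) := s.1.2.
Definition sk_ins (s : skeleton) := s.2.1.
Definition sk_outs (s : skeleton) := s.2.2.

Definition skeleton_ok (c : {ffun 'I_k -> W}) (s : skeleton) : bool :=
  [&& [forall p, forall f, (sk_base s f == inr p) == (f == sk_leg s p)],
      [forall v, uniq (sk_ins s v ++ sk_outs s v)],
      [forall v, forall f, (f \in sk_ins s v ++ sk_outs s v) == (sk_base s f == inl v)],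
      [forall v, size (sk_ins s v) == nin (col (c v))] &
      [forall v, size (sk_outs s v) == nout (col (c v))]].

Lemma skeleton_okP (c : {ffun 'I_k -> W}) s : reflect
  [/\ forall p f, (sk_base s f == inr p) = (f == sk_leg s p),
      forall v, uniq (sk_ins s v ++ sk_outs s v),
      forall v f, (f \in sk_ins s v ++ sk_outs s v) = (sk_base s f == inl v),
      forall v, size (sk_ins s v) = nin (col (c v)) &
      forall v, size (sk_outs s v) = nout (col (c v))] (skeleton_ok c s).
Proof.
apply: (iffP and5P) => -[h1 h2 h3 h4 h5]; split.
- by move=> p f; have /forallP/(_ p)/forallP/(_ f)/eqP := h1.
- exact/forallP.
- by move=> v f; have /forallP/(_ v)/forallP/(_ f)/eqP := h3.
- by move=> v; have /forallP/(_ v)/eqP := h4.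
- by move=> v; have /forallP/(_ v)/eqP := h5.
- by apply/forallP => p; apply/forallP => f; rewrite h1.
- exact/forallP.
- by apply/forallP => v; apply/forallP => f; rewrite h3.
- by apply/forallP => v; rewrite h4.
- by apply/forallP => v; rewrite h5.
Qed.

Definition raw_code : finType :=
  ({ffun 'I_k -> W} * skeleton * {ffun 'I_nf -> 'I_nf})%type.

Definition code_ok (x : raw_code) : bool :=
  skeleton_ok x.1.1 x.1.2 && pairing_on [set: 'I_nf]%SET x.2.

Definition code : finType := {x : raw_code | code_ok x}.

Lemma pairing_onT (T : finType) (o : {ffun T -> T}) :
  reflect (involutive o /\ forall f, o f != f) (pairing_on [set: T]%SET o).
Proof.
apply: (iffP forallP) => [h|[h1 h2] f]; last by rewrite !inE h1 h2 eqxx.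
by split=> f; have := h f; rewrite !inE /= => /andP[/eqP].
Qed.

Section Decode.
Variable x : code.

Definition c_col := (val x).1.1.
Definition c_skel := (val x).1.2.
Definition c_opp := (val x).2.

Let ok : skeleton_ok c_col c_skel. Proof. by have /andP[] := valP x. Qed.

Let oppP := elimT (pairing_onT _) (elimT andP (valP x)).2.

Let legP p f := let: And5 h _ _ _ _ := elimT (skeleton_okP _ _) ok in h p f.
Let star_uniq v := let: And5 _ h _ _ _ := elimT (skeleton_okP _ _) ok in h v.
Let starP v f := let: And5 _ _ h _ _ := elimT (skeleton_okP _ _) ok in h v f.
Let size_ins v := let: And5 _ _ _ h _ := elimT (skeleton_okP _ _) ok in h v.
Let size_outs v := let: And5 _ _ _ _ h := elimT (skeleton_okP _ _) ok in h v.

Definition decode : diagram P 'I_k E 'I_nf :=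
  @Diagram P _ _ _ c_opp (sk_base c_skel) (sk_leg c_skel) (fun v => col (c_col v))
    (fun v => sk_ins c_skel v) (fun v => sk_outs c_skel v)
    oppP.1 oppP.2 legP star_uniq starP size_ins size_outs.

End Decode.

Definition code_ext (x : code) : extension P E :=
  Extension (rest := decode x) (fun v => col_ord (c_col x v)).

Lemma size_star_le (D : diagram P 'I_k E 'I_nf) v :
  (size (ins D v) <= nf)%N /\ (size (outs D v) <= nf)%N.
Proof.
have := star_uniq D v; rewrite cat_uniq => /and3P[u1 _ u2].
move/card_uniqP: u1 => <-; move/card_uniqP: u2 => <-.
by split; rewrite -[X in (_ <= X)%N]card_ord max_card.
Qed.

Lemma encode (D : diagram P 'I_k E 'I_nf) (c : {ffun 'I_k -> W}) :
  (forall v, colour D v = col (c v)) ->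
  exists2 x : code, c_col x = c & is_iso D (decode x) id id id.
Proof.
move=> Dc.
pose b1 v : slots := Bseq (size_star_le D v).1.
pose b2 v : slots := Bseq (size_star_le D v).2.
pose s : skeleton := ([ffun f => base D f], [ffun p => leg D p],
  ([ffun v => b1 v], [ffun v => b2 v])).
pose x : raw_code := (c, s, [ffun f => opp D f]).
have ok : code_ok x.
  apply/andP; split; last first.
    by apply/pairing_onT; split=> f; rewrite !ffunE ?oppK ?opp_neq.
  apply/skeleton_okP; split.
  - by move=> p f; rewrite /sk_base /sk_leg !ffunE legP.
  - by move=> v; rewrite /sk_ins /sk_outs !ffunE star_uniq.
  - by move=> v f; rewrite /sk_ins /sk_outs /sk_base !ffunE starP.
  - by move=> v; rewrite /sk_ins !ffunE -Dc size_ins.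
  - by move=> v; rewrite /sk_outs !ffunE -Dc size_outs.
exists (Sub x ok) => //; split=> //; try by exists id.
- by move=> f /=; rewrite /c_opp /= ffunE.
- by move=> f /=; rewrite /sk_base /c_skel /= ffunE; case: base.
- by move=> v; rewrite map_id /= /sk_ins /c_skel /= ffunE; exact: same_order_refl.
- by move=> v; rewrite map_id /= /sk_outs /c_skel /= ffunE.
Qed.

Definition code_sym (c : {ffun 'I_k -> W}) : nat := \prod_v symfactor (col (c v)).

(** A bijection of the underlying sets transports all of the structure except
    for the presentations of the cyclic and symmetric vertices, which may be
    chosen freely. *)
Lemma card_iso_targets (x : code) (hv : {perm 'I_k}) (fe : {perm E}) (hf : {perm 'I_nf}) :
  #|[pred x' : code | `[< is_iso (decode x) (decode x') hv fe hf >]]| =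
  code_sym (c_col x).
Proof.
pose hv' v := (hv^-1)%g v; pose hf' f := (hf^-1)%g f; pose fe' p := (fe^-1)%g p.
have hvK : cancel hv hv' := permK hv; have hvK' : cancel hv' hv := permKV hv.
have hfK : cancel hf hf' := permK hf; have hfK' : cancel hf' hf := permKV hf.
have feK : cancel fe fe' := permK fe; have feK' : cancel fe' fe := permKV fe.
pose lists v := map hf (sk_ins (c_skel x) (hv' v)).
pose Fam v : pred slots := [pred s' : slots | `[< same_order (col (c_col x (hv' v))) (lists v) s' >]].
pose insof (x' : code) := sk_ins (c_skel x').
have ux v : uniq (sk_ins (c_skel x) v ++ sk_outs (c_skel x) v) := star_uniq (decode x) v.
have cFam : #|family Fam| = code_sym (c_col x).
  rewrite card_family foldrE big_image /= /code_sym (reindex_inj (@perm_inj _ hv)) /=.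
  apply: eq_bigr => v _; rewrite /Fam /lists hvK.
  apply: card_same_order => //.
  - rewrite map_inj_uniq; last exact: perm_inj.
    by have := ux v; rewrite cat_uniq => /and3P[].
  - by rewrite size_map; exact: (size_ins (decode x) v).
  - by rewrite size_map; exact: (size_star_le (decode x) v).1.
rewrite -cFam -(card_in_imset (f := insof)).
  apply: eq_card => t; apply/imsetP/familyP => [[x' /asboolP i ->] v|tF].
    by apply/asboolP; have := iso_ins i (hv' v); rewrite hvK'.
  pose b' f := match sk_base (c_skel x) (hf' f) with
               | inl v => inl (hv v) | inr p => inr (fe p) end : 'I_k + E.
  have szo v : (size (map hf (sk_outs (c_skel x) (hv' v))) <= nf)%N.
    by rewrite size_map; exact: (size_star_le (decode x) (hv' v)).2.
  pose s' : skeleton := ([ffun f => b' f], [ffun p => hf (sk_leg (c_skel x) (fe' p))],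
    (t, [ffun v => (Bseq (szo v) : slots)])).
  pose raw : raw_code := ([ffun v => c_col x (hv' v)], s',
    [ffun f => hf (c_opp x (hf' f))]).
  have tP v : same_order (col (c_col x (hv' v))) (lists v) (t v) by exact/asboolP/tF.
  have tperm v : perm_eq (t v) (lists v) := same_order_perm (tP v).
  have ok : code_ok raw.
    apply/andP; split; last first.
      apply/pairing_onT; split=> f; rewrite !ffunE.
        by rewrite hfK; have /= -> := oppK (decode x) (hf' f); rewrite hfK'.
      apply/eqP => /(congr1 hf'); rewrite hfK => h.
      by have /= := opp_neq (decode x) (hf' f); rewrite h eqxx.
    apply/skeleton_okP; split.
    - move=> p f; rewrite /sk_base /sk_leg !ffunE /b' /=.
      have := legP (decode x) (fe' p) (hf' f); rewrite /= => hl.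
      rewrite -(inj_eq (can_inj hfK')) hfK -hl.
      case: (sk_base _ _) => // q; rewrite -[p in LHS]feK'.
      by rewrite !(inj_eq (@inr_inj _ _)) (inj_eq (can_inj feK)).
    - move=> v; rewrite /sk_ins /sk_outs /= ffunE.
      rewrite (perm_uniq (perm_cat (tperm v) (perm_refl _))) /= -map_cat.
      by rewrite map_inj_uniq //; exact: perm_inj.
    - move=> v f; rewrite /sk_ins /sk_outs /sk_base /= !ffunE.
      rewrite (perm_mem (perm_cat (tperm v) (perm_refl _))) /= -map_cat.
      rewrite -{1}(hfK' f) mem_map; last exact: perm_inj.
      rewrite (starP (decode x) (hv' v) (hf' f)) /= /b'.
      case: (sk_base _ _) => // w; rewrite -[v in RHS]hvK'.
      by rewrite !(inj_eq (@inl_inj _ _)) (inj_eq (can_inj hvK)).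
    - move=> v; rewrite /sk_ins /= (perm_size (tperm v)) size_map ffunE.
      exact: (size_ins (decode x) (hv' v)).
    - move=> v; rewrite /sk_outs /= !ffunE /= size_map.
      exact: (size_outs (decode x) (hv' v)).
  exists (Sub raw ok) => //; apply/asboolP; split.
  - by exists hv'.
  - by exists fe'.
  - by exists hf'.
  - by move=> f; rewrite /= /c_opp /= ffunE hfK.
  - by move=> f; rewrite /= /sk_base /c_skel /= ffunE /b' hfK.
  - by move=> v; rewrite /= /c_col /= ffunE hvK.
  - by move=> v; have := tP (hv v); rewrite /lists hvK.
  - by move=> v; rewrite /= /sk_outs /c_skel /= ffunE /= hvK.
move=> x1 x2 /asboolP i1 /asboolP i2 e12; apply: val_inj.
have Hc : c_col x1 = c_col x2.
  apply/ffunP => v; apply: col_inj.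
  by have := iso_colour i1 (hv' v); have := iso_colour i2 (hv' v); rewrite /= !hvK' => -> ->.
have Ho : c_opp x1 = c_opp x2.
  apply/ffunP => f.
  by have := iso_opp i1 (hf' f); have := iso_opp i2 (hf' f); rewrite /= !hfK' => <- <-.
have Hb : sk_base (c_skel x1) = sk_base (c_skel x2).
  apply/ffunP => f.
  by have := iso_base i1 (hf' f); have := iso_base i2 (hf' f); rewrite /= !hfK' => -> ->.
have Hl : sk_leg (c_skel x1) = sk_leg (c_skel x2).
  apply/ffunP => p.
  by have := iso_leg i1 (fe' p); have := iso_leg i2 (fe' p); rewrite /= !feK' => <- <-.
have Hout : sk_outs (c_skel x1) = sk_outs (c_skel x2).
  apply/ffunP => v; apply: val_inj.
  by have := iso_outs i1 (hv' v); have := iso_outs i2 (hv' v); rewrite /= !hvK' => -> ->.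
move: Hc Ho Hb Hl Hout e12; rewrite /insof /c_col /c_opp /c_skel.
case: x1 {i1} => -[[c1 [[b1 l1] [n1 o1]]] p1] ok1.
case: x2 {i2} => -[[c2 [[b2 l2] [n2 o2]]] p2] ok2.
by rewrite /sk_base /sk_leg /sk_ins /sk_outs /= => -> -> -> -> -> ->.
Qed.

End Codes.

Section ClassCount.
Context (P : palette) (V E F : finType) (G : diagram P V E F).
Context (W : finType) (col : W -> vcolour P) (k nf : nat).
Hypothesis col_inj : injective col.
Hypothesis col_ord : forall w, ordinary (col w).

Local Notation code := (code E col k nf).
Local Notation code_ext := (code_ext (E := E) (k := k) (nf := nf) col_ord).
Local Notation perms := ({perm V} * {perm F} * {perm E} * {perm 'I_k} * {perm 'I_nf})%type.

Definition ext_isos (x x' : code) : nat :=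
  #|[pred s : perms | `[< is_ext_iso G (A := code_ext x) (B := code_ext x')
      s.1.1.1.1 s.1.1.1.2 s.1.1.2 s.1.2 s.2 >]]|.

(** The isomorphisms to an isomorphic object form a torsor under the
    automorphisms. *)
Lemma ext_isosE x x' : ext_isos x x' =
  (if `[< ext_iso G (code_ext x) (code_ext x') >]
   then ext_aut_order G (code_ext x) else 0)%N.
Proof.
case: asboolP => [[gv [gf [fe [hv [hf [i1 i2]]]]]]|no]; last first.
  apply/eqP; rewrite -leqn0 leqNgt; apply/negP => /card_gt0P[s].
  move=> /asboolP h; apply: no.
  by exists s.1.1.1.1, s.1.1.1.2, s.1.1.2, s.1.2, s.2; exact: h.
pose gv' := perm (bij_inj (iso_vert i1)); pose gf' := perm (bij_inj (iso_flag i1)).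
pose fe' := perm (bij_inj (iso_endp i1)); pose hv' := perm (bij_inj (iso_vert i2)).
pose hf' := perm (bij_inj (iso_flag i2)).
have Egv : gv' = gv :> (_ -> _) by apply/funext => z; rewrite permE.
have Egf : gf' = gf :> (_ -> _) by apply/funext => z; rewrite permE.
have Efe : fe' = fe :> (_ -> _) by apply/funext => z; rewrite permE.
have Ehv : hv' = hv :> (_ -> _) by apply/funext => z; rewrite permE.
have Ehf : hf' = hf :> (_ -> _) by apply/funext => z; rewrite permE.
have k1 : is_iso G G gv' fe' gf' by rewrite Egv Efe Egf.
have k2 : is_iso (decode x) (decode x') hv' fe' hf' by rewrite Ehv Efe Ehf.
have [j1 j2] : is_iso G G (gv'^-1)%g (fe'^-1)%g (gf'^-1)%g /\
    is_iso (decode x') (decode x) (hv'^-1)%g (fe'^-1)%g (hf'^-1)%g.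
  split.
    exact: is_iso_inv (permK _) (permKV _) (permK _) (permKV _) (permK _) (permKV _) k1.
  exact: is_iso_inv (permK _) (permKV _) (permK _) (permKV _) (permK _) (permKV _) k2.
pose h (s : perms) : perms :=
  (s.1.1.1.1 * gv', s.1.1.1.2 * gf', s.1.1.2 * fe', s.1.2 * hv', s.2 * hf')%g.
have h_inj : injective h.
  move=> [[[[a b] c] d] f] [[[[a' b'] c'] d'] f'].
  by rewrite /h /= => -[] /mulIg -> /mulIg -> /mulIg -> /mulIg -> /mulIg ->.
have permME (T : finType) (p q : {perm T}) : (p * q)%g = q \o p :> (T -> T).
  by apply/funext => z; rewrite permM.
rewrite /ext_isos /ext_aut_order -[RHS](card_imset _ h_inj).
apply: eq_card => s; apply/idP/imsetP => [/asboolP[l1 l2]|[t /asboolP[l1 l2] ->]]; last first.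
  apply/asboolP; split; rewrite /h /= !permME.
    exact: is_iso_comp l1 k1.
  exact: is_iso_comp l2 k2.
exists (s.1.1.1.1 * gv'^-1, s.1.1.1.2 * gf'^-1, s.1.1.2 * fe'^-1, s.1.2 * hv'^-1,
    s.2 * hf'^-1)%g; last first.
  by rewrite /h /= !mulgKV -!surjective_pairing.
apply/asboolP; split; rewrite /= !permME.
  exact: is_iso_comp l1 j1.
exact: is_iso_comp l2 j2.
Qed.

Lemma sum_ext_isos x :
  (\sum_x' ext_isos x x' = aut_order G * k`! * nf`! * code_sym col (c_col x))%N.
Proof.
pose Q (s : perms) := `[< is_iso G G s.1.1.1.1 s.1.1.2 s.1.1.1.2 >].
transitivity (\sum_(s : perms | Q s) code_sym col (c_col x))%N.
  under eq_bigr do rewrite /ext_isos -sum1_card.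
  rewrite (exchange_big_dep Q) /=; last first.
    by move=> x' s _ /asboolP[i _]; apply/asboolP; exact: i.
  apply: eq_bigr => s /asboolP Qs.
  rewrite -(card_iso_targets col_inj col_ord x s.1.2 s.1.1.2 s.2) -sum1_card.
  by apply: eq_bigl => x'; apply/asboolP/asboolP => [[]//|h]; split.
rewrite sum_nat_const; congr (_ * _)%N.
pose aG := [pred s : {perm V} * {perm E} * {perm F} | `[< is_iso G G s.1.1 s.1.2 s.2 >]].
have cQ : #|Q| = #|predX (predX aG (mem [set: {perm 'I_k}]%SET)) (mem [set: {perm 'I_nf}]%SET)|.
  pose g (s : {perm V} * {perm E} * {perm F} * {perm 'I_k} * {perm 'I_nf}) : perms :=
    (s.1.1.1.1, s.1.1.2, s.1.1.1.2, s.1.2, s.2).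
  have g_inj : injective g.
    by move=> [[[[a b] c] d] f] [[[[a' b'] c'] d'] f']; rewrite /g /= => -[] -> -> -> -> ->.
  rewrite -[RHS](card_imset _ g_inj); apply: eq_card => s.
  apply/idP/imsetP => [Qs|[t]].
    exists (s.1.1.1.1, s.1.1.2, s.1.1.1.2, s.1.2, s.2); last first.
      by rewrite /g /= -!surjective_pairing.
    by rewrite /predX !inE /= ?andbT; exact: Qs.
  by move=> + ->; rewrite /predX !inE /= ?andbT => h; exact: (asboolW h).
transitivity (#|predX (mem aG) (mem [set: {perm 'I_k}]%SET)| * #|{perm 'I_nf}|)%N.
  by rewrite cQ cardX cardsT; congr (_ * _)%N; apply: eq_card.
by rewrite cardX cardsT !card_Sn.
Qed.

(** Counting the isomorphisms that start from [x] in two ways: by their targets,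
    and by the underlying bijections. *)
Lemma ext_class_count x :
  (ext_aut_order G (code_ext x) *
   #|[pred x' | `[< ext_iso G (code_ext x) (code_ext x') >]]| =
   aut_order G * k`! * nf`! * code_sym col (c_col x))%N.
Proof.
rewrite -sum_ext_isos; under eq_bigr do rewrite ext_isosE.
by rewrite -big_mkcond /= sum_nat_const mulnC.
Qed.

End ClassCount.

Section SkeletonCount.
Context (P : palette) (E W : finType) (col : W -> vcolour P) (k nf : nat).
Variable c : {ffun 'I_k -> W}.

Definition valence (c : vcolour P) : nat := (nin c + nout c)%N.

Local Notation N v := (valence (col (c v))).

Definition slot_type : finType := (E + {v : 'I_k & 'I_(N v)})%type.

Hypothesis nfE : (#|E| + \sum_v N v)%N = nf.

Lemma card_slot_type : #|slot_type| = nf.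
Proof.
rewrite card_sum card_tagged -nfE; congr (_ + _)%N.
rewrite sumnE big_map big_enum /=; apply: eq_bigr => v _; exact: card_ord.
Qed.

Let dflt (q : slot_type) : 'I_nf := cast_ord card_slot_type (enum_rank q).

Let star (s : skeleton E k nf) v : seq 'I_nf := sk_ins s v ++ sk_outs s v.

Definition slot_flag (s : skeleton E k nf) : {ffun slot_type -> 'I_nf} :=
  [ffun q => match q with
             | inl p => sk_leg s p
             | inr (existT v j) => nth (dflt q) (star s v) j end].

(** Listing the germs at the endpoints and in the slots of all vertices
    identifies the incidences with the bijections from slots to germs. *)
Lemma card_skeletons :
  #|[pred s : skeleton E k nf | skeleton_ok col c s]| = nf`!.
Proof.
have sz s v : skeleton_ok col c s -> size (star s v) = N v.
  by move=> /skeleton_okP[_ _ _ h4 h5]; rewrite size_cat h4 h5.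
pose q v (j : 'I_(N v)) : slot_type := inr (Tagged (fun v => 'I_(N v)) j).
have starE s v (j : 'I_(N v)) : slot_flag s (q v j) = nth (dflt (q v j)) (star s v) j.
  by rewrite ffunE.
have in_star s v (j : 'I_(N v)) : skeleton_ok col c s -> slot_flag s (q v j) \in star s v.
  by move=> ok; rewrite starE mem_nth // sz.
rewrite -(card_in_imset (f := slot_flag)); last first.
  move=> s s' ok ok' /ffunP ss.
  have Hl : sk_leg s = sk_leg s'.
    by apply/ffunP => p; have := ss (inl p); rewrite !ffunE.
  have Hs v : star s v = star s' v.
    have [N0|Npos] := posnP (N v).
      by rewrite (size0nil (etrans (sz s v ok) N0)) (size0nil (etrans (sz s' v ok') N0)).
    apply: (@eq_from_nth _ (dflt (q v (Ordinal Npos)))); rewrite !sz // => i iN.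
    have := ss (q v (Ordinal iN)); rewrite !starE /=.
    by rewrite !(set_nth_default (dflt (q v (Ordinal Npos))) (dflt (q v (Ordinal iN)))) ?sz.
  have /skeleton_okP[l1 _ b1 i1 _] := ok; have /skeleton_okP[l2 _ b2 i2 _] := ok'.
  have Hi : sk_ins s = sk_ins s'.
    apply/ffunP => v; apply: val_inj => /=.
    by rewrite -(take_size_cat (sk_outs s v) (i1 v)) -(take_size_cat (sk_outs s' v) (i2 v)) -![_ ++ _]/(star _ v) Hs.
  have Ho : sk_outs s = sk_outs s'.
    apply/ffunP => v; apply: val_inj => /=.
    by rewrite -(drop_size_cat (sk_outs s v) (i1 v)) -(drop_size_cat (sk_outs s' v) (i2 v)) -![_ ++ _]/(star _ v) Hs.
  have Hb : sk_base s = sk_base s'.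
    apply/ffunP => f; case bf: (sk_base s f) => [v|p]; apply/esym/eqP.
      by rewrite -b2 -/(star s' v) -Hs /star b1 bf.
    by rewrite l2 -Hl -l1 bf.
  move: Hl Hi Ho Hb; case: s {ok ss Hs l1 b1 i1} => -[b l] [i o].
  case: s' {ok' l2 b2 i2} => -[b' l'] [i' o'].
  by rewrite /sk_base /sk_leg /sk_ins /sk_outs /= => -> -> -> ->.
have -> : nf`! = #|[set f : {ffun slot_type -> 'I_nf} | injectiveb f]%SET|.
  by rewrite card_inj_ffuns card_slot_type card_ord ffactnn.
apply: eq_card => phi; rewrite [RHS]inE; apply/imsetP/injectiveP => [[s ok ->]|phi_inj].
  have /skeleton_okP[l1 u1 b1 _ _] := ok.
  have lb p : sk_base s (sk_leg s p) = inr p by apply/eqP; rewrite l1.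
  have inb v (j : 'I_(N v)) : sk_base s (slot_flag s (q v j)) = inl v.
    by apply/eqP; rewrite -b1; exact: in_star.
  move=> [p|[v j]] [p'|[v' j']] pp.
  - by congr inl; have := congr1 (sk_base s) pp; rewrite !ffunE !lb => -[].
  - by have := congr1 (sk_base s) pp; rewrite (inb v' j') ffunE lb.
  - by have := congr1 (sk_base s) pp; rewrite (inb v j) ffunE lb.
  have vv : v = v' by have := congr1 (sk_base s) pp; rewrite (inb v j) (inb v' j') => -[].
  move: pp; case: v' / vv j' => j'; rewrite (starE s v j) (starE s v j').
  rewrite (set_nth_default (dflt (q v j)) (dflt (q v j'))) ?sz // => /eqP.
  have us : uniq (star s v) := u1 v.
  by rewrite nth_uniq ?sz // => /eqP/val_inj ->.
have [psi phiK psiK] : bijective phi.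
  by apply: inj_card_bij phi_inj _; rewrite card_slot_type card_ord.
pose lst v := [seq phi (q v j) | j <- enum 'I_(N v)].
have lst_sz v : size (lst v) = N v by rewrite size_map size_enum_ord.
have lst_u v : uniq (lst v).
  rewrite map_inj_uniq ?enum_uniq // => j j' /phi_inj qq.
  by have := congr1 (fun x => if x is inr t then tagged_as (Tagged (fun v => 'I_(N v)) j) t else j) qq; rewrite /q /= !tagged_asE.
have lst_le v : (N v <= nf)%N.
  by rewrite -lst_sz -(card_uniqP (lst_u v)) -[X in (_ <= X)%N]card_ord max_card.
have ti v : (size (take (nin (col (c v))) (lst v)) <= nf)%N.
  by rewrite size_take_min lst_sz (leq_trans (geq_minr _ _)).
have dr v : (size (drop (nin (col (c v))) (lst v)) <= nf)%N.
  by rewrite size_drop lst_sz (leq_trans (leq_subr _ _)).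
pose s : skeleton E k nf :=
  ([ffun f => match psi f with inl p => inr p | inr (existT v _) => inl v end],
   [ffun p => phi (inl p)],
   ([ffun v => (Bseq (ti v) : {bseq nf of 'I_nf})], [ffun v => (Bseq (dr v) : {bseq nf of 'I_nf})])).
have sE v : star s v = lst v by rewrite /star /sk_ins /sk_outs /= !ffunE /= cat_take_drop.
exists s; last first.
  apply/ffunP => -[p|[v j]]; first by rewrite /slot_flag /sk_leg !ffunE.
  rewrite (starE s v j) sE (nth_map j) ?size_enum_ord // nth_ord_enum //.
apply/skeleton_okP; split.
- move=> p f; rewrite /sk_base /sk_leg /= !ffunE -(can_eq psiK) phiK.
  by case: (psi f) => // -[].
- by move=> v; rewrite -/(star s v) sE.
- move=> v f; rewrite -/(star s v) sE /sk_base /= ffunE -{1}(psiK f).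
  rewrite (_ : lst v = map phi (map (q v) (enum 'I_(N v)))); last by rewrite -map_comp.
  rewrite mem_map //.
  case: (psi f) => [p|[v' j]]; first by apply/mapP => -[].
  apply/mapP/eqP => [[j' _ qq]|[vv]].
    by congr inl; exact: (congr1 (fun x : slot_type => if x is inr t then tag t else v') qq).
  by move: j; rewrite vv => j; exists j; rewrite ?mem_enum.
- by move=> v; rewrite /sk_ins /= ffunE /= size_takel // lst_sz leq_addr.
- by move=> v; rewrite /sk_outs /= ffunE /= size_drop lst_sz addKn.
Qed.

End SkeletonCount.

(** * The exponential of the potential *)

Lemma fsbig_inj (T : choiceType) (K : nmodType) (I : finType) (Q : pred I)
    (S : set T) (h : I -> T) (F : T -> K) :
  {in Q &, injective h} -> (forall i, Q i -> S (h i)) ->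
  (forall x, S x -> (forall i, Q i -> x <> h i) -> F x = 0) ->
  \sum_(x \in S) F x = \sum_(i | Q i) F (h i).
Proof.
move=> h_inj hS F0; pose r := [seq h i | i <- enum Q].
have ur : uniq r.
  rewrite map_inj_in_uniq ?enum_uniq // => i j; rewrite !mem_enum.
  exact: h_inj.
rewrite -(fsbig_widen [set` r]) /=; first last.
- move=> x [Sx xr] /=; apply: F0 => // i Qi xE; apply: xr.
  by rewrite /= xE map_f // mem_enum.
- by move=> x /= /mapP[j]; rewrite mem_enum => Qj ->; exact: hS.
by rewrite -fsbig_seq // big_map big_enum.
Qed.

Section Colours.
Context (P : palette).

Definition col_of_var (w : var P) : vcolour P :=
  match w with
  | inl (inl (existT mk a)) => Coupon mk.1 mk.2 (inl a)
  | inl (inr (existT k b)) => Cyclic k (inl b)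
  | inr (existT k g) => Symmetric k (inl g)
  end.

Lemma var_of_col w : var_of (col_of_var w) = Some w.
Proof. by case: w => [[[[m k] a]|[k b]]|[k g]]. Qed.

Lemma col_of_var_inj : injective col_of_var.
Proof. by move=> w w' ww; apply: Some_inj; rewrite -!var_of_col ww. Qed.

Lemma col_of_var_ordinary w : ordinary (col_of_var w).
Proof. by rewrite /ordinary var_of_col. Qed.

Lemma var_of_Some c w : var_of c = Some w -> c = col_of_var w.
Proof.
by case: c => [m k [a|a]|k [b|b]|k [g|g]] //= [<-].
Qed.

Lemma colour_monomial_col w : colour_monomial (col_of_var w) = ucm w.
Proof. by rewrite /colour_monomial var_of_col. Qed.

End Colours.

Section Series.
Context (R : realType) (V : vectType R) (ip : {dot V for idfun}).
Context (n : nat) (e : n.-tuple V) (P : palette) (A : feynman_algebra R n P).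

Local Notation C := R[i].
Local Notation vhat v := (to_vecC e v).

Lemma potential_coefE v w : potential_coef ip e A v w =
  vertex_form ip e A (col_of_var w) (nseq (nin (col_of_var w)) (vhat v))
    (nseq (nout (col_of_var w)) (vhat v)) / (symfactor (col_of_var w))%:R.
Proof. by case: w => [[[[m k] a]|[k b]]|[k g]] //=; rewrite divr1. Qed.

Lemma potentialE v (N : cmonom (var P)) :
  potential ip e A v N = \sum_(w \in [set: var P]) potential_coef ip e A v w *+ (ucm w == N).
Proof. by apply: eq_fsbigr => w _; exact: mcoeffU. Qed.

Lemma ucm_inj : injective (@ucm (var P)).
Proof.
move=> w w' /eqP/cmP/(_ w); rewrite !ucmE eqxx; by case: eqP.
Qed.

Lemma potential_ucm v w : potential ip e A v (ucm w) = potential_coef ip e A v w.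
Proof.
rewrite potentialE (@fsbig_inj _ _ unit xpredT _ (fun=> w)) //.
- by rewrite (big_pred1 tt) ?eqxx // => -[].
- by move=> [] [].
move=> w' _ /(_ tt isT) ww; case: eqP => // /ucm_inj //.
Qed.

Lemma potential_eq0 v (N : cmonom (var P)) : (forall w, N <> ucm w) ->
  potential ip e A v N = 0.
Proof.
move=> NU; rewrite potentialE; apply: fsbig1 => w _.
by case: eqP => // /esym/NU.
Qed.

Section Powers.
Context (s : seq (var P)).

Local Notation W := (seq_sub s).

Definition monomial_of k (c : {ffun 'I_k -> W}) : cmonom (var P) :=
  \big[@mulcm _/onecm _]_i ucm (val (c i)).

Lemma ser_mul_potential v (g : xseries R P) (N : cmonom (var P)) :
  (forall w, (0 < N w)%N -> w \in s) ->
  ser_mul (potential ip e A v) g N =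
  \sum_(w : W | (0 < N (val w))%N)
    potential_coef ip e A v (val w) * g (divcm N (ucm (val w))).
Proof.
move=> Ns.
have divK w : (0 < N w)%N -> mulcm (ucm w) (divcm N (ucm w)) = N.
  move=> Nw; apply/eqP/cmP => w'; rewrite mulcmE divcmE ucmE.
  by case: eqP => [<-|_]; rewrite ?subn0 // subnKC.
rewrite /ser_mul (@fsbig_inj _ _ W (fun w => 0 < N (val w))%N _
  (fun w => (ucm (val w), divcm N (ucm (val w))))).
- by apply: eq_bigr => w _; rewrite /= potential_ucm.
- by move=> w w' _ _ [/ucm_inj/val_inj].
- by move=> w Nw /=; exact: divK.
move=> [p q] /= pq no; have [[w pw]|pU] := pselect (exists w, p = ucm w); last first.
  by rewrite potential_eq0 ?mul0r // => w pw; apply: pU; exists w.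
have Nw : (0 < N w)%N by rewrite -pq pw mulcmE ucmE eqxx.
case: (no (SeqSub (Ns _ Nw)) Nw); congr pair => //=.
apply/eqP/cmP => w'; rewrite divcmE -pw -pq mulcmE addKn //.
Qed.

(** A product of [k] linear forms, expanded. *)
Lemma ser_pow_potential v k (N : cmonom (var P)) :
  (forall w, (0 < N w)%N -> w \in s) ->
  iter k (ser_mul (potential ip e A v)) (@ser_one R P) N =
  \sum_(c : {ffun 'I_k -> W} | monomial_of c == N)
    \prod_i potential_coef ip e A v (val (c i)).
Proof.
elim: k N => [|k IHk] N Ns.
  rewrite /= /ser_one.
  have c0 (c : {ffun 'I_0 -> W}) : monomial_of c = onecm _ by rewrite /monomial_of big_ord0.
  under eq_bigl do rewrite c0.
  under eq_bigr do rewrite big_ord0.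
  rewrite eq_sym; case: eqP => _; last by rewrite big_pred0.
  by rewrite sumr_const card_ffun card_ord expn0.
rewrite iterS ser_mul_potential //.
pose h (p : W * {ffun 'I_k -> W}) : {ffun 'I_k.+1 -> W} :=
  [ffun i => if unlift ord0 i is Some j then p.2 j else p.1].
pose h' (c : {ffun 'I_k.+1 -> W}) := (c ord0, [ffun j => c (lift ord0 j)]).
have h0 p : h p ord0 = p.1 by rewrite ffunE unlift_none.
have hS p j : h p (lift ord0 j) = p.2 j by rewrite ffunE liftK.
rewrite [RHS](reindex h) /=; last first.
  exists h' => [p _|c _].
    rewrite /h' h0 [RHS]surjective_pairing; congr pair.
    by apply/ffunP => j; rewrite ffunE hS.
  apply/ffunP => i; rewrite ffunE; case: unliftP => [j ->|->] //=.
  by rewrite ffunE.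
have hm p : monomial_of (h p) = mulcm (ucm (val p.1)) (monomial_of p.2).
  by rewrite /monomial_of big_ord_recl h0; congr (mulcm _ _); apply: eq_bigr => j _; rewrite hS.
rewrite (eq_bigr (fun w : W => \sum_(c : {ffun 'I_k -> W} | monomial_of c == divcm N (ucm (val w)))
    potential_coef ip e A v (val w) * \prod_i potential_coef ip e A v (val (c i)))); last first.
  move=> w Nw; rewrite IHk ?mulr_sumr // => w'.
  by rewrite divcmE => h0'; apply: Ns; apply: leq_trans h0' (leq_subr _ _).
rewrite pair_big_dep /=; apply: eq_big => [[w c]|[w c] _] /=; last first.
  by rewrite big_ord_recl h0; congr (_ * _); apply: eq_bigr => j _; rewrite hS.
rewrite hm /=; apply/andP/eqP => [[Nw /eqP cN]|<-].
  apply/eqP/cmP => w'; rewrite mulcmE cN divcmE ucmE.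
  by case: eqP => [<-|_]; rewrite ?subn0 // subnKC.
rewrite mulcmE ucmE eqxx; split => //.
by apply/cmP => w'; rewrite divcmE mulcmE addKn.
Qed.

Lemma monomial_ofE k (c : {ffun 'I_k -> W}) w :
  monomial_of c w = (\sum_i (val (c i) == w))%N.
Proof.
rewrite /monomial_of (big_morph (fun N : cmonom (var P) => N w) (id1 := 0%N) (op1 := addn)).
- by apply: eq_bigr => i _; rewrite ucmE.
- by move=> m m'; rewrite mulcmE.
- exact: onecmE.
Qed.

Lemma sum_monomial_of k (c : {ffun 'I_k -> W}) (g : var P -> nat) :
  (\sum_(w : W) monomial_of c (val w) * g (val w) = \sum_i g (val (c i)))%N.
Proof.
transitivity (\sum_(w : W) \sum_i (val (c i) == val w) * g (val w))%N.
  by apply: eq_bigr => w _; rewrite monomial_ofE big_distrl.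
rewrite exchange_big /=; apply: eq_bigr => i _.
rewrite (bigD1 (c i)) //= eqxx mul1n big1 ?addn0 // => w wc.
by rewrite val_eqE eq_sym (negbTE wc).
Qed.

Definition degree_of (N : cmonom (var P)) : nat := (\sum_(w : W) N (val w))%N.

Lemma degree_of_monomial k (c : {ffun 'I_k -> W}) : degree_of (monomial_of c) = k.
Proof.
have := sum_monomial_of c (fun=> 1%N).
rewrite sum_nat_const card_ord muln1; apply: etrans.
by apply: eq_bigr => w _; rewrite muln1.
Qed.

(** The potential being linear in the variables, only the power whose order is
    the degree of the monomial contributes. *)
Lemma ser_exp_potential v (N : cmonom (var P)) :
  (forall w, (0 < N w)%N -> w \in s) ->
  ser_exp (potential ip e A v) N =
  (\sum_(c : {ffun 'I_(degree_of N) -> W} | monomial_of c == N)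
    \prod_i potential_coef ip e A v (val (c i))) / (degree_of N)`!%:R.
Proof.
move=> Ns; rewrite /ser_exp (@fsbig_inj _ _ unit xpredT _ (fun=> degree_of N)).
- by rewrite (big_pred1 tt) ?ser_pow_potential // => -[].
- by move=> [] [].
- by [].
move=> k _ /(_ tt isT) kN; rewrite ser_pow_potential // big_pred0 ?mul0r // => c.
by apply/eqP => cN; apply: kN; rewrite -cN degree_of_monomial.
Qed.

End Powers.

Lemma ser_mul_monomial (a : C) (m : cmonom (var P)) (g : xseries R P) (M : cmonom (var P)) :
  ser_mul (ser_of_poly (mkmalgU m a)) g M =
  if `[< exists N, M = mulcm m N >] then a * g (divcm M m) else 0.
Proof.
case: asboolP => [[N MN]|noN].
  have MD : divcm M m = N by apply/eqP/cmP => w; rewrite divcmE MN mulcmE addKn.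
  rewrite /ser_mul (@fsbig_inj _ _ unit xpredT _ (fun=> (m, N))).
  - rewrite (big_pred1 tt) => [|[] //]; rewrite /ser_of_poly MD.
    by congr (_ * _); rewrite mcoeffU eqxx.
  - by move=> [] [].
  - by [].
  move=> [p q] /= pq /(_ tt isT) no; rewrite /ser_of_poly.
  have [mp|mp] := eqVneq m p; last first.
    by rewrite [mcoeff _ _](_ : _ = 0) ?mul0r // mcoeffU (negbTE mp).
  case: no; congr pair => //; apply/eqP/cmP => w.
  have := congr1 (fun N : cmonom (var P) => N w) (etrans pq MN).
  by rewrite /= !mulcmE -mp => /addnI.
apply: fsbig1 => -[p q] /= pq; rewrite /ser_of_poly.
have [mp|mp] := eqVneq m p; first by case: noN; exists q; rewrite -pq mp.
by rewrite [mcoeff _ _](_ : _ = 0) ?mul0r // mcoeffU (negbTE mp).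
Qed.

End Series.

(** * Expectations of complex polynomials *)

Section ComplexExpectation.
Context (R : realType) (V : vectType R) (ip : {dot V for idfun}).
Context (n : nat) (nV : n = \dim {:V}) (u : 'I_n -> V).
Hypothesis ou : orthonormal_family ip u.
Context (dv : {measure set (hilbert ip) -> \bar R}).
Hypothesis dv_inv : translation_invariant dv.
Hypothesis dv_nontrivial : nontrivial_measure dv.

Local Notation H := (hilbert ip).
Local Notation C := R[i].
Local Notation exp_growth := (@exp_growth R V ip n u).

Definition cexp_growth (f : H -> C) : Prop :=
  exp_growth (fun v => complex.Re (f v)) /\ exp_growth (fun v => complex.Im (f v)).

Definition cexpectation (f : H -> C) : C := cintegral (gaussian dv) f.

Lemma cexpectationE f : cexpectation f =
  Complex (expectation dv (fun v => complex.Re (f v))) (expectation dv (fun v => complex.Im (f v))).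
Proof. by []. Qed.

Lemma cexp_growth_cintegrable f : cexp_growth f -> cintegrable (gaussian dv) f.
Proof.
by move=> [f1 f2]; split; apply: (exp_growth_integrable nV ou dv_inv dv_nontrivial).
Qed.

Lemma cexp_growth_real r : exp_growth r -> cexp_growth (fun v => (r v)%:C%C).
Proof. by move=> er; split => //; exact: exp_growth_cst. Qed.

Lemma cexp_growth_cst (c : C) : cexp_growth (cst c).
Proof. by split; exact: exp_growth_cst. Qed.

Lemma cexp_growthD f g : cexp_growth f -> cexp_growth g ->
  cexp_growth (fun v => f v + g v).
Proof.
move=> [f1 f2] [g1 g2]; split.
  rewrite (_ : (fun v => _) = fun v => complex.Re (f v) + complex.Re (g v)); first exact: exp_growthD.
  by apply/funext => v; case: (f v) => ? ?; case: (g v).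
rewrite (_ : (fun v => _) = fun v => complex.Im (f v) + complex.Im (g v)); first exact: exp_growthD.
by apply/funext => v; case: (f v) => ? ?; case: (g v).
Qed.

Lemma cexp_growthM f g : cexp_growth f -> cexp_growth g ->
  cexp_growth (fun v => f v * g v).
Proof.
move=> [f1 f2] [g1 g2]; split.
  rewrite (_ : (fun v => _) = fun v => complex.Re (f v) * complex.Re (g v) - complex.Im (f v) * complex.Im (g v)).
    by apply: exp_growthB; exact: exp_growthM.
  by apply/funext => v; case: (f v) => ? ?; case: (g v).
rewrite (_ : (fun v => _) = fun v => complex.Re (f v) * complex.Im (g v) + complex.Im (f v) * complex.Re (g v)).
  by apply: exp_growthD; exact: exp_growthM.
by apply/funext => v; case: (f v) => ? ?; case: (g v).
Qed.

Lemma cexp_growth_sum (I : Type) (s : seq I) (Q : pred I) (F : I -> H -> C) :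
  (forall i, cexp_growth (F i)) -> cexp_growth (fun v => \sum_(i <- s | Q i) F i v).
Proof.
move=> eF; elim: s => [|i s IHs].
  rewrite (_ : (fun v => _) = cst 0); first exact: cexp_growth_cst.
  by apply/funext => v; rewrite big_nil.
rewrite (_ : (fun v => _) = fun v => (if Q i then F i v else 0) + \sum_(j <- s | Q j) F j v).
  by apply: cexp_growthD => //; case: (Q i) => //; exact: cexp_growth_cst.
by apply/funext => v; rewrite big_cons; case: (Q i); rewrite ?add0r.
Qed.

Lemma cexp_growth_prod (I : Type) (s : seq I) (Q : pred I) (F : I -> H -> C) :
  (forall i, cexp_growth (F i)) -> cexp_growth (fun v => \prod_(i <- s | Q i) F i v).
Proof.
move=> eF; elim: s => [|i s IHs].
  rewrite (_ : (fun v => _) = cst 1); first exact: cexp_growth_cst.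
  by apply/funext => v; rewrite big_nil.
rewrite (_ : (fun v => _) = fun v => (if Q i then F i v else 1) * \prod_(j <- s | Q j) F j v).
  by apply: cexp_growthM => //; case: (Q i) => //; exact: cexp_growth_cst.
by apply/funext => v; rewrite big_cons; case: (Q i); rewrite ?mul1r.
Qed.

Lemma cexpectation_real r : cexpectation (fun v => (r v)%:C%C) = (expectation dv r)%:C%C.
Proof.
rewrite cexpectationE /=; congr Complex.
exact: (expectation_cst nV ou dv_inv dv_nontrivial).
Qed.

Lemma cexpectationD f g : cexp_growth f -> cexp_growth g ->
  cexpectation (fun v => f v + g v) = cexpectation f + cexpectation g.
Proof.
move=> [f1 f2] [g1 g2]; rewrite !cexpectationE.
transitivity (Complex (expectation dv (fun v => complex.Re (f v) + complex.Re (g v)))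
                      (expectation dv (fun v => complex.Im (f v) + complex.Im (g v)))).
  by congr Complex; congr expectation; apply/funext => v; case: (f v) => ? ?; case: (g v).
by rewrite !(expectationD nV ou dv_inv dv_nontrivial).
Qed.

Lemma cexpectationZ (c : C) f : cexp_growth f ->
  cexpectation (fun v => c * f v) = c * cexpectation f.
Proof.
move=> [f1 f2]; rewrite !cexpectationE; case: c => a b.
have Z k g : exp_growth g -> expectation dv (fun v => k * g v) = k * expectation dv g.
  exact: (expectationZ nV ou dv_inv dv_nontrivial).
transitivity (Complex
    (expectation dv (fun v => a * complex.Re (f v) - b * complex.Im (f v)))
    (expectation dv (fun v => a * complex.Im (f v) + b * complex.Re (f v)))).
  by congr Complex; congr expectation; apply/funext => v; case: (f v) => ? ?.
rewrite (expectationB nV ou dv_inv dv_nontrivial); [|exact: exp_growthZ|exact: exp_growthZ].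
rewrite (expectationD nV ou dv_inv dv_nontrivial); [|exact: exp_growthZ|exact: exp_growthZ].
by rewrite !Z.
Qed.

Lemma cexpectation_sum (I : Type) (s : seq I) (Q : pred I) (F : I -> H -> C) :
  (forall i, cexp_growth (F i)) ->
  cexpectation (fun v => \sum_(i <- s | Q i) F i v) =
  \sum_(i <- s | Q i) cexpectation (F i).
Proof.
move=> eF; have E0 : cexpectation (cst 0) = 0.
  rewrite -[RHS](mul0r (cexpectation (cst 0))) -cexpectationZ; last exact: cexp_growth_cst.
  by congr cexpectation; apply/funext => v; rewrite mul0r.
elim: s => [|i s IHs].
  by rewrite big_nil -E0; congr cexpectation; apply/funext => v; rewrite big_nil.
rewrite big_cons -IHs; case Qi : (Q i); last first.
  by congr cexpectation; apply/funext => v; rewrite big_cons Qi.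
rewrite -cexpectationD //; last exact: cexp_growth_sum.
by congr cexpectation; apply/funext => v; rewrite big_cons Qi.
Qed.

Definition coordC (k : 'I_n) (v : H) : C := (ip (v : V) (u k))%:C%C.

Lemma cexp_growth_coordC k : cexp_growth (coordC k).
Proof. exact/cexp_growth_real/(exp_growth_coord nV ou). Qed.

Lemma wick (F : finType) (m : F -> 'I_n) :
  cexpectation (fun v => \prod_f coordC (m f) v) = (num_pairings m [set: F]%SET)%:R.
Proof.
rewrite (_ : (fun v => _) = fun v : H => (\prod_(f in [set: F]%SET) ip (v : V) (u (m f)))%:C%C).
  rewrite cexpectation_real (wick_on nV ou dv_inv dv_nontrivial m).
  exact: (rmorph_nat (@real_complex R)).
apply/funext => v; rewrite rmorph_prod /=; apply: eq_bigl => f; by rewrite finset.inE.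
Qed.

End ComplexExpectation.

Section StarExpansion.
Context (R : realType) (V : vectType R) (ip : {dot V for idfun}).
Context (n : nat) (e : n.-tuple V) (e_basis : basis_of {:V} e) (u : 'I_n -> V).
Hypothesis ou : orthonormal_family ip u.
Context (P : palette) (A : feynman_algebra R n P).
Context (vert endp flag : finType) (colour : vert -> vcolour P).
Context (base : flag -> vert + endp) (leg : endp -> flag).
Context (ins outs : vert -> seq flag).
Hypothesis legP : forall p f, (base f == inr p) = (f == leg p).
Hypothesis star_uniq : forall v, uniq (ins v ++ outs v).
Hypothesis starP : forall v f, (f \in ins v ++ outs v) = (base f == inl v).
Hypothesis size_ins : forall v, size (ins v) = nin (colour v).
Hypothesis size_outs : forall v, size (outs v) = nout (colour v).

Local Notation form := (star_form ip e A colour ins outs).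
Local Notation y v k := (coordC u k (v : hilbert ip)).

(** On the right the vector [v] sits in every slot; expanding it in the
    orthonormal basis, slot by slot, gives the left-hand side. *)
Lemma star_expansion (a : {ffun endp -> 'I_n}) (v : hilbert ip) :
  \sum_(m : {ffun flag -> 'I_n} | [forall p, m (leg p) == a p])
    form (onb e u \o m) * (\prod_f y v (m f)) =
  (\prod_p y v (a p)) * form (fun=> to_vecC e (v : V)).
Proof.
have nV := size_basis_dim e_basis.
(* The label [None] stands for the vector [v], the others for the basis vectors;
   at an endpoint the label is prescribed. *)
pose wt f := if base f is inr p then y v (a p) else 1.
pose k f (j : option 'I_n) : R[i] := if j is None then wt f else 0.
pose p (f : flag) (j : option 'I_n) := to_vecC e (v : V).
pose k' f (j : option 'I_n) : R[i] := if j is Some i then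
  (if base f is inr q then (i == a q)%:R * y v i else y v i) else 0.
pose p' (f : flag) (j : option 'I_n) := if j is Some i then onb e u i else 0.
have := @multi_exchange _ flag (option 'I_n) (vecC R n) k k' p p' form.
have E f xi : \sum_j k f j * form (upd xi f (p f j)) = \sum_j k' f j * form (upd xi f (p' f j)).
  rewrite !big_option /k' mul0r add0r [X in _ + X]big1 => [|i _]; last by rewrite mul0r.
  rewrite addr0 /k /wt; case bf: (base f) => [v0|q].
    rewrite mul1r /p (to_vecC_lincomb e_basis ou).
    by rewrite (star_form_slot _ _ _ star_uniq starP size_ins size_outs _ _ _ bf).
  rewrite (star_form_external _ _ _ _ starP _ _ bf).
  rewrite (bigD1 (a q)) //= eqxx mul1r big1 ?addr0 => [|i iq].
    by rewrite (star_form_external _ _ _ _ starP _ _ bf).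
  by rewrite (negbTE iq) !mul0r.
move=> /(_ E) EE.
have legb q : base (leg q) = inr q by apply/eqP; rewrite legP.
have leg_i : injective leg.
  by move=> q q' /(congr1 base); rewrite !legb => -[].
transitivity (\sum_(L : {ffun flag -> option 'I_n})
    (\prod_f k' f (L f)) * form (fun f => p' f (L f))).
  rewrite sum_ffun_some => [|l f lf]; last first.
    by rewrite (bigD1 f) //= lf mul0r mul0r.
  rewrite big_mkcond; apply: eq_bigr => m _.
  have -> : form (fun f => p' f ([ffun i => Some (m i)] f)) = form (onb e u \o m).
    by congr star_form; apply/funext => f; rewrite ffunE.
  case: ifPn => [/forallP hm|/forallPn[q mq]].
    rewrite mulrC; congr (_ * _); apply: eq_bigr => f _; rewrite /k' ffunE.
    case bf: (base f) => [//|q]; have /eqP -> : f == leg q by rewrite -legP bf.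
    by rewrite hm mul1r.
  by rewrite (bigD1 (leg q)) //= /k' ffunE legb (negbTE mq) !mul0r.
rewrite -EE (bigD1 [ffun=> None]) //= [X in _ + X]big1 ?addr0 => [|L LN]; last first.
  have [f Lf] : exists f, L f <> None.
    apply: contrapT => no; case/eqP: LN; apply/ffunP => f; rewrite ffunE.
    by apply: contrapT => Lf; apply: no; exists f.
  by rewrite (bigD1 f) //=; case: (L f) Lf => // i _; rewrite /k !mul0r.
congr (_ * _); transitivity (\prod_f wt f).
  by apply: eq_bigr => f _; rewrite /k ffunE.
rewrite (bigID [pred f | f \in [set leg q | q in endp]%SET]) /=.
rewrite [X in _ * X]big1 ?mulr1 => [|f fl]; last first.
  rewrite /wt; case bf: (base f) => [//|q]; case/negP: fl.
  by apply/imsetP; exists q => //; apply/eqP; rewrite -legP bf.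
by rewrite (big_imset _ (in2W leg_i)) /=; apply: eq_bigr => q _; rewrite /wt legb.
Qed.

End StarExpansion.

(** * Invariance of the summands under isomorphism *)

Lemma card_flags (P : palette) (V E F : finType) (D : diagram P V E F) :
  (#|E| + \sum_v valence (colour D v))%N = #|F|.
Proof.
rewrite -[RHS]sum1_card (partition_big (base D) xpredT) //= big_sumType /= addnC.
congr (_ + _)%N.
  apply: eq_bigr => v _; rewrite sum1_card -(eq_card (fun f => starP D v f)).
  by rewrite (card_uniqP (star_uniq D v)) size_cat size_ins size_outs.
rewrite -sum1_card; apply: eq_bigr => p _.
by rewrite (eq_bigl (pred1 (leg D p))) ?big_pred1_eq // => f; rewrite legP.
Qed.

Section ExtensionInvariance.
Context (P : palette) (V E F : finType) (G : diagram P V E F).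

Definition conj_perm (T T' : finType) (h : T -> T') (h' : T' -> T)
    (K : cancel h h') (K' : cancel h' h) (s : {perm T}) : {perm T'} :=
  perm (inj_comp (can_inj K) (inj_comp (@perm_inj _ s) (can_inj K'))).

Lemma conj_permE (T T' : finType) (h : T -> T') (h' : T' -> T)
    (K : cancel h h') (K' : cancel h' h) (s : {perm T}) :
  conj_perm K K' s = h \o (s \o h') :> (T' -> T').
Proof. by apply/funext => z; rewrite permE. Qed.

Lemma conj_perm_inj (T T' : finType) (h : T -> T') (h' : T' -> T)
    (K : cancel h h') (K' : cancel h' h) : injective (conj_perm K K').
Proof.
move=> s t st; apply/permP => z.
have := congr1 (fun r : {perm T'} => h' (r (h z))) st.
by rewrite !permE /= !K.
Qed.

Lemma ext_aut_order_le (B B' : extension P E) :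
  ext_iso G B B' -> (ext_aut_order G B <= ext_aut_order G B')%N.
Proof.
move=> [gv [gf [fe [hv [hf [i1 i2]]]]]].
have [gv' K1 K1'] := iso_vert i1; have [gf' K2 K2'] := iso_flag i1.
have [fe' K3 K3'] := iso_endp i1; have [hv' K4 K4'] := iso_vert i2.
have [hf' K5 K5'] := iso_flag i2.
have j1 := is_iso_inv K1 K1' K3 K3' K2 K2' i1.
have j2 := is_iso_inv K4 K4' K3 K3' K5 K5' i2.
pose h (s : {perm V} * {perm F} * {perm E} * {perm 'I_(nvert B)} * {perm 'I_(nflag B)}) :=
  (conj_perm K1 K1' s.1.1.1.1, conj_perm K2 K2' s.1.1.1.2, conj_perm K3 K3' s.1.1.2,
   conj_perm K4 K4' s.1.2, conj_perm K5 K5' s.2).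
have h_inj : injective h.
  move=> [[[[a b] c] d] f] [[[[a' b'] c'] d'] f'].
  by rewrite /h /= => -[] /conj_perm_inj -> /conj_perm_inj -> /conj_perm_inj ->
    /conj_perm_inj -> /conj_perm_inj ->.
rewrite /ext_aut_order -(card_imset _ h_inj); apply: subset_leq_card.
apply/fintype.subsetP => t /imsetP[s /asboolP[l1 l2] ->].
apply/asboolP; split; rewrite /h /= !conj_permE.
  exact: is_iso_comp (is_iso_comp j1 l1) i1.
exact: is_iso_comp (is_iso_comp j2 l2) i2.
Qed.

Lemma ext_aut_order_iso (B B' : extension P E) :
  ext_iso G B B' -> ext_aut_order G B = ext_aut_order G B'.
Proof.
by move=> i; apply/eqP; rewrite eqn_leq !ext_aut_order_le //; exact: ext_iso_sym.
Qed.

Context (R : realType) (T : vectType R) (ip : {dot T for idfun}).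
Context (n : nat) (e : n.-tuple T) (e_basis : basis_of {:T} e) (u : 'I_n -> T).
Hypothesis ou : orthonormal_family ip u.
Context (A : feynman_algebra R n P).

Definition contraction (B : extension P E) : R[i] :=
  \sum_a tensor ip e u A G a * tensor ip e u A (rest B) a.

Lemma Z_contraction (B : extension P E) :
  Z ip e A G B = mkmalgU (mulcm (weight G) (weight (rest B))) (contraction B).
Proof.
transitivity ((\dim {:T})%:R ^+ circles G (rest B) *:
  (mkmalgU (weight (glue G (rest B)))
    (amplitude_coef ip e u A (glue G (rest B)) 0) : xpoly R P)).
  by congr (_ *: _); exact: (amplitude_orthonormal e_basis ou).
rewrite scale_mkmalgU weight_glue; congr mkmalgU.
rewrite -(size_basis_dim e_basis) -natrX.
exact: glue_contraction.
Qed.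

Lemma contraction_iso (B B' : extension P E) :
  ext_iso G B B' -> contraction B = contraction B'.
Proof.
move=> [gv [gf [fe [hv [hf [i1 i2]]]]]].
have [fe' K K'] := iso_endp i1.
pose r (a : {ffun E -> 'I_n}) : {ffun E -> 'I_n} := [ffun p => a (fe p)].
pose r' (a : {ffun E -> 'I_n}) : {ffun E -> 'I_n} := [ffun p => a (fe' p)].
rewrite /contraction (reindex r) /=; last first.
  by exists r' => a _; apply/ffunP => p; rewrite !ffunE ?K ?K'.
apply: eq_bigr => a _; apply/esym; congr (_ * _).
  exact: (tensor_iso _ _ _ _ i1).
exact: (tensor_iso _ _ _ _ i2).
Qed.

Lemma weight_ext_iso (B B' : extension P E) :
  ext_iso G B B' -> weight (rest B) = weight (rest B').
Proof. by move=> [gv [gf [fe [hv [hf [i1 i2]]]]]]; rewrite (weight_iso i2). Qed.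

End ExtensionInvariance.

(** * Summation over the complements *)

Section VertexExpansion.
Context (R : realType) (V : vectType R) (ip : {dot V for idfun}).
Context (n : nat) (e : n.-tuple V) (e_basis : basis_of {:V} e) (u : 'I_n -> V).
Hypothesis ou : orthonormal_family ip u.
Context (P : palette) (A : feynman_algebra R n P).

Definition vertex_polynomial (c : vcolour P) (v : hilbert ip) : R[i] :=
  vertex_form ip e A c (nseq (nin c) (to_vecC e (v : V)))
    (nseq (nout c) (to_vecC e (v : V))).

Lemma map_const (T T' : Type) (x : T') (s : seq T) :
  map (fun=> x) s = nseq (size s) x.
Proof. by elim: s => //= _ s ->. Qed.

(** The polynomial is a sum of monomials in the coordinates, by
    [star_expansion] for a single vertex without endpoints. *)
Lemma cexp_growth_vertex c : cexp_growth u (vertex_polynomial c).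
Proof.
pose N := valence c; pose ins := take (nin c) (enum 'I_N).
pose outs := drop (nin c) (enum 'I_N).
have szi : size ins = nin c by rewrite size_takel // size_enum_ord leq_addr.
have szo : size outs = nout c by rewrite size_drop size_enum_ord addKn.
pose base (f : 'I_N) : unit + void := inl tt.
pose leg0 (p : void) : 'I_N := match p with end.
pose a0 : {ffun void -> 'I_n} := [ffun p : void => match p with end].
have legP0 p f : (base f == inr p) = (f == leg0 p) by case: p.
have uniq0 (v : unit) : uniq (ins ++ outs) by rewrite cat_take_drop enum_uniq.
have starP0 v f : (f \in ins ++ outs) = (base f == inl v).
  by rewrite cat_take_drop mem_enum; case: v.
have h v := star_expansion e_basis ou A legP0 uniq0 starP0 (fun=> szi) (fun=> szo) a0 v.
suff -> : vertex_polynomial c = fun v : hilbert ip =>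
    \sum_(m : {ffun 'I_N -> 'I_n} | [forall p, m (leg0 p) == a0 p])
      star_form ip e A (fun=> c) (fun _ : unit => ins) (fun=> outs) (onb e u \o m) *
        \prod_f coordC u (m f) v.
  apply: cexp_growth_sum => m; apply: cexp_growthM; first exact: cexp_growth_cst.
  by apply: cexp_growth_prod => f; exact: (cexp_growth_coordC (size_basis_dim e_basis) ou).
apply/funext => v; rewrite h [X in X * _]big1 ?mul1r; last by case.
by rewrite /star_form (big_pred1 tt) => [|[]] //; rewrite !map_const szi szo.
Qed.

Lemma cexp_growth_amplitude (vert endp flag : finType) (D : diagram P vert endp flag) :
  cexp_growth u (fun v : hilbert ip => amplitude_coef ip e u A D (v : V)).
Proof.
rewrite (_ : (fun v => _) = fun v : hilbert ip =>
    \sum_a tensor ip e u A D a * \prod_p coordC u (a p) v).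
  apply: cexp_growth_sum => a; apply: cexp_growthM; first exact: cexp_growth_cst.
  by apply: cexp_growth_prod => f; exact: (cexp_growth_coordC (size_basis_dim e_basis) ou).
apply/funext => v; rewrite amplitude_coef_tensor; apply: eq_bigr => a _.
by congr (_ * _); exact: rmorph_prod.
Qed.

Lemma potential_coef_vertex (v : hilbert ip) w :
  potential_coef ip e A (v : V) w =
  vertex_polynomial (col_of_var w) v / (symfactor (col_of_var w))%:R.
Proof. exact: potential_coefE. Qed.

Lemma cexp_growth_potential w :
  cexp_growth u (fun v : hilbert ip => potential_coef ip e A (v : V) w).
Proof.
rewrite (_ : (fun v => _) = fun v : hilbert ip =>
    vertex_polynomial (col_of_var w) v * (symfactor (col_of_var w))%:R^-1).
  by apply: cexp_growthM; [exact: cexp_growth_vertex|exact: cexp_growth_cst].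
by apply/funext => v; exact: potential_coef_vertex.
Qed.

End VertexExpansion.

Section CodeSums.
Context (R : realType) (V : vectType R) (ip : {dot V for idfun}).
Context (n : nat) (e : n.-tuple V) (e_basis : basis_of {:V} e) (u : 'I_n -> V).
Hypothesis ou : orthonormal_family ip u.
Context (P : palette) (A : feynman_algebra R n P).
Context (dv : {measure set (hilbert ip) -> \bar R}).
Hypothesis dv_inv : translation_invariant dv.
Hypothesis dv_nontrivial : nontrivial_measure dv.
Context (E : finType).

Local Notation C := R[i].
Local Notation tensor := (tensor ip e u A).
Local Notation cexpectation := (@cexpectation R V ip dv).
Let nV := size_basis_dim e_basis.

Section Pairings.
Context (W : finType) (col : W -> vcolour P) (k nf : nat) (c : {ffun 'I_k -> W}).
Hypothesis nfE : (#|E| + \sum_v valence (col (c v)))%N = nf.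

Definition legs_and_vertices (a : {ffun E -> 'I_n}) (v : hilbert ip) : C :=
  (\prod_p coordC u (a p) v) * \prod_i vertex_polynomial e A (col (c i)) v.

(** For fixed colours and incidences, the sum over the edges is an expectation
    by Wick's formula, which no longer depends on the incidences. *)
Lemma sum_code_tensor a :
  \sum_(x : code E col k nf | c_col x == c) tensor (decode x) a =
  nf`!%:R * cexpectation (legs_and_vertices a).
Proof.
pose form (y : raw_code E W k nf) (m : {ffun 'I_nf -> 'I_n}) : C :=
  star_form ip e A (fun v => col (y.1.1 v)) (fun v => sk_ins y.1.2 v)
    (fun v => sk_outs y.1.2 v) (onb e u \o m).
pose legs (y : raw_code E W k nf) (m : {ffun 'I_nf -> 'I_n}) :=
  [forall p, m (sk_leg y.1.2 p) == a p].
pose T (y : raw_code E W k nf) : C :=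
  \sum_(m : {ffun 'I_nf -> 'I_n} | compatible m y.2 && legs y m) form y m.
transitivity (\sum_(x : code E col k nf | (val x).1.1 == c) T (val x)).
  by [].
rewrite -(@big_sub_cond _ _ _ _ (@code_ok P E W col k nf) (fun y => y.1.1 == c)).
transitivity (\sum_(s | skeleton_ok col c s)
    \sum_(o | pairing_on [set: 'I_nf]%SET o) T (c, s, o)).
  pose h (q : skeleton E k nf * {ffun 'I_nf -> 'I_nf}) : raw_code E W k nf := (c, q.1, q.2).
  pose h' (y : raw_code E W k nf) := (y.1.2, y.2).
  rewrite [RHS]pair_big_dep [LHS](reindex_onto h h') /=.
    by apply: eq_bigl => -[s o] /=; rewrite !eqxx !andbT.
  by move=> [[c' s] o] /= /andP[_ /eqP ->].
rewrite (eq_bigr (fun=> cexpectation (legs_and_vertices a))) => [|s sok].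
  by rewrite sumr_const card_skeletons // mulr_natl.
have /skeleton_okP[legP star_uniq starP size_ins size_outs] := sok.
rewrite (exchange_big_dep (fun m => legs (c, s, [ffun f => f]) m)) /=; last first.
  by move=> o m _ /andP[].
transitivity (\sum_(m | legs (c, s, [ffun f => f]) m)
   cexpectation (fun v => form (c, s, [ffun f => f]) m * \prod_f coordC u (m f) v)).
  apply: eq_bigr => m lm.
  rewrite (cexpectationZ nV ou dv_inv dv_nontrivial); last first.
    by apply: cexp_growth_prod => f; exact: (cexp_growth_coordC nV ou).
  rewrite (wick nV ou dv_inv dv_nontrivial) mulr_natr -sumr_const.
  by apply: eq_bigl => o; rewrite inE (_ : legs (c, s, o) m) ?andbT.
rewrite -(cexpectation_sum nV ou dv_inv dv_nontrivial); last first.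
  move=> m; apply: cexp_growthM; first exact: cexp_growth_cst.
  by apply: cexp_growth_prod => f; exact: (cexp_growth_coordC nV ou).
congr cexpectation; apply/funext => v.
transitivity ((\prod_p coordC u (a p) v) * star_form ip e A (fun v => col (c v))
   (fun v => sk_ins s v) (fun v => sk_outs s v) (fun=> to_vecC e (v : V))).
  exact: (star_expansion e_basis ou A legP star_uniq starP size_ins size_outs).
congr (_ * _); apply: eq_bigr => i _.
by rewrite !map_const size_ins size_outs.
Qed.

End Pairings.

Context (Vt F : finType) (G : diagram P Vt E F) (s : seq (var P)).

Local Notation W := (seq_sub s).

Definition col (w : W) : vcolour P := col_of_var (val w).

Lemma col_inj : injective col.
Proof. by move=> w w' /col_of_var_inj/val_inj. Qed.

Lemma col_ord w : ordinary (col w).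
Proof. exact: col_of_var_ordinary. Qed.

Lemma weight_decode k nf (x : code E col k nf) : weight (decode x) = monomial_of (c_col x).
Proof. by apply: eq_bigr => v _; exact: colour_monomial_col. Qed.

(** The coefficient of [mulcm (weight G) N] in the integrand of the theorem; see
    [ser_integrand]. *)
Definition integrand k (N : cmonom (var P)) (v : hilbert ip) : C :=
  (aut_order G)%:R^-1 * amplitude_coef ip e u A G (v : V) *
  ((\sum_(c : {ffun 'I_k -> W} | monomial_of c == N)
     \prod_i potential_coef ip e A (v : V) (val (c i))) / k`!%:R).

Lemma cexp_growth_integrand k N : cexp_growth u (integrand k N).
Proof.
apply: cexp_growthM.
  apply: cexp_growthM; first exact: cexp_growth_cst.
  exact: (cexp_growth_amplitude e_basis ou).
apply: cexp_growthM; last exact: cexp_growth_cst.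
apply: cexp_growth_sum => c; apply: cexp_growth_prod => i.
exact: (cexp_growth_potential e_basis ou).
Qed.

(** The factor [nf`!] from the incidences cancels, and the factors of [code_sym]
    turn the forms of the vertices into coefficients of the potential. *)
Lemma sum_code_contraction k nf (N : cmonom (var P)) :
  (forall c : {ffun 'I_k -> W}, monomial_of c = N ->
     (#|E| + \sum_v valence (col (c v)))%N = nf) ->
  \sum_(x : code E col k nf | monomial_of (c_col x) == N)
    (aut_order G * k`! * nf`! * code_sym col (c_col x))%:R^-1 *
      contraction G ip e u A (code_ext col_ord x) =
  cexpectation (integrand k N).
Proof.
move=> nfE.
rewrite (partition_big (@c_col P E W col k nf) (fun c => monomial_of c == N)) //=.
transitivity (\sum_(c : {ffun 'I_k -> W} | monomial_of c == N)
   cexpectation (fun v => (aut_order G)%:R^-1 * amplitude_coef ip e u A G (v : V) *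
     ((\prod_i potential_coef ip e A (v : V) (val (c i))) / k`!%:R))); last first.
  rewrite -(cexpectation_sum nV ou dv_inv dv_nontrivial); last first.
    move=> c; apply: cexp_growthM.
      apply: cexp_growthM; first exact: cexp_growth_cst.
      exact: (cexp_growth_amplitude e_basis ou).
    apply: cexp_growthM; last exact: cexp_growth_cst.
    by apply: cexp_growth_prod => i; exact: (cexp_growth_potential e_basis ou).
  by congr cexpectation; apply/funext => v; rewrite /integrand -mulr_sumr -mulr_suml.
apply: eq_bigr => c /eqP cN.
have e1 := nfE c cN.
pose K : C := (aut_order G * k`! * nf`! * code_sym col c)%:R^-1.
transitivity (K * \sum_a tensor G a * (nf`!%:R * cexpectation (legs_and_vertices col c a))).
  transitivity (K * \sum_(x : code E col k nf | c_col x == c)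
     contraction G ip e u A (code_ext col_ord x)).
    rewrite mulr_sumr; apply: eq_big => x.
      by apply/andP/idP => [[]//|/eqP xc]; rewrite xc cN !eqxx.
    by move=> /andP[_ /eqP ->].
  congr (_ * _); rewrite exchange_big /=; apply: eq_bigr => a _.
  by rewrite -mulr_sumr -(sum_code_tensor e1).
have [K' K'E] : exists K' : C, K' = (aut_order G)%:R^-1 * (k`!%:R^-1 * (code_sym col c)%:R^-1).
  by eexists.
have KE : K * nf`!%:R = K'.
  have nf0 : (nf`!%:R : C) != 0 by rewrite pnatr_eq0 -lt0n fact_gt0.
  have simp (x y z w t : C) : z * t = 1 -> x * y * z * w * t = x * (y * w).
    by move=> zt; rewrite -[RHS]mulr1 -zt; ring.
  by rewrite /K K'E !natrM !invfM; exact/simp/mulVf.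
have gL a : cexp_growth u (legs_and_vertices col c a).
  apply: cexp_growthM.
    by apply: cexp_growth_prod => p; exact: (cexp_growth_coordC nV ou).
  by apply: cexp_growth_prod => i; exact: (cexp_growth_vertex e_basis ou).
transitivity (cexpectation (fun v => \sum_a (K' * tensor G a) * legs_and_vertices col c a v)).
  rewrite (cexpectation_sum nV ou dv_inv dv_nontrivial); last first.
    by move=> a; apply: cexp_growthM => //; exact: cexp_growth_cst.
  rewrite mulr_sumr; apply: eq_bigr => a _.
  rewrite (cexpectationZ nV ou dv_inv dv_nontrivial) // -KE.
  by rewrite -!mulrA; congr (_ * _); rewrite mulrCA.
congr cexpectation; apply/funext => v.
transitivity (K' * (amplitude_coef ip e u A G (v : V) * \prod_i vertex_polynomial e A (col (c i)) v)).
  rewrite amplitude_coef_tensor mulr_suml mulr_sumr; apply: eq_bigr => a _.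
  rewrite -!mulrA /legs_and_vertices; congr (_ * (_ * (_ * _))).
  by apply/esym; exact: rmorph_prod.
have -> : \prod_i potential_coef ip e A (v : V) (val (c i)) =
    (\prod_i vertex_polynomial e A (col (c i)) v) / (code_sym col c)%:R.
  rewrite /code_sym natr_prod -prodf_div; apply: eq_bigr => i _.
  exact: potential_coef_vertex.
by rewrite K'E; move: (_^-1) (_^-1) (_^-1) => x y z; ring.
Qed.

End CodeSums.

(** * The Feynman expansion *)

Section Main.
Context (R : realType) (V : vectType R) (ip : {dot V for idfun}).
Context (n : nat) (e : n.-tuple V) (e_basis : basis_of {:V} e) (u : 'I_n -> V).
Hypothesis ou : orthonormal_family ip u.
Context (dv : {measure set (hilbert ip) -> \bar R}).
Hypothesis dv_inv : translation_invariant dv.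
Hypothesis dv_nontrivial : nontrivial_measure dv.
Context (P : palette) (A : feynman_algebra R n P).
Context (Vt E F : finType) (G : diagram P Vt E F) (s : seq (var P)).

Local Notation C := R[i].
Local Notation W := (seq_sub s).
Local Notation col := (@col P s).
Local Notation col_ord := (@col_ord P s).
Local Notation col_inj := (@col_inj P s).
Local Notation contraction := (contraction G ip e u A).
Local Notation cexpectation := (@cexpectation R V ip dv).

Section ClassSum.
Context (k nf : nat).
Local Notation code := (code E col k nf).
Local Notation code_ext := (code_ext (E := E) (k := k) (nf := nf) col_ord).

Lemma code_sym_iso (x x' : code) : ext_iso G (code_ext x) (code_ext x') ->
  code_sym col (c_col x) = code_sym col (c_col x').
Proof.
move=> [gv [gf [fe [hv [hf [_ i]]]]]].
rewrite /code_sym [RHS](reindex_inj (bij_inj (iso_vert i))) /=.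
by apply: eq_bigr => v _; have := iso_colour i v => /= ->.
Qed.

(** The members of a class among the codes share its weight equally. *)
Lemma class_sum (L : lmodType C) (S : set (extension P E)) (X : extension P E -> L)
    (Q : pred code) :
  (forall B B', ext_iso G B B' -> S B -> S B') ->
  (forall B B', ext_iso G B B' -> X B = X B') ->
  (forall x, Q x -> S (code_ext x)) ->
  (forall x x', ext_iso G (code_ext x) (code_ext x') -> Q x -> Q x') ->
  (forall B, S B -> X B <> 0 -> exists2 x, Q x & ext_iso G B (code_ext x)) ->
  \sum_(B \in iso_classes (ext_iso G) S) (ext_aut_order G B)%:R^-1 *: X B =
  \sum_(x | Q x) (aut_order G * k`! * nf`! * code_sym col (c_col x))%:R^-1 *:
    X (code_ext x).
Proof.
move=> SI XI QS QI cov.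
pose g (x : code) : L :=
  (aut_order G * k`! * nf`! * code_sym col (c_col x))%:R^-1 *: X (code_ext x).
transitivity (\sum_(x : {x : code | Q x}) g (val x)); last first.
  by rewrite -(big_sub Q).
apply: (groupoid_sum (@ext_iso_refl _ _ _ _ G) (@ext_iso_sym _ _ _ _ G)
  (@ext_iso_trans _ _ _ _ G) (r := fun th : {x : code | Q x} => code_ext (val th))).
- exact: SI.
- by move=> B B' BB; rewrite (ext_aut_order_iso BB) (XI _ _ BB).
- by move=> th; apply: QS; exact: valP.
- move=> B SB XB; have [|x Qx Bx] := cov B SB.
    by move=> X0; apply: XB; rewrite X0 scaler0.
  by exists (Sub x Qx).
move=> [x0 Qx0] /=.
rewrite -(@big_sub_cond _ _ _ _ Q (fun x => `[< ext_iso G (code_ext x0) (code_ext x) >]) g).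
rewrite (eq_bigr (fun=> g x0)) => [|x /andP[_ /asboolP i]]; last first.
  by rewrite /g (XI _ _ i) (code_sym_iso i).
rewrite (eq_bigl [pred x | `[< ext_iso G (code_ext x0) (code_ext x) >]]) => [|x]; last first.
  apply/andP/idP => [[]//|/asboolP i]; split; first exact: QI i Qx0.
  exact/asboolP.
rewrite sumr_const /g -[RHS]scaler_nat scalerA; congr (_ *: _).
rewrite -(ext_class_count G col_inj col_ord x0) natrM invfM.
set N := #|_|; have N0 : (N%:R : C) != 0.
  rewrite pnatr_eq0 -lt0n; apply/card_gt0P; exists x0; rewrite unfold_in.
  by apply/asboolP; exact: ext_iso_refl.
by rewrite mulrCA mulfV // mulr1.
Qed.

End ClassSum.

Section Coefficient.
Context (N : cmonom (var P)).
Hypothesis Ns : forall w, (0 < N w)%N -> w \in s.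

Local Notation k := (degree_of s N).
(** The number of germs of a complement of monomial [N]. *)
Definition code_flags : nat :=
  (#|E| + \sum_(w : W) N (val w) * valence (col w))%N.
Local Notation nf := code_flags.

Lemma code_flagsE j (c : {ffun 'I_j -> W}) : monomial_of c = N ->
  (#|E| + \sum_v valence (col (c v)))%N = nf.
Proof.
move=> cN; congr (_ + _)%N; rewrite -cN.
by apply/esym; exact: (sum_monomial_of c (fun w => valence (col_of_var w))).
Qed.

(** The monomial of a complement determines its numbers of vertices and germs. *)
Lemma code_cover (B : extension P E) : weight (rest B) = N ->
  exists2 x : code E col k nf, monomial_of (c_col x) = N &
    ext_iso G B (code_ext col_ord x).
Proof.
move=> BN; pose w v := oget (@rest_ordinary P E B v).
have wE v : colour (rest B) v = col_of_var (w v).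
  by apply: var_of_Some; rewrite /w ogetK.
have NE : N = \big[@mulcm _/onecm _]_v ucm (w v).
  by rewrite -BN; apply: eq_bigr => v _; rewrite wE colour_monomial_col.
have ws v : w v \in s.
  by apply: Ns; rewrite NE (bigD1 v) //= mulcmE ucmE eqxx.
pose c : {ffun 'I_(nvert B) -> W} := [ffun v => SeqSub (ws v)].
have cN : monomial_of c = N.
  by rewrite NE; apply: eq_bigr => v _; rewrite ffunE.
have colE v : colour (rest B) v = col (c v) by rewrite wE ffunE.
have kE : nvert B = k by rewrite -cN degree_of_monomial.
have nfE : nflag B = nf.
  rewrite -[nflag B]card_ord -(card_flags (rest B)) -(code_flagsE cN).
  by congr (_ + _)%N; apply: eq_bigr => v _; rewrite colE.
have [x xc xi] := encode colE.
have : ext_iso G B (code_ext col_ord x).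
  by exists id, id, id, id, id; split => //; exact: is_iso_id.
have : monomial_of (c_col x) = N by rewrite xc.
by move: x {xc xi}; rewrite kE nfE => x; exists x.
Qed.

Lemma weight_code_iso j l (x x' : code E col j l) :
  ext_iso G (code_ext col_ord x) (code_ext col_ord x') ->
  monomial_of (c_col x) == N -> monomial_of (c_col x') == N.
Proof.
by move=> /weight_ext_iso i; rewrite -!weight_decode; move: i => /= ->.
Qed.

Definition code_sum : C := \sum_(x : code E col k nf | monomial_of (c_col x) == N)
    (aut_order G * k`! * nf`! * code_sym col (c_col x))%:R^-1 *
      contraction (code_ext col_ord x).

Lemma code_sumE : code_sum = cexpectation (integrand e u A G s k N).
Proof.
apply: (sum_code_contraction e_basis ou A dv_inv dv_nontrivial G) => c.
exact: code_flagsE.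
Qed.

Lemma ser_integrand (v : hilbert ip) :
  ser_mul (ser_of_poly ((aut_order G)%:R^-1 *: amplitude ip e A G (v : V)))
    (ser_exp (potential ip e A (v : V))) (mulcm (weight G) N) =
  integrand e u A G s k N v.
Proof.
transitivity (ser_mul (ser_of_poly (mkmalgU (weight G)
    ((aut_order G)%:R^-1 * amplitude_coef ip e u A G v)))
    (ser_exp (potential ip e A v)) (mulcm (weight G) N)).
  congr (ser_mul (ser_of_poly _) _ _); rewrite -scale_mkmalgU; congr (_ *: _).
  exact: (amplitude_orthonormal e_basis ou).
rewrite ser_mul_monomial; case: asboolP => [_|[]]; last by exists N.
have -> : divcm (mulcm (weight G) N) (weight G) = N.
  by apply/eqP/cmP => w; rewrite divcmE mulcmE addKn.
by rewrite (ser_exp_potential _ _ _ _ Ns).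
Qed.

Lemma expect_coefficient : expect ip e A G (mulcm (weight G) N) = code_sum.
Proof.
pose X (B : extension P E) : C^o := mcoeff (mulcm (weight G) N) (Z ip e A G B).
have XE B : X B = contraction B *+ (weight (rest B) == N).
  rewrite /X (Z_contraction G e_basis ou A).
  transitivity (contraction B *+ (mulcm (weight G) (weight (rest B)) == mulcm (weight G) N)).
    exact: mcoeffU.
  congr (_ *+ _); congr nat_of_bool; apply/eqP/eqP => [h|-> //].
  apply/eqP/cmP => w; have := congr1 (fun M : cmonom (var P) => M w) h.
  by rewrite /= !mulcmE => /addnI.
transitivity (\sum_(B \in iso_classes (ext_iso G) [set: extension P E])
    (ext_aut_order G B)%:R^-1 *: X B); first by [].
rewrite (@class_sum k nf _ _ _ (fun x => monomial_of (c_col x) == N)).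
- apply: eq_bigr => x /eqP xN; rewrite XE /=.
  by rewrite (weight_decode x) xN eqxx.
- by [].
- by move=> B B' i; rewrite !XE (contraction_iso ip e u A i) (weight_ext_iso i).
- by [].
- exact: weight_code_iso.
move=> B _; rewrite XE; have [BN _|_ []//] := eqVneq (weight (rest B)) N.
by have [x /eqP xN Bx] := code_cover BN; exists x.
Qed.

End Coefficient.

End Main.

Section Closures.
Context (R : realType) (V : vectType R) (ip : {dot V for idfun}).
Context (n : nat) (e : n.-tuple V) (e_basis : basis_of {:V} e) (u : 'I_n -> V).
Hypothesis ou : orthonormal_family ip u.
Context (P : palette) (A : feynman_algebra R n P).
Context (Vt E F : finType) (G : diagram P Vt E F).

Lemma weight_closure (B : extension P E) : closures B -> weight (rest B) = onecm _.
Proof.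
move=> B0; apply: big1 => v _; exfalso.
by have := ltn_ord v; rewrite [X in (_ < X)%N]B0.
Qed.

Lemma nil_cover (w : var P) : (0 < onecm (var P) w)%N -> w \in [::].
Proof. by rewrite onecmE. Qed.

(** Closures are the complements of trivial monomial. *)
Lemma expect_closuresE : expect_closures ip e A G =
  mkmalgU (weight G) (code_sum ip e u A G [::] (onecm _)).
Proof.
pose k := degree_of [::] (onecm (var P)).
have k0 : k = 0%N.
  by apply: big1 => w _; exact: onecmE.
pose nf := code_flags E [::] (onecm (var P)).
pose X (B : extension P E) : xpoly R P := Z ip e A G B.
pose Q (x : code E (@col P [::]) k nf) := monomial_of (c_col x) == onecm _.
pose a (x : code E (@col P [::]) k nf) : R[i] :=
  (aut_order G * k`! * nf`! * code_sym (@col P [::]) (c_col x))%:R^-1.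
have XE B : X B = mkmalgU (mulcm (weight G) (weight (rest B))) (contraction G ip e u A B).
  exact: (Z_contraction G e_basis ou A).
transitivity (\sum_(x | Q x) a x *: X (code_ext (@col_ord P [::]) x)).
  have h := @class_sum R P Vt E F G [::] k nf (xpoly R P) (@closures P E) X Q.
  transitivity (\sum_(B \in iso_classes (ext_iso G) (@closures P E)) (ext_aut_order G B)%:R^-1 *: X B).
    reflexivity.
  apply: h => [|||x x' xx|].
  - move=> B B' i; rewrite /closures /= => B0.
    by rewrite -(ext_iso_nvert i).
  - move=> B B' i; rewrite (XE B) (XE B').
    rewrite (weight_ext_iso i) (contraction_iso ip e u A i); reflexivity.
  - by move=> x _; exact: k0.
  - exact: (weight_code_iso xx).
  move=> B B0 _; have [x /eqP xN Bx] := code_cover G nil_cover (weight_closure B0).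
  by exists x.
transitivity (\sum_(x | Q x) (mkmalgU (weight G)
    (a x * contraction G ip e u A (code_ext (@col_ord P [::]) x)) : xpoly R P)).
  apply: eq_bigr => x /eqP xN.
  have wE : mulcm (weight G) (weight (decode x)) = weight G.
    rewrite (weight_decode x) xN.
    by apply/eqP/cmP => w; rewrite mulcmE onecmE addn0.
  rewrite (XE (code_ext (@col_ord P [::]) x)).
  rewrite scale_mkmalgU [weight (rest _)]/(weight (decode x)).
  rewrite wE.
  reflexivity.
apply/esym; exact: (raddf_sum (@mkmalgU _ _ (weight G))).
Qed.

End Closures.

Theorem theorem11p1 (R : realType) (V : vectType R) (ip : {dot V for idfun})
    (n : nat) (e : n.-tuple V) (e_basis : basis_of {:V} e)
    (dv : {measure set (hilbert ip) -> \bar R})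
    (dv_inv : translation_invariant dv) (dv_nontrivial : nontrivial_measure dv)
    (P : palette) (A : feynman_algebra R n P)
    (vert endp flag : finType) (G : diagram P vert endp flag) :
  (forall M : cmonom (var P),
     let f (v : hilbert ip) : R[i] :=
       mcoeff M (amplitude ip e A G v) / (aut_order G)%:R in
     cintegrable (gaussian dv) f /\
     mcoeff M (expect_closures ip e A G) = cintegral (gaussian dv) f) /\
  (forall M : cmonom (var P),
     let f (v : hilbert ip) : R[i] :=
       ser_mul
         (ser_of_poly ((aut_order G)%:R^-1 *: amplitude ip e A G v))
         (ser_exp (potential ip e A v)) M in
     cintegrable (gaussian dv) f /\
     expect ip e A G M = cintegral (gaussian dv) f).
Proof.
have nV := size_basis_dim e_basis.
have [u ou] : exists u : 'I_n -> V, orthonormal_family ip u.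
  by rewrite nV; exact: orthonormal_basis_exists.
have zero_ok : cintegrable (gaussian dv) (fun=> 0 : R[i]) /\
    0 = cintegral (gaussian dv) (fun=> 0 : R[i]).
  split; first exact/(cexp_growth_cintegrable nV ou dv_inv dv_nontrivial)/cexp_growth_cst.
  have := cexpectationZ nV ou dv_inv dv_nontrivial 0 (cexp_growth_cst ip u 0).
  rewrite mul0r => h; rewrite -[LHS]h.
  by congr cintegral; apply/funext => v; rewrite mul0r.
split=> M f.
  have fE v : f v = (aut_order G)%:R^-1 * amplitude_coef ip e u A G (v : V) *+ (weight G == M).
    rewrite /f (amplitude_orthonormal e_basis ou A G) mulrC -mulrnAr; congr (_ * _).
    exact: mcoeffU.
  rewrite (expect_closuresE e_basis ou A G).
  have -> : mcoeff M (mkmalgU (weight G) (code_sum ip e u A G [::] (onecm _))) =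
      code_sum ip e u A G [::] (onecm _) *+ (weight G == M) by exact: mcoeffU.
  have [GM|GM] := eqVneq (weight G) M; last first.
    have -> : f = fun=> 0 by apply/funext => v; rewrite fE (negbTE GM).
    exact: zero_ok.
  have -> : f = integrand e u A G [::] (degree_of [::] (onecm (var P))) (onecm _).
    apply/funext => v; rewrite fE GM eqxx mulr1n -[LHS]mulr1; congr (_ * _).
    have k0 : degree_of [::] (onecm (var P)) = 0%N by apply: big1 => w _; exact: onecmE.
    rewrite k0 divr1 (eq_bigl xpredT) => [|c]; last first.
      by rewrite /monomial_of big_ord0 eqxx.
    under eq_bigr do rewrite big_ord0.
    by rewrite sumr_const card_ffun card_ord expn0.
  split; first exact/(cexp_growth_cintegrable nV ou dv_inv dv_nontrivial)/(cexp_growth_integrand e_basis ou).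
  exact: (code_sumE e_basis ou dv_inv dv_nontrivial A G).
have [[N MN]|noN] := pselect (exists N, M = mulcm (weight G) N); last first.
  have -> : f = fun=> 0.
    apply/funext => v; rewrite /f (amplitude_orthonormal e_basis ou A G) scale_mkmalgU.
    by rewrite ser_mul_monomial; case: asboolP => // -[N MN]; case: noN; exists N.
  split; first exact: zero_ok.1.
  rewrite -zero_ok.2; apply: fsbig1 => B _.
  rewrite (Z_contraction G e_basis ou A) [mcoeff _ _](_ : _ = 0) ?mulr0 //.
  transitivity (contraction G ip e u A B *+ (mulcm (weight G) (weight (rest B)) == M)).
    exact: mcoeffU.
  by case: eqP => // GM; case: noN; exists (weight (rest B)).
have [s Ns] : exists s : seq (var P), forall w, (0 < N w)%N -> w \in s.
  exists (finsupp N) => w; rewrite lt0n => Nw; by rewrite mem_finsupp.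
have -> : f = integrand e u A G s (degree_of s N) N.
  by apply/funext => v; rewrite /f MN (ser_integrand e_basis ou A G Ns).
split; first exact/(cexp_growth_cintegrable nV ou dv_inv dv_nontrivial)/(cexp_growth_integrand e_basis ou).
rewrite MN (expect_coefficient e_basis ou A G Ns).
exact: (code_sumE e_basis ou dv_inv dv_nontrivial A G).
Qed.
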